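(* Let $\mathcal T$ be a tree and let $(\alpha_n)_{n\in\mathcal N_M}$ be a given family of real numbers. Then $A_T$ generates a strongly continuous semigroup of operators on $\mathcal H$ if, and only if, $$\alpha_n\neq k_n\qquad\forall n\in\mathcal N_M.$$ Likewise, $A_N$ generates a strongly continuous semigroup of operators on $\mathcal H$ if, and only if, $\alpha_n\neq k_n$ for all $n\in\mathcal N_M$; and $A_D$ generates a strongly continuous semigroup of operators on $\mathcal H_0$ if, and only if, $\alpha_n\ne k_n$ for all $n\in\mathcal N_M$.
   Context: Network. $\mathcal T$ is a finite tree with nodes $n\in\mathcal N=\{0,\dots,N\}$ and edges $i\in\mathcal I=\{1,\dots,N\}$. The node $0$ is an external (simple, i.e. degree one) node called the root; edges are oriented away from the root. Each edge has length $1$ and is parametrized by $x\in[0,1]$, $x=0$ being its initial point and $x=1$ its final point. The numbering is such that edge $i$ has node $i$ as final point, and edge $1$ has the root as initial point. $\mathcal N_S$ and $\mathcal N_M$ denote the sets of simple (degree one, external) and multiple (internal) nodes. For $n\in\mathcal N_M$, $\mathcal I_n$ is the set of edges having node $n$ as initial point, and $k_n=\#\mathcal I_n+1\ge 2$ is the number of edges meeting at $n$ (degree-two internal nodes are allowed). Constants (wave speeds) $c_i>0$, $i\in\mathcal I$, are given. Spaces. $$\mathcal H=\Big\{(u_i,v_i)_{i\in\mathcal I}\in\prod_{i\in\mathcal I}[H^1(0,1)\times L^2(0,1)]:\ u_i(0)=u_n(1)\ \forall n\in\mathcal N_M,\ \forall i\in\mathcal I_n\Big\},$$ $$\mathcal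 H_0=\{(u_i,v_i)_{i\in\mathcal I}\in\mathcal H:\ u_1(0)=0\},$$ with the product norm. Operators. Each of $A_D,A_N,A_T$ acts by $(u_i,v_i)_{i\in\mathcal I}\mapsto(v_i,c_i^2u_{i,xx})_{i\in\mathcal I}$. Consider, for $(u_i,v_i)_{i\in\mathcal I}\in\prod_{i\in\mathcal I}[H^2(0,1)\times H^1(0,1)]$, the conditions (a) $c_nu_{n,x}(1)=-v_n(1)$ for $n\in\mathcal N_S\setminus\{0\}$; (b) $\sum_{i\in\mathcal I_n}c_iu_{i,x}(0)-c_nu_{n,x}(1)=-\alpha_nv_n(1)$ for $n\in\mathcal N_M$; (c) $u_i(0)=u_n(1)$ and $v_i(0)=v_n(1)$ for $n\in\mathcal N_M$, $i\in\mathcal I_n$. The domains are the sets of $(u_i,v_i)_{i\in\mathcal I}\in\prod_{i\in\mathcal I}[H^2(0,1)\times H^1(0,1)]$ satisfying (a), (b), (c) and, in addition: for $\mathcal D(A_D)\subset\mathcal H_0$: $u_1(0)=0$ and $v_1(0)=0$; for $\mathcal D(A_N)\subset\mathcal H$: $u_{1,x}(0)=0$; for $\mathcal D(A_T)\subset\mathcal H$: $c_1u_{1,x}(0)=v_1(0)$. *)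

(* Defs.v *)
From HB Require Import structures.
From mathcomp Require Import all_boot all_order all_algebra.
From mathcomp Require Import all_classical all_reals all_analysis.
From mathcomp Require Import measurable_realfun ring lra.

Set Implicit Arguments.
Unset Strict Implicit.
Unset Printing Implicit Defensive.

Import Order.TTheory GRing.Theory Num.Theory.
Import numFieldNormedType.Exports.

Local Open Scope classical_set_scope.
Local Open Scope ring_scope.

(** * Strongly continuous semigroups *)

Section Semigroups.
Context {R : realType} {V : normedModType R}.
Implicit Types (W D : set V) (S : R -> V -> V) (A : V -> V).

(** A strongly continuous semigroup of bounded linear operators on the linear
    subspace [W] of [V]; the values of [S t] outside [W], or for [t < 0], are
    irrelevant. *)
Definition C0_semigroup W S : Prop :=
  [/\ forall t, 0 <= t ->
        [/\ forall x, W x -> W (S t x),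
            forall (a : R) x y, W x -> W y ->
              S t (a *: x + y) = a *: S t x + S t y
          & exists M : R, forall x, W x -> `|S t x| <= M * `|x|],
      forall x, W x -> S 0 x = x,
      forall s t x, 0 <= s -> 0 <= t -> W x -> S (s + t) x = S s (S t x)
    & forall x, W x -> S t x @[t --> 0^'+] --> x].

(** [A], with domain [D], generates a strongly continuous semigroup on [W]:
    it coincides, domain included, with the infinitesimal generator of one. *)
Definition generates_C0_semigroup W D A : Prop :=
  exists S, C0_semigroup W S /\
    forall x y,
      (D x /\ A x = y) <->
      [/\ W x, W y & h^-1 *: (S h x - x) @[h --> 0^'+] --> y].

End Semigroups.

(** * The space L^2(0,1) *)

Section L2_space.
Context (R : realType).

Definition mu01 : set (measurableTypeR R) -> \bar R :=
  mrestr (@lebesgue_measure R) (measurable_itv `]0%R, 1%R[).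

HB.instance Definition _ := Measure.on mu01.

Let mu01_fin : fin_num_fun mu01.
Proof.
move=> A mA; rewrite ge0_fin_numE ?measure_ge0//.
rewrite (@le_lt_trans _ _ (@lebesgue_measure R `]0%R, 1%R[))//.
  rewrite /mu01 /mrestr; apply: le_measure; rewrite ?inE//.
  exact: measurableI.
by rewrite lebesgue_measure_itv/= lte_fin ltr01 -EFinD ltry.
Qed.

HB.instance Definition _ := @Measure_isFinite.Build _ _ _ mu01 mu01_fin.

Local Notation L2fun := (LfunType mu01 (lee1n 2)).

Definition L2null : {pred L2fun} :=
  fun f => `[< {ae mu01, forall x, f x = 0} >].

Let L2null_zmod : zmod_closed L2null.
Proof.
split; first by apply/asboolP; apply/aeW.
move=> f g /asboolP f0 /asboolP g0; apply/asboolP.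
apply: filterS2 f0 g0 => x /= fx gx.
by rewrite -[LHS]/(f x - g x) fx gx subr0.
Qed.

HB.instance Definition _ := GRing.isZmodClosed.Build L2fun L2null L2null_zmod.

(** Square integrable functions on ]0, 1[ up to almost everywhere equality. *)
Definition L2 : Type := Quotient.quot L2null.

HB.instance Definition _ := Choice.on L2.
HB.instance Definition _ := EqQuotient.on L2.
HB.instance Definition _ := GRing.Zmodule.on L2.
HB.instance Definition _ := ZmodQuotient.on L2.

Implicit Types (f g : L2) (p q : L2fun) (a : R).

Local Open Scope quotient_scope.

Lemma L2_eqP p q :
  reflect {ae mu01, forall x, p x = q x} (\pi_L2 p == \pi_L2 q).
Proof.
rewrite -Quotient.idealrBE; apply: (iffP (asboolP _)); apply: filterS => x /= e.
  by apply/eqP; rewrite -subr_eq0; apply/eqP.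
by rewrite -[LHS]/(p x - q x) e subrr.
Qed.

Lemma L2_reprP p : {ae mu01, forall x, repr (\pi_L2 p) x = p x}.
Proof. by apply/L2_eqP; rewrite reprK. Qed.

Definition L2scale a f : L2 := \pi_L2 (a *: repr f).

Lemma L2scale_pi a p : L2scale a (\pi_L2 p) = \pi_L2 (a *: p).
Proof.
apply/eqP/L2_eqP; apply: filterS (L2_reprP p) => x /= e.
by rewrite -[LHS]/(a * _) e.
Qed.

Lemma L2_ind (P : L2 -> Prop) : (forall p, P (\pi_L2 p)) -> forall f, P f.
Proof. by move=> Pp f; rewrite -[f]reprK. Qed.

Let L2scalerA a b f : L2scale a (L2scale b f) = L2scale (a * b) f.
Proof. by elim/L2_ind: f => p; do 3 rewrite L2scale_pi; rewrite scalerA. Qed.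

Let L2scale1r : left_id 1 L2scale.
Proof. by elim/L2_ind => p; rewrite L2scale_pi scale1r. Qed.

Let L2scalerDr : right_distributive L2scale +%R.
Proof.
move=> a; elim/L2_ind => p; elim/L2_ind => q.
by rewrite -[X in L2scale a X]pi_addr !L2scale_pi -pi_addr scalerDr.
Qed.

Let L2scalerDl f : {morph L2scale^~ f : a b / a + b}.
Proof.
by elim/L2_ind: f => p a b; rewrite !L2scale_pi -pi_addr scalerDl.
Qed.

HB.instance Definition _ :=
  GRing.Zmodule_isLmodule.Build R L2 L2scalerA L2scale1r L2scalerDr L2scalerDl.

Lemma L2_repr_linear a f g :
  {ae mu01, forall x, repr (a *: f + g) x = a * repr f x + repr g x}.
Proof.
have -> : a *: f + g = \pi_L2 (a *: repr f + repr g) by rewrite pi_addr reprK.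
exact: L2_reprP.
Qed.

End L2_space.

Section L2_norm.
Context (R : realType).
Local Notation L2fun := (LfunType (@mu01 R) (lee1n 2)).
Local Notation L2 := (L2 R).
Local Open Scope quotient_scope.
Implicit Types (f g : L2) (p q : L2fun) (a : R).

Definition L2norm f : R := fine 'N[@mu01 R]_2%:E[EFin \o repr f]%E.

Lemma L2norm_pi p : L2norm (\pi_L2 p) = fine 'N[@mu01 R]_2%:E[EFin \o p]%E.
Proof.
rewrite /L2norm unlock; congr (fine (_ `^ _)%E).
have mE (q : L2fun) :
    measurable_fun setT (EFin \o (fun x : measurableTypeR R => `|q x| `^ 2)).
  apply/measurable_EFinP.
  apply/(@measurableT_comp _ _ _ _ _ _ (fun x : R => x `^ 2)%R) => //.
  exact/measurableT_comp.
apply: ge0_ae_eq_integral => //; [exact: mE|exact: mE|..].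
- by move=> x _; exact: poweR_ge0.
- by move=> x _; exact: poweR_ge0.
- by apply: filterS (L2_reprP p) => x /= -> _.
Qed.

Let L2normD f g : L2norm (f + g) <= L2norm f + L2norm g.
Proof.
elim/L2_ind: f => p; elim/L2_ind: g => q.
by rewrite -pi_addr !L2norm_pi; exact: ler_LnormD.
Qed.

Let L2normZ a f : L2norm (a *: f) = `|a| * L2norm f.
Proof.
elim/L2_ind: f => p.
rewrite [X in L2norm X](L2scale_pi a p) !L2norm_pi.
by rewrite (LnormZ p a) -finite_norm_fine.
Qed.

Let L2norm0_eq0 f : L2norm f = 0 -> f = 0.
Proof.
elim/L2_ind: f => p; rewrite L2norm_pi => /fine_Lnormr_eq0 p0.
rewrite -[RHS]pi_zeror; apply/eqP/L2_eqP.
by apply: filterS p0 => x /(_ I) ->.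
Qed.

HB.instance Definition _ :=
  Lmodule_isNormed.Build R L2 L2normD L2normZ L2norm0_eq0.

End L2_norm.

Section l2_triangle.
Context (R : realType).

Lemma sum_cauchy (I : finType) (a b : I -> R) :
  \sum_i a i * b i <=
    Num.sqrt (\sum_i a i ^+ 2) * Num.sqrt (\sum_i b i ^+ 2).
Proof.
set A := \sum_i a i ^+ 2; set B := \sum_i b i ^+ 2.
have A0 : 0 <= A by apply: sumr_ge0 => i _; exact: sqr_ge0.
have B0 : 0 <= B by apply: sumr_ge0 => i _; exact: sqr_ge0.
have sA := sqr_sqrtr A0; have sB := sqr_sqrtr B0.
have sA0 := sqrtr_ge0 A; have sB0 := sqrtr_ge0 B.
have main s t : 2 * (s * t * \sum_i a i * b i) <= s ^+ 2 * A + t ^+ 2 * B.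
  rewrite !mulr_sumr -big_split/=; apply: ler_sum => i _.
  by have := sqr_ge0 (s * a i - t * b i); lra.
have [A00|Ane0] := eqVneq (Num.sqrt A) 0.
  rewrite A00 mul0r big1// => i _.
  have : A = 0 by rewrite -sA A00 expr0n.
  move/eqP; rewrite psumr_eq0; last by move=> j _; exact: sqr_ge0.
  move/allP/(_ i (mem_index_enum _)); rewrite /= sqrf_eq0 => /eqP ->.
  by rewrite mul0r.
have [B00|Bne0] := eqVneq (Num.sqrt B) 0.
  rewrite B00 mulr0 big1// => i _.
  have : B = 0 by rewrite -sB B00 expr0n.
  move/eqP; rewrite psumr_eq0; last by move=> j _; exact: sqr_ge0.
  move/allP/(_ i (mem_index_enum _)); rewrite /= sqrf_eq0 => /eqP ->.
  by rewrite mulr0.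
have Ap : 0 < Num.sqrt A by rewrite lt0r Ane0.
have Bp : 0 < Num.sqrt B by rewrite lt0r Bne0.
have ABp : 0 < Num.sqrt A * Num.sqrt B by rewrite mulr_gt0.
have := main (Num.sqrt B) (Num.sqrt A).
rewrite sA sB; set S := \sum_i _ => h.
rewrite -(ler_pM2l ABp).
have -> : Num.sqrt A * Num.sqrt B * (Num.sqrt A * Num.sqrt B) = A * B.
  by rewrite -{3}sA -{3}sB; ring.
by move: h; rewrite [Num.sqrt B * _]mulrC; lra.
Qed.

Lemma sum_minkowski (I : finType) (a b c : I -> R) :
  (forall i, 0 <= c i <= a i + b i) ->
  Num.sqrt (\sum_i c i ^+ 2) <=
    Num.sqrt (\sum_i a i ^+ 2) + Num.sqrt (\sum_i b i ^+ 2).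
Proof.
move=> cab; set A := Num.sqrt (\sum_i a i ^+ 2).
set B := Num.sqrt (\sum_i b i ^+ 2).
have sA : A ^+ 2 = \sum_i a i ^+ 2.
  by rewrite /A sqr_sqrtr ?sumr_ge0// => i _; exact: sqr_ge0.
have sB : B ^+ 2 = \sum_i b i ^+ 2.
  by rewrite /B sqr_sqrtr ?sumr_ge0// => i _; exact: sqr_ge0.
have A0 : 0 <= A by exact: sqrtr_ge0.
have B0 : 0 <= B by exact: sqrtr_ge0.
have AB := sum_cauchy a b; rewrite -/A -/B in AB.
rewrite -[leRHS]ger0_norm ?addr_ge0// -sqrtr_sqr ler_wsqrtr//.
apply: (@le_trans _ _ (\sum_i (a i ^+ 2 + b i ^+ 2 + 2 * (a i * b i)))).
  apply: ler_sum => i _; have /andP[c0 c1] := cab i.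
  have : c i ^+ 2 <= (a i + b i) ^+ 2 by rewrite lerXn2r// nnegrE (le_trans c0).
  by lra.
rewrite big_split/= big_split/= -mulr_sumr -sA -sB; lra.
Qed.

Lemma pair_minkowski (a1 a2 b1 b2 c1 c2 : R) :
  0 <= c1 <= a1 + b1 -> 0 <= c2 <= a2 + b2 ->
  Num.sqrt (c1 ^+ 2 + c2 ^+ 2) <=
    Num.sqrt (a1 ^+ 2 + a2 ^+ 2) + Num.sqrt (b1 ^+ 2 + b2 ^+ 2).
Proof.
move=> h1 h2; pose F (x y : R) (b : bool) := if b then x else y.
have := @sum_minkowski bool (F a1 a2) (F b1 b2) (F c1 c2).
by rewrite !big_bool/=; apply; case.
Qed.

End l2_triangle.

(** * The Sobolev spaces H^1(0,1) and H^2(0,1) *)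

Section H1_space.
Context (R : realType).
Local Notation L2 := (L2 R).

(** Weak derivatives are tested against C^1 functions with compact support in
    ]0, 1[. *)
Definition test_function (phi : R -> R) : Prop :=
  [/\ forall x, derivable phi x 1,
      continuous (derive1 phi)
    & exists a b : R, [/\ 0 < a, b < 1 &
        forall x, x \notin `[a, b] -> phi x = 0]].

Definition weak_derivative (u g : L2) : Prop :=
  forall phi, test_function phi ->
    \int[@mu01 R]_x (repr u x * derive1 phi x) = - \int[@mu01 R]_x (repr g x * phi x).

Definition H1graph : {pred L2 * L2} := fun p => `[< weak_derivative p.1 p.2 >].

Lemma continuous_Lfun (f : R -> R) : continuous f -> f \in Lfun (@mu01 R) 2%:E.
Proof.
move=> cf.
have mf : measurable_fun [set: measurableTypeR R] f.
  exact: continuous_measurable_fun.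
have m2 (g : measurableTypeR R -> R) : measurable_fun setT g ->
    measurable_fun setT (EFin \o (fun x : measurableTypeR R => `|g x| `^ 2)).
  move=> mg; apply/measurable_EFinP.
  apply/(@measurableT_comp _ _ _ _ _ _ (fun x : R => x `^ 2)%R) => //.
  exact/measurableT_comp.
have [M fM] : exists M : R, forall x, x \in `[0, 1]%R -> `|f x| <= M.
  have [|c _ cM] := @EVT_max R (fun x => `|f x|) 0 1 ler01.
    by apply: continuous_subspaceT => x; apply: cvg_norm; exact: cf.
  by exists `|f c|.
have M0 : 0 <= M by apply: le_trans (fM 0 _); rewrite ?in_itv/= ?lexx ?ler01.
have aeM : {ae @mu01 R, forall x, `|f x| <= M}.
  exists (~` `]0, 1[%classic); split; first exact: measurableC.
    by rewrite /mu01/= /mrestr setICl measure0.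
  move=> x /= nfx /=; rewrite in_itv/= => /andP[x0 x1]; apply: nfx.
  by apply: fM; rewrite in_itv/= !ltW.
rewrite inE; apply/andP; split; first by rewrite inE.
rewrite inE/= /finite_norm unlock poweR_lty//.
apply: (@le_lt_trans _ _ (\int[@mu01 R]_x (`|M| `^ 2)%:E)%E).
  apply: ae_ge0_le_integral => //.
  - by move=> x _; exact: poweR_ge0.
  - exact: m2.
  - apply: (@filterS _ _ (ae_filter_ringOfSetsType _) _ _ _ aeM) => x fxM _.
    by rewrite /= lee_fin ge0_ler_powR ?nnegrE// (le_trans fxM)// ler_norm.
rewrite [ltLHS](_ : _ = ((`|M| `^ 2)%:E * @mu01 R setT)%E); last first.
  exact: integral_cst.
rewrite lte_mul_pinfty// ?lee_fin ?powR_ge0//.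
by rewrite ltey_eq fin_num_measure.
Qed.

Lemma L2_integrable (u : L2) (f : R -> R) : continuous f ->
  (@mu01 R).-integrable setT (EFin \o (fun x => repr u x * f x)).
Proof.
move=> cf; apply/Lfun1_integrable.
exact: Lfun2_mul_Lfun1 (LfunP _) (continuous_Lfun cf).
Qed.

Lemma L2_int_linear (a : R) (u v : L2) (f : R -> R) : continuous f ->
  \int[@mu01 R]_x (repr (a *: u + v) x * f x) =
  a * \int[@mu01 R]_x (repr u x * f x) + \int[@mu01 R]_x (repr v x * f x).
Proof.
move=> cf; have iu := L2_integrable u cf; have iv := L2_integrable v cf.
have iau : (@mu01 R).-integrable setT
    (EFin \o (fun x => a * (repr u x * f x))).
  by apply: (eq_integrable measurableT _ _ _ (integrableZl measurableT a iu)).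
have iauv := integrableD measurableT iau iv.
rewrite -RintegralZl// -RintegralD//.
congr fine; apply: ae_eq_integral => //.
- exact: measurable_int (L2_integrable _ cf).
- exact: measurable_int iauv.
- apply: filterS (L2_repr_linear a u v) => x e _ /=.
  by rewrite e mulrDl mulrA.
Qed.

Lemma test_continuous phi : test_function phi ->
  continuous phi /\ continuous (derive1 phi).
Proof.
case=> dphi cdphi _; split => // x.
by apply: differentiable_continuous; exact/derivable1_diffP.
Qed.

Let H1graph_submod : submod_closed H1graph.
Proof.
have lin (a : R) (p q : L2 * L2) :
    H1graph p -> H1graph q -> H1graph (a *: p + q).
  move=> /asboolP hp /asboolP hq; apply/asboolP => phi tphi.
  have [cphi cdphi] := test_continuous tphi.
  rewrite L2_int_linear// L2_int_linear// hp// hq//; lra.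
split; last by move=> a p q; exact: lin.
apply/asboolP => phi tphi; have [cphi cdphi] := test_continuous tphi.
have int0 f : continuous f -> \int[@mu01 R]_x (repr (0 : L2) x * f x) = 0.
  move=> cf; have := L2_int_linear (-1) 0 0 cf.
  by rewrite scaler0 addr0; lra.
by rewrite !int0// oppr0.
Qed.

HB.instance Definition _ :=
  GRing.isSubmodClosed.Build R (L2 * L2)%type H1graph H1graph_submod.

(** An element of H^1(0,1) is recorded together with its weak derivative in
    L^2(0,1), by which the norm is computed. *)
Record H1 := MkH1 { H1_graph : L2 * L2; _ : H1_graph \in H1graph }.

HB.instance Definition _ := [isSub for H1_graph].
HB.instance Definition _ := [Choice of H1 by <:].
HB.instance Definition _ := [SubChoice_isSubLmodule of H1 by <:].

Definition H1fun (w : H1) : L2 := (H1_graph w).1.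
Definition wderiv (w : H1) : L2 := (H1_graph w).2.
Definition H1norm (w : H1) : R :=
  Num.sqrt (`|H1fun w| ^+ 2 + `|wderiv w| ^+ 2).

Let H1normD v w : H1norm (v + w) <= H1norm v + H1norm w.
Proof. by apply: pair_minkowski; rewrite normr_ge0 ler_normD. Qed.

Let H1normZ (a : R) w : H1norm (a *: w) = `|a| * H1norm w.
Proof.
rewrite /H1norm -[H1fun _]/(a *: H1fun w) -[wderiv _]/(a *: wderiv w).
rewrite !normrZ !exprMn -mulrDr sqrtrM ?sqr_ge0// sqrtr_sqr normr_id.
by [].
Qed.

Let H1norm0_eq0 w : H1norm w = 0 -> w = 0.
Proof.
move/eqP; rewrite sqrtr_eq0 => le0.
have /eqP : `|H1fun w| ^+ 2 + `|wderiv w| ^+ 2 == 0.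
  by rewrite eq_le le0 addr_ge0// sqr_ge0.
move/eqP; rewrite paddr_eq0 ?sqr_ge0// !sqrf_eq0 !normr_eq0 => /andP[/eqP u0 /eqP g0].
apply: val_inj => /=; rewrite [LHS]surjective_pairing.
by rewrite -[X in (X, _)]/(H1fun w) -[X in (_, X)]/(wderiv w) u0 g0.
Qed.

HB.instance Definition _ :=
  Lmodule_isNormed.Build R H1 H1normD H1normZ H1norm0_eq0.

End H1_space.

Section Traces.
Context (R : realType).

(** The continuous representative on [0, 1] of an element of H^1(0,1), which
    is unique on [0, 1]; boundary values are read off it. *)
Definition crep (w : H1 R) : R -> R :=
  get [set f : R -> R | {within `[0, 1], continuous f} /\
                        {ae @mu01 R, forall x, repr (H1fun w) x = f x}].

Definition isH1 (f : L2 R) : Prop := exists w : H1 R, H1fun w = f.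

(** [f] as an element of H^1(0,1); meaningful when [isH1 f]. *)
Definition toH1 (f : L2 R) : H1 R := get [set w | H1fun w = f].

Definition isH2 (u : H1 R) : Prop := isH1 (wderiv u).

(** First and second derivatives of [u]; meaningful when [isH2 u]. *)
Definition dx (u : H1 R) : H1 R := toH1 (wderiv u).
Definition dxx (u : H1 R) : L2 R := wderiv (dx u).

End Traces.

(** * The tree *)

(** The nodes are [0, ..., m + 1] and the edges [1, ..., m + 1], the edge
    numbered [i + 1] being represented by [i : 'I_m.+1]. *)
Definition node (m : nat) := 'I_m.+2.
Definition edge (m : nat) := 'I_m.+1.

Definition root_node {m} : node m := ord0.
Definition edge1 {m} : edge m := ord0.

(** Edge number [i + 1] has node [i + 1] as final point. *)
Definition fin_pt {m} (i : edge m) : node m := lift ord0 i.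

Section Incidence.
Context {m : nat} (init : edge m -> node m).

Definition out_edges (n : node m) : {set edge m} :=
  [set i | init i == n]%SET.

Definition degree (n : node m) : nat :=
  (#|[pred i | init i == n]| + #|[pred i | fin_pt i == n]|)%N.

Definition oriented_edge : rel (node m) :=
  fun a b => [exists i, (init i == a) && (fin_pt i == b)].

End Incidence.

(** Since the final points of the edges are pairwise distinct and are all the
    nodes but the root, the graph is a tree whose edges are oriented away from
    the root as soon as an oriented path leads from the root to any node. *)
Record tree (m : nat) := Tree {
  init_pt : edge m -> node m;
  init_edge1 : init_pt edge1 = root_node;
  root_simple : degree init_pt root_node = 1%N;
  tree_connected : forall n, connect (oriented_edge init_pt) root_node n
}.

Section Nodes.
Context {m : nat} (T : tree m).

Definition simple_node (n : node m) : Prop := degree (init_pt T) n = 1%N.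
Definition multiple_node (n : node m) : Prop := (1 < degree (init_pt T) n)%N.
Definition outgoing (n : node m) : {set edge m} := out_edges (init_pt T) n.
Definition knode (n : node m) : nat := #|outgoing n|.+1.

End Nodes.

(** * States of the network *)

Section State.
Context (R : realType) (m : nat).

(** Families [(u_i, v_i)_i] in the product of the H^1(0,1) x L^2(0,1). *)
Definition state := {ffun edge m -> H1 R * L2 R}.

HB.instance Definition _ := Choice.on state.
HB.instance Definition _ := GRing.Lmodule.on state.

Definition state_norm (x : state) : R :=
  Num.sqrt (\sum_i (`|(x i).1| ^+ 2 + `|(x i).2| ^+ 2)).

Let comp_norm (x : state) i := Num.sqrt (`|(x i).1| ^+ 2 + `|(x i).2| ^+ 2).

Let state_normE x : state_norm x = Num.sqrt (\sum_i comp_norm x i ^+ 2).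
Proof.
congr Num.sqrt; apply: eq_bigr => i _.
by rewrite /comp_norm sqr_sqrtr ?addr_ge0 ?sqr_ge0.
Qed.

Let state_normD x y : state_norm (x + y) <= state_norm x + state_norm y.
Proof.
rewrite !state_normE; apply: sum_minkowski => i; rewrite sqrtr_ge0/=.
by rewrite /comp_norm ffunE; apply: pair_minkowski; rewrite normr_ge0 ler_normD.
Qed.

Let state_normZ (a : R) x : state_norm (a *: x) = `|a| * state_norm x.
Proof.
rewrite -[in RHS](normr_id a) -[in RHS]sqrtr_sqr -sqrtrM ?sqr_ge0//.
rewrite mulr_sumr; congr Num.sqrt; apply: eq_bigr => i _.
by rewrite ffunE !normrZ !exprMn mulrDr.
Qed.

Let state_norm0_eq0 x : state_norm x = 0 -> x = 0.
Proof.
move/eqP; rewrite sqrtr_eq0 => le0.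
have ge0 i : 0 <= `|(x i).1| ^+ 2 + `|(x i).2| ^+ 2 by rewrite addr_ge0// sqr_ge0.
have : \sum_i (`|(x i).1| ^+ 2 + `|(x i).2| ^+ 2) == 0.
  by rewrite eq_le le0 sumr_ge0.
rewrite psumr_eq0// => /allP x0; apply/ffunP => i; rewrite ffunE.
have := x0 i (mem_index_enum _); rewrite /= paddr_eq0 ?sqr_ge0//.
rewrite !sqrf_eq0 !normr_eq0 => /andP[/eqP u0 /eqP v0].
by rewrite [LHS]surjective_pairing u0 v0.
Qed.

HB.instance Definition _ :=
  Lmodule_isNormed.Build R state state_normD state_normZ state_norm0_eq0.

End State.

(** * The spaces and the operators *)

Section Network.
Context {R : realType} {m : nat} (T : tree m).
Context (c : edge m -> R) (alpha : node m -> R).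
Implicit Types x : state R m.

(** Only the values of [alpha] at multiple nodes matter.

    As the root is simple, every multiple node is the final point of an edge
    [j], of the same number; such nodes are written [fin_pt j]. *)

Definition spaceH : set (state R m) := [set x |
  forall j, multiple_node T (fin_pt j) -> forall i, i \in outgoing T (fin_pt j) ->
    crep (x i).1 0 = crep (x j).1 1].

Definition spaceH0 : set (state R m) :=
  [set x | spaceH x /\ crep (x edge1).1 0 = 0].

Definition wave_op x : state R m :=
  [ffun i => (toH1 (x i).2, c i ^+ 2 *: dxx (x i).1)].

Definition H2_H1 x : Prop := forall i, isH2 (x i).1 /\ isH1 (x i).2.

Definition outer_cond x : Prop :=
  forall j, simple_node T (fin_pt j) ->
    c j * crep (dx (x j).1) 1 = - crep (toH1 (x j).2) 1.

Definition inner_cond x : Prop :=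
  forall j, multiple_node T (fin_pt j) ->
    \sum_(i in outgoing T (fin_pt j)) c i * crep (dx (x i).1) 0
      - c j * crep (dx (x j).1) 1
    = - alpha (fin_pt j) * crep (toH1 (x j).2) 1.

Definition continuity_cond x : Prop :=
  forall j, multiple_node T (fin_pt j) -> forall i, i \in outgoing T (fin_pt j) ->
    crep (x i).1 0 = crep (x j).1 1 /\
    crep (toH1 (x i).2) 0 = crep (toH1 (x j).2) 1.

Definition common_domain : set (state R m) := [set x |
  [/\ H2_H1 x, outer_cond x, inner_cond x & continuity_cond x]].

Definition domain_D : set (state R m) := [set x | common_domain x /\
  (crep (x edge1).1 0 = 0 /\ crep (toH1 (x edge1).2) 0 = 0)].

Definition domain_N : set (state R m) := [set x | common_domain x /\
  crep (dx (x edge1).1) 0 = 0].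

Definition domain_T : set (state R m) := [set x | common_domain x /\
  c edge1 * crep (dx (x edge1).1) 0 = crep (toH1 (x edge1).2) 0].

End Network.

(* Main.v *)
Require Import Defs.
From HB Require Import structures.
From mathcomp Require Import all_boot all_order all_algebra.
From mathcomp Require Import all_classical all_reals all_analysis.
From mathcomp Require Import measurable_realfun ring lra zify.

Set Implicit Arguments.
Unset Strict Implicit.
Unset Printing Implicit Defensive.

Import Order.TTheory GRing.Theory Num.Theory.
Import numFieldNormedType.Exports.

Local Open Scope classical_set_scope.
Local Open Scope ring_scope.

(** On each edge, the waves [v - c u_x] and [v + c u_x] are transported to the
    right and to the left with speed [c]. At a multiple node [n], the conditions
    of the domain amount to: all edges have the same velocity there, and this
    velocity multiplied by [k_n - alpha_n] is the sum of the incoming waves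
    ([kappa], [scatteringP]). The three operators differ only in the reflection
    coefficient of the root, 0, 1 or -1 ([domain_TE], [domain_NE],
    [domain_DE]), and are treated together.

    If [alpha_n] differs from [k_n] at all multiple nodes, then the waves that
    depart into the edges are a linear function of the waves that arrive at the
    nodes ([scatter_boundary]). Weighting the energy of the waves so that it
    grows steeply in the direction of propagation, the energy lost by the
    arriving waves outweighs the energy of the departing ones: the operator
    minus a constant is dissipative for an equivalent inner product
    ([energy_dissipation]). The equation [x - h A x = y] consists of transport
    equations with damping; a small [h] damps the waves so much that the
    coupling at the nodes is a small perturbation ([euler_range]). The theorem
    of Lumer and Phillips applies ([lumer_phillips]); it is obtained from the
    convergence of the implicit Euler scheme of step [2^-k].

    If [alpha_n = k_n] at a node, then waves can leave this node although none
    arrives. For every large [l], boundary layers of width [c / l] at the node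
    are states of the domain for which [l x - A x] is of the order of [x]
    ([approximate_eigenvectors]), while for the generator of a semigroup it is
    at least of the order of [l x] ([generator_resolvent_bound], which rests on
    the exponential growth bound [C0_semigroup_growth]).

    The elements of H^1(0,1) being given by a weak derivative, the analysis on
    the edges rests on their representation as primitives ([H1_primitive]), by
    which boundary values are continuous ([sobolev]) and can be integrated by
    parts ([wip_energy]). *)

(** * Subspaces and equivalent inner products *)

Definition linear_subspace {R : realType} {V : normedModType R} (W : set V) : Prop :=
  W 0 /\ forall (a : R) x y, W x -> W y -> W (a *: x + y).

(** Completeness of a mere subset, in terms of explicit bounds. *)
Definition seq_complete {R : realType} {V : normedModType R} (W : set V) : Prop :=
  forall u : nat -> V, (forall n, W (u n)) ->
    (forall e : R, 0 < e -> exists N, forall p q, (N <= p)%N -> (N <= q)%N ->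
      `|u p - u q| < e) ->
    exists l, W l /\ forall e : R, 0 < e -> exists N, forall n, (N <= n)%N ->
      `|u n - l| < e.

Definition linear_on {R : realType} {V : normedModType R} (W : set V) (A : V -> V) :=
  forall (a : R) x y, W x -> W y -> A (a *: x + y) = a *: A x + A y.

Lemma subrACA (V : zmodType) (a b c d : V) : a - b - (c - d) = a - c - (b - d).
Proof. by rewrite !opprD addrACA. Qed.

Section Subspaces.
Context {R : realType} {V : normedModType R} (W : set V) (sW : linear_subspace W).

Lemma subspaceZ (a : R) x : W x -> W (a *: x).
Proof. by move=> Wx; have := sW.2 a x 0 Wx sW.1; rewrite addr0. Qed.

Lemma subspaceD x y : W x -> W y -> W (x + y).
Proof. by move=> Wx Wy; have := sW.2 1 x y Wx Wy; rewrite scale1r. Qed.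

Lemma subspaceB x y : W x -> W y -> W (x - y).
Proof. by move=> Wx Wy; rewrite addrC -scaleN1r; exact: sW.2. Qed.

Lemma linear_onB A x y : linear_on W A -> W x -> W y -> A (x - y) = A x - A y.
Proof. by move=> lA Wx Wy; rewrite addrC -scaleN1r lA// scaleN1r addrC. Qed.

Lemma linear_onD A x y : linear_on W A -> W x -> W y -> A (x + y) = A x + A y.
Proof. by move=> lA Wx Wy; rewrite -[x]scale1r lA// !scale1r. Qed.

Lemma linear_on0 A : linear_on W A -> A 0 = 0.
Proof.
move=> lA; have := linear_onB lA sW.1 sW.1; rewrite subrr => ->; exact: subrr.
Qed.

Lemma linear_onZ A (a : R) x : linear_on W A -> W x -> A (a *: x) = a *: A x.
Proof.
by move=> lA Wx; have := lA a x 0 Wx sW.1; rewrite addr0 (linear_on0 lA) addr0.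
Qed.

End Subspaces.

(** The choice [s = b], [t = a], unless one of the two is 0. *)
Lemma quadratic_CS {R : realFieldType} (a b c : R) : 0 <= a -> 0 <= b ->
  (forall s t, 2 * (s * t * c) <= s ^+ 2 * a ^+ 2 + t ^+ 2 * b ^+ 2) -> c <= a * b.
Proof.
move=> a0 b0 h; have [ea|an] := eqVneq a 0.
  rewrite ea mul0r leNgt; apply/negP => p.
  have := h (b ^+ 2 + 1) c; have := mulr_gt0 p p.
  by have := mulr_ge0 (sqr_ge0 c) (sqr_ge0 b); rewrite ea; lra.
have [eb|bn] := eqVneq b 0.
  rewrite eb mulr0 leNgt; apply/negP => p.
  have := h c (a ^+ 2 + 1); have := mulr_gt0 p p.
  by have := mulr_ge0 (sqr_ge0 c) (sqr_ge0 a); rewrite eb; lra.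
have ap : 0 < a by rewrite lt0r an.
have bp : 0 < b by rewrite lt0r bn.
rewrite -(ler_pM2l (mulr_gt0 ap bp)).
by have := h b a; lra.
Qed.

(** Limits and completeness do not depend on which of two equivalent norms is
    used, whereas dissipativity is meant for one inner product, adapted to the
    operator. *)
Record inner_product {R : realType} {V : normedModType R} (ip : V -> V -> R) : Prop := {
  ip_sym : forall x y, ip x y = ip y x;
  ip_lin : forall (a : R) x y z, ip (a *: x + y) z = a * ip x z + ip y z;
  ip_lb : exists2 k : R, 0 < k & forall x, k * `|x| ^+ 2 <= ip x x;
  ip_ub : exists2 K : R, 0 < K & forall x, ip x x <= K * `|x| ^+ 2
}.

Section InnerProduct.
Context {R : realType} {V : normedModType R} (ip : V -> V -> R).
Hypothesis ipP : inner_product ip.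

Definition ipnorm x := Num.sqrt (ip x x).
Local Notation N := ipnorm.

Lemma ipD x y z : ip (x + y) z = ip x z + ip y z.
Proof. by rewrite -[x]scale1r (ip_lin ipP) mul1r scale1r. Qed.

Lemma ip0 z : ip 0 z = 0.
Proof. by have := ipD 0 0 z; rewrite addr0; lra. Qed.

Lemma ipZ (a : R) x z : ip (a *: x) z = a * ip x z.
Proof. by have := ip_lin ipP a x 0 z; rewrite addr0 ip0 addr0. Qed.

Lemma ipN x z : ip (- x) z = - ip x z.
Proof. by rewrite -scaleN1r ipZ mulN1r. Qed.

Lemma ipDr x y z : ip z (x + y) = ip z x + ip z y.
Proof. by rewrite (ip_sym ipP) ipD !(ip_sym ipP _ z). Qed.

Lemma ipZr (a : R) x z : ip z (a *: x) = a * ip z x.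
Proof. by rewrite (ip_sym ipP) ipZ (ip_sym ipP x). Qed.

Lemma ipNr x z : ip z (- x) = - ip z x.
Proof. by rewrite (ip_sym ipP) ipN (ip_sym ipP x). Qed.

Lemma ip_ge0 x : 0 <= ip x x.
Proof.
have [k k0 h] := ip_lb ipP; apply: le_trans (h x).
by rewrite mulr_ge0 ?sqr_ge0 ?ltW.
Qed.

Lemma ipnorm_ge0 x : 0 <= N x.
Proof. exact: sqrtr_ge0. Qed.

Lemma ipnorm_sqr x : N x ^+ 2 = ip x x.
Proof. by rewrite sqr_sqrtr// ip_ge0. Qed.

Lemma ip_CS x y : ip x y <= N x * N y.
Proof.
have h (s t : R) : 2 * (s * t * ip x y) <= s ^+ 2 * ip x x + t ^+ 2 * ip y y.
  have := ip_ge0 (s *: x - t *: y).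
  rewrite ipD ipN !ipDr !ipNr !ipZ !ipZr (ip_sym ipP y x); lra.
by apply: quadratic_CS; rewrite ?ipnorm_ge0// => s t; rewrite !ipnorm_sqr.
Qed.

Lemma ipnormD x y : N (x + y) <= N x + N y.
Proof.
rewrite -(@ler_pXn2r _ 2) ?nnegrE ?addr_ge0 ?ipnorm_ge0// ipnorm_sqr.
rewrite ipD !ipDr (ip_sym ipP y x) -!ipnorm_sqr; have := ip_CS x y; nra.
Qed.

Lemma ipnormZ (a : R) x : N (a *: x) = `|a| * N x.
Proof.
by rewrite /N ipZ ipZr mulrA -expr2 sqrtrM ?sqr_ge0// sqrtr_sqr.
Qed.

Lemma ipnormN x : N (- x) = N x.
Proof. by rewrite -scaleN1r ipnormZ normrN1 mul1r. Qed.

Lemma ipnormBC x y : N (x - y) = N (y - x).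
Proof. by rewrite -ipnormN opprB. Qed.

Lemma ipnormB3 x y z : N (x - z) <= N (x - y) + N (y - z).
Proof. by apply: le_trans (ipnormD _ _); rewrite addrA subrK. Qed.

Lemma ipnorm0 : N 0 = 0.
Proof. by rewrite /N ip0 sqrtr0. Qed.

Lemma ipnorm_lb : exists2 k : R, 0 < k & forall x, `|x| <= k * N x.
Proof.
have [k k0 h] := ip_lb ipP.
have sk : 0 < Num.sqrt k by rewrite sqrtr_gt0.
exists (Num.sqrt k)^-1; rewrite ?invr_gt0// => x.
rewrite ler_pdivlMl// -(@ler_pXn2r _ 2) ?nnegrE ?mulr_ge0 ?ipnorm_ge0 ?sqrtr_ge0//.
by rewrite exprMn sqr_sqrtr ?(ltW k0)// ipnorm_sqr.
Qed.

Lemma ipnorm_ub : exists2 K : R, 0 < K & forall x, N x <= K * `|x|.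
Proof.
have [K K0 h] := ip_ub ipP.
have sk : 0 < Num.sqrt K by rewrite sqrtr_gt0.
exists (Num.sqrt K) => // x.
rewrite -(@ler_pXn2r _ 2) ?nnegrE ?mulr_ge0 ?ipnorm_ge0 ?normr_ge0 ?sqrtr_ge0//.
by rewrite exprMn ipnorm_sqr sqr_sqrtr ?(ltW K0).
Qed.

Lemma ipnorm_eq0 x : N x = 0 -> x = 0.
Proof.
have [k k0 h] := ipnorm_lb => x0; apply/eqP; rewrite -normr_eq0 eq_le normr_ge0.
by rewrite (le_trans (h x))// x0 mulr0.
Qed.

Definition iplim (u : nat -> V) (l : V) :=
  forall e : R, 0 < e -> exists n0, forall n, (n0 <= n)%N -> N (u n - l) < e.

Lemma iplim_uniq u l l' : iplim u l -> iplim u l' -> l = l'.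
Proof.
move=> h h'; apply/eqP; rewrite -subr_eq0; apply/eqP/ipnorm_eq0/eqP.
rewrite eq_le ipnorm_ge0 andbT; apply/ler_addgt0Pr => e e0; rewrite add0r.
have e2 : 0 < e / 2 by lra.
have [n1 h1] := h _ e2; have [n2 h2] := h' _ e2.
pose n := maxn n1 n2.
have := ipnormB3 l (u n) l'; rewrite (ipnormBC l (u n)).
have := h1 n (leq_maxl _ _); have := h2 n (leq_maxr _ _); lra.
Qed.

Lemma iplim_le u l y (C : R) : iplim u l ->
  (forall e, 0 < e -> exists n1, forall n, (n1 <= n)%N -> N (u n - y) <= C + e) ->
  N (l - y) <= C.
Proof.
move=> h hC; apply/ler_addgt0Pr => e e0.
have e2 : 0 < e / 2 by lra.
have [n1 h1] := h _ e2; have [n2 h2] := hC _ e2.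
pose n := maxn n1 n2.
have := ipnormB3 l (u n) y; rewrite (ipnormBC l (u n)).
have := h1 n (leq_maxl _ _); have := h2 n (leq_maxr _ _); lra.
Qed.

Lemma seq_complete_ip (W : set V) (u : nat -> V) : seq_complete W ->
  (forall n, W (u n)) ->
  (forall e : R, 0 < e -> exists n0, forall p q, (n0 <= p)%N -> (n0 <= q)%N ->
      N (u p - u q) < e) ->
  exists l, W l /\ iplim u l.
Proof.
move=> cW Wu cu; have [k k0 hk] := ipnorm_lb; have [K K0 hK] := ipnorm_ub.
have [e e0|l [Wl hl]] := cW u Wu.
  have [|n0 h0] := cu (e / k); first by rewrite divr_gt0.
  exists n0 => p q hp hq; apply: le_lt_trans (hk _) _.
  by rewrite -ltr_pdivlMl// mulrC h0.
exists l; split => // e e0; have [|n0 h0] := hl (e / K); first by rewrite divr_gt0.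
exists n0 => n hn; apply: le_lt_trans (hK _) _.
by rewrite -ltr_pdivlMl// mulrC h0.
Qed.

End InnerProduct.

(** * The implicit Euler scheme of a dissipative operator *)

Section LumerPhillips.
Context {R : realType} {V : normedModType R} (W D : set V) (A : V -> V).
Context (ip : V -> V -> R).
Hypothesis ipP : inner_product ip.
Hypothesis sW : linear_subspace W.
Hypothesis sD : linear_subspace D.
Hypothesis DW : D `<=` W.
Hypothesis lA : linear_on D A.
Hypothesis AW : forall x, D x -> W (A x).
Hypothesis cW : seq_complete W.
Hypothesis dissA : forall x, D x -> ip (A x) x <= 0.
Hypothesis rangeA : forall (h : R) y, 0 < h -> W y ->
  exists x, D x /\ x - h *: A x = y.

Local Notation N := (ipnorm ip).

(** One step of the implicit Euler scheme: [(1 - h A)^-1]. *)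
Definition resolvent (h : R) (y : V) : V := get [set x | D x /\ x - h *: A x = y].
Local Notation J := resolvent.

Let AB x y : D x -> D y -> A (x - y) = A x - A y.
Proof. exact: linear_onB. Qed.

Let AhB h x y : D x -> D y ->
  x - y - h *: A (x - y) = x - h *: A x - (y - h *: A y).
Proof. by move=> Dx Dy; rewrite AB// scalerBr subrACA. Qed.

(** The cross term in the expansion of [ip (x - h A x) (x - h A x)] is
    nonnegative. *)
Lemma dissN h x : D x -> 0 <= h -> N x <= N (x - h *: A x).
Proof.
move=> Dx h0; have [x0|x0] := eqVneq (N x) 0; first by rewrite x0 ipnorm_ge0.
have xp : 0 < N x by rewrite lt0r x0 ipnorm_ge0.
rewrite -(ler_pM2r xp) -expr2 (ipnorm_sqr ipP).
apply: le_trans (ip_CS ipP _ _).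
rewrite (ipD ipP) (ipN ipP) (ipZ ipP) lerDl -mulrN mulr_ge0// oppr_ge0.
exact: dissA.
Qed.

Lemma resolventP h y : 0 < h -> W y -> D (J h y) /\ J h y - h *: A (J h y) = y.
Proof.
move=> h0 Wy; have [x hx] := rangeA h0 Wy.
exact: (@getPex _ [set x | D x /\ x - h *: A x = y] (ex_intro _ x hx)).
Qed.

Lemma resolvent_uniq h x y : 0 < h -> D x -> x - h *: A x = y -> J h y = x.
Proof.
move=> h0 Dx hx.
have Wy : W y.
  rewrite -hx; apply: (subspaceB sW); [exact: DW|apply: (subspaceZ sW); exact: AW].
have [Dz hz] := resolventP h0 Wy; set z := J h y in Dz hz *.
apply/eqP; rewrite -subr_eq0; apply/eqP/(ipnorm_eq0 ipP)/eqP.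
rewrite eq_le ipnorm_ge0 andbT.
apply: le_trans (dissN (subspaceB sD Dz Dx) (ltW h0)) _.
by rewrite AhB// hz hx subrr (ipnorm0 ipP).
Qed.

Lemma resolventD h y : 0 < h -> W y -> D (J h y).
Proof. by move=> h0 Wy; have [] := resolventP h0 Wy. Qed.

Lemma resolventW h y : 0 < h -> W y -> W (J h y).
Proof. by move=> h0 Wy; exact/DW/resolventD. Qed.

Lemma resolvent_lin h : 0 < h -> linear_on W (J h).
Proof.
move=> h0 a x y Wx Wy.
have [Dx hx] := resolventP h0 Wx; have [Dy hy] := resolventP h0 Wy.
apply: resolvent_uniq => //; first exact: sD.2.
rewrite lA// -[in RHS]hx -[in RHS]hy scalerDr scalerA mulrC -scalerA.
by rewrite scalerBr opprD addrACA.
Qed.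

Lemma resolvent_contr h y : 0 < h -> W y -> N (J h y) <= N y.
Proof.
move=> h0 Wy; have [Dy hy] := resolventP h0 Wy.
by rewrite -{2}hy dissN// ltW.
Qed.

Lemma resolvent_comm h x : 0 < h -> D x -> D (A (J h x)) /\ A (J h x) = J h (A x).
Proof.
move=> h0 Dx; have Wx := DW Dx; have [Dz hz] := resolventP h0 Wx.
set z := J h x in Dz hz *.
have Az : A z = h^-1 *: (z - x).
  by rewrite -[in RHS]hz subKr scalerA mulVf ?gt_eqF// scale1r.
have DAz : D (A z) by rewrite Az; apply: (subspaceZ sD); exact: subspaceB.
split=> //; apply/esym/resolvent_uniq => //.
rewrite -(linear_onZ sD h lA DAz) -AB//; last exact: subspaceZ.
by rewrite hz.
Qed.

Lemma iter_resolvent_lin h n : 0 < h -> linear_on W (iter n (J h)).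
Proof.
move=> h0; elim: n => [//|n IH] a x y Wx Wy /=.
have iW z : W z -> W (iter n (J h) z).
  by move=> Wz; elim: (n) => //= k Wk; exact: resolventW.
by rewrite IH// resolvent_lin//; exact: iW.
Qed.

Lemma iter_resolventW h n y : 0 < h -> W y -> W (iter n (J h) y).
Proof. by move=> h0 Wy; elim: n => //= n; exact: resolventW. Qed.

Lemma iter_resolvent_contr h n y : 0 < h -> W y -> N (iter n (J h) y) <= N y.
Proof.
move=> h0 Wy; elim: n => //= n IH; apply: le_trans IH.
by apply: resolvent_contr => //; exact: iter_resolventW.
Qed.

Lemma iter_resolvent_comm h n x : 0 < h -> D x ->
  D (iter n (J h) x) /\ A (iter n (J h) x) = iter n (J h) (A x).
Proof.
move=> h0 Dx; elim: n => //= n [Dn An].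
by split; [exact/resolventD/DW | rewrite -An; exact: (resolvent_comm h0 Dn).2].
Qed.

Lemma resolvent_near h x : 0 < h -> D x -> N (J h x - x) <= h * N (A x).
Proof.
move=> h0 Dx; have [Dz hz] := resolventP h0 (DW Dx).
rewrite -{2}hz subKr (resolvent_comm h0 Dx).2 (ipnormZ ipP) gtr0_norm//.
by rewrite ler_pM2l// resolvent_contr//; exact: AW.
Qed.

Lemma iter_resolvent_near h n x : 0 < h -> D x ->
  N (iter n (J h) x - x) <= n%:R * h * N (A x).
Proof.
move=> h0 Dx; elim: n => [|n IH]; first by rewrite subrr (ipnorm0 ipP) !mul0r.
apply: le_trans (ipnormB3 ipP _ (J h x) _) _.
rewrite iterS -(linear_onB (resolvent_lin h0)); last 2 first.
- exact/iter_resolventW/DW.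
- exact: DW.
rewrite -natr1 !mulrDl mul1r lerD ?resolvent_near//.
apply: le_trans IH; apply: resolvent_contr => //.
by apply: (subspaceB sW); [exact/iter_resolventW/DW|exact: DW].
Qed.

(** One step against two half steps: since
    [(1 - h/2 A)^2 - (1 - h A) = h^2/4 A^2], the local error is of order two. *)
Lemma resolvent_half h x : 0 < h -> D x -> D (A x) ->
  N (J h x - J (h / 2) (J (h / 2) x)) <= h ^+ 2 * N (A (A x)).
Proof.
move=> h0 Dx DAx; have k0 : 0 < h / 2 by lra.
set k := h / 2 in k0 *; have hk : h = 2 * k by rewrite /k; lra.
have [Dy hy] := resolventP k0 (DW Dx); set y := J k x in Dy hy *.
have [Dw hw] := resolventP k0 (DW Dy); set w := J k y in Dw hw *.
have [Dz hz] := resolventP h0 (DW Dx); set z := J h x in Dz hz *.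
have [DAy Ay] := resolvent_comm k0 Dx; rewrite -/y in DAy Ay.
have [DAw Aw] := resolvent_comm k0 Dy; rewrite -/w in DAw Aw.
have AAw : A (A w) = J k (J k (A (A x))).
  rewrite Aw (resolvent_comm k0 DAy).2 Ay.
  by rewrite (resolvent_comm k0 DAx).2.
have xE : x = w - h *: A w + k ^+ 2 *: A (A w).
  rewrite -hy -hw AB//; last exact: subspaceZ.
  rewrite (linear_onZ sD k lA DAw) hk scalerBr !scalerA -expr2 opprB.
  by rewrite mulrDl mul1r scalerDl opprD !addrA [in RHS]addrAC.
apply: le_trans (dissN (subspaceB sD Dz Dw) (ltW h0)) _.
have -> : z - w - h *: A (z - w) = k ^+ 2 *: A (A w).
  rewrite AhB// hz.
  by rewrite [X in X - _]xE addrC addKr.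
rewrite (ipnormZ ipP) ger0_norm ?sqr_ge0//; apply: ler_pM.
- exact: sqr_ge0.
- exact: ipnorm_ge0.
- by rewrite hk; nra.
rewrite AAw; apply: le_trans (resolvent_contr k0 _) _.
  by apply: resolventW => //; exact: AW.
by apply: resolvent_contr => //; exact: AW.
Qed.

(** As the steps are contractions, the local errors add up. *)
Lemma iter_resolvent_half h n x : 0 < h -> D x -> D (A x) ->
  N (iter n (J h) x - iter n.*2 (J (h / 2)) x) <= n%:R * h ^+ 2 * N (A (A x)).
Proof.
move=> h0 Dx DAx; have k0 : 0 < h / 2 by lra.
elim: n => [|n IH]; first by rewrite subrr (ipnorm0 ipP) !mul0r.
set y := iter n.*2 (J (h / 2)) x in IH.
have [Dy Ay] := iter_resolvent_comm n.*2 k0 Dx; rewrite -/y in Dy Ay.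
have [DAy AAy] := iter_resolvent_comm n.*2 k0 DAx; rewrite -Ay in DAy AAy.
apply: le_trans (ipnormB3 ipP _ (J h y) _) _.
rewrite doubleS !iterS -(linear_onB (resolvent_lin h0)); last 2 first.
- exact/iter_resolventW/DW.
- exact: DW.
rewrite -[n.+1%:R]natr1 !mulrDl mul1r lerD//.
  apply: le_trans IH; apply: resolvent_contr => //.
  by apply: (subspaceB sW); [exact/iter_resolventW/DW|exact: DW].
apply: le_trans (resolvent_half h0 Dy DAy) _.
rewrite ler_wpM2l ?sqr_ge0// AAy iter_resolvent_contr//; exact: AW.
Qed.

Definition mesh (k : nat) : R := 2^-1 ^+ k.

Lemma mesh_gt0 k : 0 < mesh k.
Proof. by rewrite exprn_gt0// invr_gt0. Qed.

Lemma meshS k : mesh k.+1 = mesh k / 2.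
Proof. by rewrite /mesh exprSr. Qed.

Lemma mesh_mono p q : (p <= q)%N -> mesh q <= mesh p.
Proof.
move=> /subnK <-; rewrite /mesh exprD ler_piMl// ?exprn_ge0 ?invr_ge0//.
by rewrite exprn_ile1// ?invr_ge0// invf_le1// ler1n.
Qed.

Lemma mesh_small (e : R) : 0 < e -> exists k0, forall k, (k0 <= k)%N -> mesh k < e.
Proof.
move=> e0; have [k0 hk] : exists k0, mesh k0 < e.
  exists (Num.truncn e^-1); rewrite /mesh exprVn invf_plt ?posrE ?exprn_gt0//.
  apply: lt_le_trans (truncnS_gt _) _; rewrite -natrX ler_nat.
  exact: ltn_expl.
by exists k0 => k hk'; apply: le_lt_trans hk; exact: mesh_mono.
Qed.

(** The scheme of mesh [2^-k] makes as many whole steps as fit into [0, t];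
    dyadic meshes make successive schemes comparable. *)
Definition nsteps (k : nat) (t : R) : nat := Num.truncn (t / mesh k).

Lemma nsteps_itv k t : 0 <= t ->
  (nsteps k t)%:R * mesh k <= t < (nsteps k t)%:R * mesh k + mesh k.
Proof.
move=> t0; have m0 := mesh_gt0 k.
have := @truncn_itv _ (t / mesh k) _.
rewrite divr_ge0 ?(ltW m0)// => /(_ isT); rewrite -/(nsteps k t).
by rewrite ler_pdivlMr// ltr_pdivrMr// -natr1 mulrDl mul1r.
Qed.

Lemma nstepsD k s t : 0 <= s -> 0 <= t ->
  nsteps k (s + t) = (nsteps k s + nsteps k t)%N \/
  nsteps k (s + t) = (nsteps k s + nsteps k t).+1.
Proof.
move=> s0 t0; have m0 := mesh_gt0 k.
have /andP[h1 h2] := nsteps_itv k s0; have /andP[h3 h4] := nsteps_itv k t0.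
have /andP[h5 h6] := nsteps_itv k (addr_ge0 s0 t0).
have : (nsteps k s + nsteps k t < (nsteps k (s + t)).+1)%N.
  rewrite -(ltr_nat R) natrD -natr1 -(ltr_pM2r m0) !mulrDl mul1r; lra.
have : (nsteps k (s + t) < (nsteps k s + nsteps k t).+2)%N.
  rewrite -(ltr_nat R) -natr1 -natr1 natrD -(ltr_pM2r m0) !mulrDl mul1r; lra.
lia.
Qed.

Lemma nstepsS k t : 0 <= t ->
  nsteps k.+1 t = (nsteps k t).*2 \/ nsteps k.+1 t = (nsteps k t).*2.+1.
Proof.
move=> t0; have m0 := mesh_gt0 k.
have /andP[h1 h2] := nsteps_itv k t0; have /andP[h3 h4] := nsteps_itv k.+1 t0.
rewrite meshS in h3 h4.
have : ((nsteps k t).*2 < (nsteps k.+1 t).+1)%N.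
  rewrite -(ltr_nat R) -(ltr_pM2r m0) -natr1 -addnn natrD; lra.
have : (nsteps k.+1 t < (nsteps k t).*2.+2)%N.
  rewrite -(ltr_nat R) -(ltr_pM2r m0) -natr1 -natr1 -addnn natrD; lra.
lia.
Qed.

Definition euler (k : nat) (t : R) (x : V) := iter (nsteps k t) (J (mesh k)) x.

Lemma eulerW k t x : W x -> W (euler k t x).
Proof. by apply: iter_resolventW; exact: mesh_gt0. Qed.

Lemma euler_contr k t x : W x -> N (euler k t x) <= N x.
Proof. by apply: iter_resolvent_contr; exact: mesh_gt0. Qed.

Lemma euler_lin k t : linear_on W (euler k t).
Proof. by apply: iter_resolvent_lin; exact: mesh_gt0. Qed.

(** At most one step of the finer scheme has no counterpart in the coarser one. *)
Lemma euler_step k t x : 0 <= t -> D x -> D (A x) ->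
  N (euler k t x - euler k.+1 t x) <= mesh k * (t * N (A (A x)) + N (A x)).
Proof.
move=> t0 Dx DAx; have m0 := mesh_gt0 k; have m1 := mesh_gt0 k.+1.
have /andP[h1 _] := nsteps_itv k t0.
have H := iter_resolvent_half (nsteps k t) m0 Dx DAx; rewrite -meshS in H.
have {}H : N (euler k t x - iter (nsteps k t).*2 (J (mesh k.+1)) x) <=
    mesh k * (t * N (A (A x))).
  apply: le_trans H _; rewrite [leRHS]mulrA ler_wpM2r ?ipnorm_ge0//.
  by rewrite expr2 mulrA mulrC ler_pM2l.
rewrite mulrDr; have NA := ipnorm_ge0 ip (A x).
have [e|e] := nstepsS k t0; rewrite /euler e.
  by apply: le_trans H _; rewrite lerDl mulr_ge0// ltW.
apply: le_trans (ipnormB3 ipP _ _ _) _; apply: lerD; first exact: H.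
have [Dy Ay] := iter_resolvent_comm (nsteps k t).*2 m1 Dx.
rewrite iterS (ipnormBC ipP); apply: le_trans (resolvent_near m1 Dy) _.
apply: ler_pM => //; first exact: ltW; first exact: ipnorm_ge0.
  exact: mesh_mono.
by rewrite Ay iter_resolvent_contr//; exact: AW.
Qed.

(** The previous bounds form a geometric series. *)
Lemma euler_cauchy_smooth t x p q : 0 <= t -> D x -> D (A x) -> (p <= q)%N ->
  N (euler p t x - euler q t x) <= 2 * mesh p * (t * N (A (A x)) + N (A x)).
Proof.
move=> t0 Dx DAx /subnK <-; rewrite addnC; set C := t * _ + _.
have C0 : 0 <= C by rewrite addr_ge0 ?mulr_ge0 ?ipnorm_ge0.
suff : forall d, N (euler p t x - euler (p + d)%N t x) <= 2 * (mesh p - mesh (p + d)%N) * C.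
  move=> /(_ (q - p)%N) /le_trans; apply; rewrite ler_wpM2r//.
  by have := mesh_gt0 (p + (q - p)); lra.
elim=> [|d IH]; first by rewrite addn0 subrr (ipnorm0 ipP); lra.
apply: le_trans (ipnormB3 ipP _ (euler (p + d) t x) _) _.
rewrite addnS meshS; have := @euler_step (p + d) t x t0 Dx DAx; rewrite -/C; nra.
Qed.

(** * Density of the domain *)

(** Minty's argument: by dissipativity, [J h x - x] shrinks with [h]. Its norm
    therefore converges as [h] tends to 0, and the inequality makes [J h x]
    itself a Cauchy family. *)
Lemma resolvent_minty h k x : 0 < h -> h <= k -> W x ->
  N (J h x - J k x) ^+ 2 <= N (J k x - x) ^+ 2 - N (J h x - x) ^+ 2.
Proof.
move=> h0 hk Wx; have k0 : 0 < k by exact: lt_le_trans hk.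
have [Du hu] := resolventP h0 Wx; set u := J h x in Du hu *.
have [Dv hv] := resolventP k0 Wx; set v := J k x in Dv hv *.
have Au : A u = h^-1 *: (u - x).
  by rewrite -[in RHS]hu subKr scalerA mulVf ?gt_eqF// scale1r.
have Av : A v = k^-1 *: (v - x).
  by rewrite -[in RHS]hv subKr scalerA mulVf ?gt_eqF// scale1r.
have := dissA (subspaceB sD Du Dv); rewrite AB// Au Av.
have uv : u - v = (u - x) - (v - x) by rewrite opprB addrA subrK.
rewrite uv; have hab : h = k -> u - x = v - x by rewrite /u /v => ->.
move: (u - x) (v - x) hab => a b hab.
rewrite !(ipnorm_sqr ipP) !(ipD ipP) !(ipN ipP) !(ipDr ipP) !(ipNr ipP) !(ipZ ipP).
rewrite (ip_sym ipP b a).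
set aa := ip a a; set bb := ip b b; set ab := ip a b => H.
have aa0 : 0 <= aa by exact: ip_ge0.
have bb0 : 0 <= bb by exact: ip_ge0.
have cs : 2 * ab <= aa + bb.
  have := ip_ge0 ipP (a - b).
  by rewrite !(ipD ipP) !(ipN ipP) !(ipDr ipP) !(ipNr ipP) (ip_sym ipP b a) -/aa -/bb -/ab; lra.
have {}H : k * (aa - ab) - h * (ab - bb) <= 0.
  have hkp : 0 < h * k by rewrite mulr_gt0.
  rewrite -(pmulr_rle0 _ hkp) in H.
  move: H; congr (_ <= _); field.
  by rewrite !gt_eqF.
move: hk; rewrite le_eqVlt => /predU1P[hk|hk].
  have ab' := hab hk; rewrite /aa /bb ab'.
  by rewrite subrr /ab ab'; lra.
have aabb : aa <= bb by nra.
nra.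
Qed.

Lemma resolvent_cauchy x : W x -> forall e : R, 0 < e -> exists n0, forall p q,
  (n0 <= p)%N -> (n0 <= q)%N -> N (J (mesh p) x - J (mesh q) x) < e.
Proof.
move=> Wx e e0; pose a k := N (J (mesh k) x - x) ^+ 2.
have hinf : has_inf (range a).
  split; first by exists (a 0); exists 0.
  by exists 0 => _ [k _ <-]; exact: sqr_ge0.
have e20 : 0 < e ^+ 2 by rewrite exprn_gt0.
have [_ [n0 _ <-] han] := inf_adherent e20 hinf.
have main p q : (n0 <= p)%N -> (p <= q)%N -> N (J (mesh p) x - J (mesh q) x) < e.
  move=> hp hq; rewrite (ipnormBC ipP).
  rewrite -(@ltr_pXn2r _ 2) ?nnegrE ?ipnorm_ge0 ?(ltW e0)//.
  apply: le_lt_trans (resolvent_minty (mesh_gt0 q) (mesh_mono hq) Wx) _.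
  rewrite -/(a p) -/(a q).
  have : a p <= a n0.
    rewrite -subr_ge0; apply: le_trans (resolvent_minty (mesh_gt0 p) (mesh_mono hp) Wx).
    exact: sqr_ge0.
  have : inf (range a) <= a q by apply: (ge_inf hinf.2); exists q.
  by move: han; lra.
exists n0 => p q hp hq; have [pq|/ltnW pq] := leqP p q; first exact: main.
by rewrite (ipnormBC ipP); exact: main.
Qed.

(** If [u = J h x] tends to [z] with [h], then [u - x = h A u], so that
    [J 1 (u - x) = h (J 1 u - u)] tends to 0. Hence [J 1 (z - x) = 0], and
    [z = x]. *)
Lemma resolvent_to_id x : W x -> iplim ip (fun k => J (mesh k) x) x.
Proof.
move=> Wx; have [z [Wz hz]] := seq_complete_ip ipP cW
  (fun n => resolventW (mesh_gt0 n) Wx) (resolvent_cauchy Wx).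
suff : z - x = 0 by move=> /subr0_eq zx; move: hz; rewrite zx.
have Ww : W (z - x) by exact: (subspaceB sW).
have [Dv hv] := resolventP (@ltr01 R) Ww.
suff v0 : J 1 (z - x) = 0 by rewrite -hv v0 (linear_on0 sD lA) scaler0 subrr.
apply/(ipnorm_eq0 ipP)/eqP; rewrite eq_le ipnorm_ge0 andbT.
apply/ler_addgt0Pr => e e0; rewrite add0r.
have Nx := ipnorm_ge0 ip x.
have [|n1 h1] := hz (e / 2); first by lra.
have [|n2 h2] := @mesh_small (e / (4 * (N x + 1))).
  by rewrite divr_gt0// mulr_gt0//; lra.
pose n := maxn n1 n2; have m0 := mesh_gt0 n.
have {}h1 := h1 n (leq_maxl _ _); have {}h2 := h2 n (leq_maxr _ _).
have [Du hu] := resolventP m0 Wx; set u := J (mesh n) x in Du hu h1.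
have Nu : N u <= N x by exact: resolvent_contr.
have Wu := DW Du.
have Au : mesh n *: A u = u - x by rewrite -[in RHS]hu subKr.
have Ju : J 1 (mesh n *: u - (u - x)) = mesh n *: u.
  apply: resolvent_uniq => //; first exact: subspaceZ.
  by rewrite (linear_onZ sD _ lA Du) Au scale1r.
have Wy : W (mesh n *: u - (u - x)).
  by apply: (subspaceB sW); [exact: subspaceZ|exact: (subspaceB sW)].
have c1 : N (J 1 (z - x) + mesh n *: u) <= N (z - u) + mesh n * N u.
  rewrite -{1}Ju -(linear_onD (resolvent_lin ltr01))//.
  apply: le_trans (resolvent_contr ltr01 (subspaceD sW Ww Wy)) _.
  rewrite addrCA opprB subrKA addrC.
  by apply: le_trans (ipnormD ipP _ _) _; rewrite (ipnormZ ipP) (gtr0_norm m0).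
have c2 : N (J 1 (z - x)) <= N (J 1 (z - x) + mesh n *: u) + mesh n * N u.
  rewrite -{1}[J 1 (z - x)](addrK (mesh n *: u)).
  apply: le_trans (ipnormD ipP _ _) _.
  by rewrite (ipnormN ipP) (ipnormZ ipP) (gtr0_norm m0).
rewrite (ipnormBC ipP) in h1.
have c3 : mesh n * N u <= e / 4.
  have : mesh n * (4 * (N x + 1)) < e by rewrite -ltr_pdivlMr// mulr_gt0//; lra.
  nra.
lra.
Qed.

(** Two steps of the scheme lead into the domain of [A^2], where its error is
    under control. *)
Lemma smooth_dense x : W x -> forall e : R, 0 < e ->
  exists d, [/\ D d, D (A d) & N (x - d) < e].
Proof.
move=> Wx e e0; have e2 : 0 < e / 2 by lra.
have [k hk] := resolvent_to_id Wx e2; have {hk} := hk k (leqnn k).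
have Dd := resolventD (mesh_gt0 k) Wx; set d := J _ x in Dd * => hd.
have [k' hk'] := resolvent_to_id (DW Dd) e2; have {hk'} := hk' k' (leqnn k').
have Dd' := resolventD (mesh_gt0 k') (DW Dd) => hd'.
have [Ad _] := resolvent_comm (mesh_gt0 k') Dd.
exists (J (mesh k') d); split => //.
have := ipnormB3 ipP x d (J (mesh k') d).
by rewrite (ipnormBC ipP x d) (ipnormBC ipP d (J _ d)); lra.
Qed.

(** The schemes are uniformly Lipschitz, so that convergence on a dense subset
    suffices. *)
Lemma euler_cauchy t x : 0 <= t -> W x -> forall e : R, 0 < e ->
  exists n0, forall p q, (n0 <= p)%N -> (n0 <= q)%N ->
  N (euler p t x - euler q t x) < e.
Proof.
move=> t0 Wx e e0; have e4 : 0 < e / 4 by lra.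
have [d [Dd DAd xd]] := smooth_dense Wx e4.
set C := t * N (A (A d)) + N (A d).
have C0 : 0 <= C by rewrite addr_ge0 ?mulr_ge0 ?ipnorm_ge0.
have [|n0 hn] := @mesh_small (e / (4 * (C + 1))).
  by rewrite divr_gt0// mulr_gt0//; lra.
have main p q : (n0 <= p)%N -> (p <= q)%N -> N (euler p t x - euler q t x) < e.
  move=> hp hq; have := euler_cauchy_smooth t0 Dd DAd hq; rewrite -/C => h.
  have m0 := mesh_gt0 p.
  have : mesh p * (4 * (C + 1)) < e by rewrite -ltr_pdivlMr ?hn// mulr_gt0//; lra.
  move=> h1; have h2 : 2 * mesh p * C < e / 2 by nra.
  have c k : N (euler k t x - euler k t d) <= N (x - d).
    rewrite -(linear_onB (@euler_lin k t)) ?euler_contr//.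
      by apply: (subspaceB sW) => //; exact: DW.
    exact: DW.
  have := ipnormB3 ipP (euler p t x) (euler p t d) (euler q t x).
  have := ipnormB3 ipP (euler p t d) (euler q t d) (euler q t x).
  have := c p; have := c q; rewrite (ipnormBC ipP (euler q t x)); lra.
exists n0 => p q hp hq; have [pq|/ltnW pq] := leqP p q; first exact: main.
by rewrite (ipnormBC ipP); exact: main.
Qed.

(** * The semigroup as the limit of the scheme *)

Definition semi (t : R) (x : V) : V :=
  get [set l | W l /\ iplim ip (fun k => euler k t x) l].
Local Notation S := semi.

Lemma semiP t x : 0 <= t -> W x -> W (S t x) /\ iplim ip (fun k => euler k t x) (S t x).
Proof.
move=> t0 Wx; have [l hl] := seq_complete_ip ipP cW (fun n => eulerW n t Wx) (euler_cauchy t0 Wx).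
exact: (@getPex _ [set l | W l /\ iplim ip (fun k => euler k t x) l] (ex_intro _ l hl)).
Qed.

Lemma semi_lin t : 0 <= t -> linear_on W (S t).
Proof.
move=> t0 a x y Wx Wy; have Wz := sW.2 a x y Wx Wy.
apply: (iplim_uniq ipP (semiP t0 Wz).2) => e e0.
have e2 : 0 < e / 2 by lra.
have ea : 0 < e / (2 * (`|a| + 1)).
  by rewrite divr_gt0// mulr_gt0// ltr_pwDr.
have [n1 h1] := (semiP t0 Wx).2 _ ea; have [n2 h2] := (semiP t0 Wy).2 _ e2.
exists (maxn n1 n2) => n; rewrite geq_max => /andP[k1 k2].
rewrite (@euler_lin n t)// opprD addrACA -scalerBr.
apply: le_lt_trans (ipnormD ipP _ _) _; rewrite (ipnormZ ipP).
have {}h1 := h1 n k1; have {}h2 := h2 n k2.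
have a0 := normr_ge0 a.
have : N (euler n t x - S t x) * (2 * (`|a| + 1)) < e.
  by rewrite -ltr_pdivlMr// mulr_gt0// ltr_pwDr.
have := ipnorm_ge0 ip (euler n t x - S t x); nra.
Qed.

Lemma semi_contr t x : 0 <= t -> W x -> N (S t x) <= N x.
Proof.
move=> t0 Wx; have := (semiP t0 Wx).2; rewrite -[S t x in leLHS]subr0 => /(iplim_le ipP).
apply=> e e0; exists 0%N => n _; rewrite subr0.
by apply: le_trans (euler_contr n t Wx) _; lra.
Qed.

Lemma semi0 x : W x -> S 0 x = x.
Proof.
move=> Wx; apply: (iplim_uniq ipP (semiP (lexx 0) Wx).2) => e e0; exists 0%N => n _.
by rewrite /euler /nsteps mul0r truncn0 subrr (ipnorm0 ipP).
Qed.

(** The numbers of steps add up, except for one step at most, which is close to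
    the identity. *)
Lemma semiD s t x : 0 <= s -> 0 <= t -> W x -> S (s + t) x = S s (S t x).
Proof.
move=> s0 t0 Wx; have st0 := addr_ge0 s0 t0.
have [Wy hy] := semiP t0 Wx; have [Wz hz] := semiP s0 Wy.
apply: (iplim_uniq ipP (semiP st0 Wx).2) => e e0.
have e4 : 0 < e / 4 by lra. have e8 : 0 < e / 8 by lra.
have [d [Dd DAd xd]] := smooth_dense Wx e8.
have Nd := ipnorm_ge0 ip (A d).
have [n1 h1] := hy _ e4; have [n2 h2] := hz _ e4.
have [|n3 h3] := @mesh_small (e / 4 / (N (A d) + 1)).
  by rewrite divr_gt0//; lra.
exists (maxn n1 (maxn n2 n3)) => n; rewrite !geq_max => /and3P[k1 k2 k3].
have {}h1 := h1 n k1; have {}h2 := h2 n k2; have {}h3 := h3 n k3.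
have m0 := mesh_gt0 n.
have Wd := DW Dd.
have c1 : N (euler n (s + t) x - euler n s (euler n t x)) < e / 2.
  have [E|E] := nstepsD n s0 t0; rewrite /euler E ?iterS iterD.
    by rewrite subrr (ipnorm0 ipP); lra.
  set y := iter _ _ (iter _ _ x).
  have Wy' : W y by do 2 apply: iter_resolventW => //.
  set f := fun w => iter (nsteps n s) (J (mesh n)) (iter (nsteps n t) (J (mesh n)) w).
  have fE w : f w = iter (nsteps n s + nsteps n t) (J (mesh n)) w by rewrite iterD.
  have c : N (f x - f d) <= N (x - d).
    rewrite !fE -(linear_onB (iter_resolvent_lin _ m0))//.
    by apply: iter_resolvent_contr => //; exact: (subspaceB sW).
  have Wfd : W (f d) by rewrite fE; exact: iter_resolventW.
  have Wfx : W (f x) by rewrite fE; exact: iter_resolventW.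
  have c' : N (J (mesh n) (f x) - J (mesh n) (f d)) <= N (x - d).
    apply: le_trans c; rewrite -(linear_onB (resolvent_lin m0))//.
    by apply: resolvent_contr => //; exact: (subspaceB sW).
  have c'' : N (J (mesh n) (f d) - f d) <= mesh n * N (A d).
    rewrite fE; have [Df Af] := iter_resolvent_comm (nsteps n s + nsteps n t) m0 Dd.
    apply: le_trans (resolvent_near m0 Df) _; rewrite ler_pM2l// Af.
    by apply: iter_resolvent_contr => //; exact: AW.
  have c3 : mesh n * N (A d) < e / 4.
    have : mesh n * (N (A d) + 1) < e / 4 by rewrite -ltr_pdivlMr//; lra.
    by nra.
  have := ipnormB3 ipP (J (mesh n) (f x)) (J (mesh n) (f d)) (f x).
  have := ipnormB3 ipP (J (mesh n) (f d)) (f d) (f x).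
  rewrite (ipnormBC ipP (f d) (f x)) -/(f x); lra.
have c2 : N (euler n s (euler n t x) - euler n s (S t x)) < e / 4.
  rewrite -(linear_onB (@euler_lin n s))//; last exact: eulerW.
  by apply: le_lt_trans h1; apply: euler_contr; apply: (subspaceB sW) => //; exact: eulerW.
have := ipnormB3 ipP (euler n (s + t) x) (euler n s (euler n t x)) (S s (S t x)).
have := ipnormB3 ipP (euler n s (euler n t x)) (euler n s (S t x)) (S s (S t x)).
by lra.
Qed.

(** Every step moves by [h A] applied to the new point, that is by the image of
    [A x] under the scheme. To bound how far this image is from [A x], which
    need not belong to [D], it is approximated by a point [z] of [D]. *)
Lemma iter_resolvent_deriv h n x z : 0 < h -> D x -> D z ->
  N (iter n (J h) x - x - (n%:R * h) *: A x) <=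
  n%:R * h * (2 * N (A x - z) + n%:R * h * N (A z)).
Proof.
move=> h0 Dx Dz; have WA := AW Dx; have Wz := DW Dz.
have near m : (m <= n)%N ->
    N (iter m (J h) (A x) - A x) <= 2 * N (A x - z) + n%:R * h * N (A z).
  move=> mn; have c1 := iter_resolvent_near m h0 Dz.
  have c2 : N (iter m (J h) (A x) - iter m (J h) z) <= N (A x - z).
    rewrite -(linear_onB (iter_resolvent_lin m h0))//.
    by apply: iter_resolvent_contr => //; exact: (subspaceB sW).
  have c3 : m%:R * h * N (A z) <= n%:R * h * N (A z).
    by rewrite ler_wpM2r ?ipnorm_ge0// ler_pM2r// ler_nat.
  have := ipnormB3 ipP (iter m (J h) (A x)) (iter m (J h) z) (A x).
  have := ipnormB3 ipP (iter m (J h) z) z (A x).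
  rewrite (ipnormBC ipP z); lra.
set B := _ + _ in near *.
suff : forall j, (j <= n)%N ->
    N (iter j (J h) x - x - (j%:R * h) *: A x) <= j%:R * h * B by apply.
elim=> [|j IH] jn.
  by rewrite subrr mul0r scale0r subrr (ipnorm0 ipP) mul0r.
have [Dy Ay] := iter_resolvent_comm j.+1 h0 Dx.
have [Du Au] := iter_resolvent_comm j h0 Dx.
set u := iter j (J h) x in Du Au IH *.
have Ju : iter j.+1 (J h) x = u + h *: iter j.+1 (J h) (A x).
  have [_] := resolventP h0 (DW Du); rewrite -[J h u]/(iter j.+1 (J h) x) Ay.
  by move=> <-; rewrite subrK.
have -> : iter j.+1 (J h) x - x - (j.+1%:R * h) *: A x =
  (u - x - (j%:R * h) *: A x) + h *: (iter j.+1 (J h) (A x) - A x).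
  rewrite [in LHS]Ju -natr1 mulrDl mul1r scalerDl scalerBr opprD [RHS]addrACA.
  by congr (_ + _); exact: addrAC.
rewrite -natr1 !mulrDl mul1r.
apply: le_trans (ipnormD ipP _ _) _; apply: lerD; first exact/IH/ltnW.
by rewrite (ipnormZ ipP) gtr0_norm// ler_pM2l// near.
Qed.

Lemma semi_near t x d : 0 <= t -> W x -> D d ->
  N (S t x - x) <= 2 * N (x - d) + t * N (A d).
Proof.
move=> t0 Wx Dd; apply: (iplim_le ipP (semiP t0 Wx).2) => e e0.
exists 0%N => n _; have m0 := mesh_gt0 n; have Wd := DW Dd.
have c1 := iter_resolvent_near (nsteps n t) m0 Dd.
have c2 : N (euler n t x - euler n t d) <= N (x - d).
  rewrite -(linear_onB (@euler_lin n t))//.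
  by apply: euler_contr => //; exact: (subspaceB sW).
have /andP[c3 _] := nsteps_itv n t0.
have c4 : (nsteps n t)%:R * mesh n * N (A d) <= t * N (A d).
  by rewrite ler_wpM2r// ipnorm_ge0.
have := ipnormB3 ipP (euler n t x) (euler n t d) x.
have := ipnormB3 ipP (euler n t d) d x.
rewrite (ipnormBC ipP d) -/(euler n t d) in c1 *; lra.
Qed.

Lemma semi_deriv t x z : 0 <= t -> D x -> D z ->
  N (S t x - x - t *: A x) <= t * (2 * N (A x - z) + t * N (A z)).
Proof.
move=> t0 Dx Dz; rewrite -addrA -opprD.
apply: (iplim_le ipP (semiP t0 (DW Dx)).2) => e e0.
have NA := ipnorm_ge0 ip (A x).
have [|n0 hn] := @mesh_small (e / (N (A x) + 1)); first by rewrite divr_gt0//; lra.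
exists n0 => n /hn nn; have m0 := mesh_gt0 n.
have {}nn : mesh n * N (A x) < e.
  have : mesh n * (N (A x) + 1) < e by rewrite -ltr_pdivlMr//; lra.
  by nra.
have c1 := iter_resolvent_deriv (nsteps n t) m0 Dx Dz.
have /andP[c3 c4] := nsteps_itv n t0.
rewrite -/(euler n t x) in c1; set s := (nsteps n t)%:R * mesh n in c1 c3 c4.
have s0 : 0 <= s by rewrite mulr_ge0// ltW.
have c5 : s * (2 * N (A x - z) + s * N (A z)) <= t * (2 * N (A x - z) + t * N (A z)).
  have := ipnorm_ge0 ip (A z); have := ipnorm_ge0 ip (A x - z) => u v.
  apply: ler_pM => //; first by nra.
  by rewrite lerD2l ler_wpM2r.
have -> : euler n t x - (x + t *: A x) =
    (euler n t x - x - s *: A x) + (s - t) *: A x.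
  by rewrite scalerBl addrA subrK opprD addrA.
apply: le_trans (ipnormD ipP _ _) _; rewrite (ipnormZ ipP).
have : `|s - t| * N (A x) <= mesh n * N (A x).
  by rewrite ler_wpM2r// distrC ger0_norm; lra.
lra.
Qed.

End LumerPhillips.

Lemma near0P {R : realType} (P : R -> Prop) :
  (exists2 d : R, 0 < d & forall h, 0 < h -> h < d -> P h) <->
  (\forall h \near 0^'+, P h).
Proof.
split => [[d d0 h]|].
  near=> t; apply: h; near: t; [exact: nbhs_right_gt|exact: nbhs_right_lt].
rewrite /at_right near_withinE => /nbhs_ballP[d d0 h]; exists d => // t t0 td.
apply: h => //; rewrite /ball/= sub0r normrN gtr0_norm//.
Unshelve. all: by end_near. Qed.

Lemma cvg_at0P {R : realType} {V : normedModType R} (f : R -> V) l :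
  f h @[h --> 0^'+] --> l <->
  forall e : R, 0 < e -> exists2 d : R, 0 < d &
    forall h, 0 < h -> h < d -> `|f h - l| < e.
Proof.
rewrite cvgrPdist_lt; split => H e e0.
  have /near0P[d d0 h] := H e e0; exists d => // t t0 td.
  by rewrite distrC; exact: h.
by apply/near0P; have [d d0 h] := H e e0; exists d => // t t0 td; rewrite distrC h.
Qed.

(** The limit of the scheme is a contraction semigroup whose generator extends
    [A]. Since [1 - A] is onto already and a contraction semigroup has no
    eigenvector for the eigenvalue 1, the generator is not larger than [A]. *)
Theorem lumer_phillips_contr {R : realType} {V : normedModType R} (W D : set V)
    (A : V -> V) (ip : V -> V -> R) :
  inner_product ip -> linear_subspace W -> linear_subspace D -> D `<=` W ->
  linear_on D A -> (forall x, D x -> W (A x)) -> seq_complete W ->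
  (forall x, D x -> ip (A x) x <= 0) ->
  (forall (h : R) y, 0 < h -> W y -> exists x, D x /\ x - h *: A x = y) ->
  generates_C0_semigroup W D A.
Proof.
move=> ipP sW sD DW lA AW cW dissA rangeA.
have [k k0 hk] := ipnorm_lb ipP; have [K K0 hK] := ipnorm_ub ipP.
pose S := semi W D A ip; exists S.
have SP := semiP ipP sW sD DW lA AW cW dissA rangeA.
have Slin := semi_lin ipP sW sD DW lA AW cW dissA rangeA.
have Scontr := semi_contr ipP sW sD DW lA AW cW dissA rangeA.
have near := semi_near ipP sW sD DW lA AW cW dissA rangeA.
have deriv := semi_deriv ipP sW sD DW lA AW cW dissA rangeA.
have dense := smooth_dense ipP sW sD DW lA AW cW dissA rangeA.
split; first split.
- move=> t t0; split => [x Wx|a x y|]; [exact: (SP _ _ t0 Wx).1|exact: Slin|].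
  exists (k * K) => x Wx; apply: le_trans (hk _) _; rewrite -mulrA ler_pM2l//.
  by apply: le_trans (hK _); exact: Scontr.
- exact: (semi0 ipP sW sD DW lA AW cW dissA rangeA).
- exact: (semiD ipP sW sD DW lA AW cW dissA rangeA).
- move=> x Wx; apply/cvg_at0P => e e0.
  have ek : 0 < e / k / 4 by rewrite !divr_gt0.
  have [d [Dd _ xd]] := dense _ Wx _ ek; have Nd := ipnorm_ge0 ip (A d).
  exists (e / k / 4 / (ipnorm ip (A d) + 1)); first by rewrite divr_gt0//; lra.
  move=> t t0; rewrite ltr_pdivlMr => [tt|]; last by lra.
  apply: le_lt_trans (hk _) _; rewrite -ltr_pdivlMl// mulrC.
  by apply: le_lt_trans (near _ _ _ (ltW t0) Wx Dd) _; nra.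
have fwd x : D x -> h^-1 *: (S h x - x) @[h --> 0^'+] --> A x.
  move=> Dx; apply/cvg_at0P => e e0.
  have ek : 0 < e / k / 4 by rewrite !divr_gt0.
  have [z [Dz _ xd]] := dense _ (AW _ Dx) _ ek; have Nd := ipnorm_ge0 ip (A z).
  exists (e / k / 4 / (ipnorm ip (A z) + 1)); first by rewrite divr_gt0//; lra.
  move=> t t0; rewrite ltr_pdivlMr => [tt|]; last by lra.
  apply: le_lt_trans (hk _) _; rewrite -ltr_pdivlMl// mulrC.
  have -> : t^-1 *: (S t x - x) - A x = t^-1 *: (S t x - x - t *: A x).
    by rewrite [RHS]scalerBr scalerA mulVf ?gt_eqF// scale1r.
  rewrite (ipnormZ ipP) gtr0_norm ?invr_gt0// ltr_pdivrMl//.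
  apply: le_lt_trans (deriv _ _ _ (ltW t0) Dx Dz) _.
  by rewrite ltr_pM2l//; nra.
move=> x y; split => [[Dx <-]|[Wx Wy hxy]].
  by split; [exact: DW|exact: AW|exact: fwd].
have [z [Dz hz]] := rangeA 1 _ ltr01 (subspaceB sW Wx Wy).
rewrite scale1r in hz; have Wz := DW _ Dz.
have Ww : W (x - z) by exact: (subspaceB sW).
have hw : y - A z = x - z.
  by apply/esym/eqP; rewrite -subr_eq0 opprD addrACA -opprD hz subrr.
suff w0 : x - z = 0.
  move/subr0_eq: (w0) => xz; split; first by rewrite xz.
  by move/eqP: hw; rewrite w0 subr_eq0 xz => /eqP.
(* [x - z] is an eigenvector of the generator, for the eigenvalue 1 *)
apply/(ipnorm_eq0 ipP)/eqP; rewrite eq_le ipnorm_ge0 andbT.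
apply/ler_addgt0Pr => e e0; rewrite add0r.
have e2 : 0 < e / K / 2 by rewrite !divr_gt0.
have [d1 d10 h1] := (cvg_at0P _ _).1 hxy _ e2.
have [d2 d20 h2] := (cvg_at0P _ _).1 (fwd _ Dz) _ e2.
pose t := Num.min d1 d2 / 2.
have t0 : 0 < t by rewrite divr_gt0// lt_min d10.
have td1 : t < d1 by rewrite /t; have := ge_min d1 d1 d2; rewrite lexx /=; lra.
have td2 : t < d2 by rewrite /t; have := ge_min d2 d1 d2; rewrite lexx orbT /=; lra.
have {}h1 := h1 t t0 td1; have {}h2 := h2 t t0 td2.
have : `|t^-1 *: (S t (x - z) - (x - z)) - (x - z)| < e / K.
  have -> : S t (x - z) = S t x - S t z by exact: (linear_onB (Slin _ (ltW t0))).
  rewrite -[X in _ - X]hw.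
  have -> : t^-1 *: (S t x - S t z - (x - z)) - (y - A z) =
     (t^-1 *: (S t x - x) - y) - (t^-1 *: (S t z - z) - A z).
    by rewrite subrACA scalerBr subrACA.
  by apply: le_lt_trans (ler_normB _ _) _; lra.
move=> h3.
have h4 : ipnorm ip (t^-1 *: (S t (x - z) - (x - z)) - (x - z)) <= e.
  by apply: le_trans (hK _) _; rewrite -ler_pdivlMl// mulrC ltW.
have := Scontr t _ (ltW t0) Ww; set w := x - z in h4 *.
have E : (1 + t) *: w = S t w - t *: (t^-1 *: (S t w - w) - w).
  rewrite [t *: (_ - w)]scalerBr scalerA mulfV ?gt_eqF// scale1r opprB addrCA subKr.
  by rewrite scalerDl scale1r addrC.
have : ipnorm ip ((1 + t) *: w) <= ipnorm ip (S t w) + t * e.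
  rewrite E; apply: le_trans (ipnormD ipP _ _) _; rewrite (ipnormN ipP).
  by rewrite lerD2l (ipnormZ ipP) gtr0_norm// ler_pM2l.
rewrite (ipnormZ ipP) gtr0_norm; last by lra.
have := ipnorm_ge0 ip w; nra.
Qed.

(** * The Lumer-Phillips theorem *)

Lemma expR_quad {R : realType} (s : R) : `|s| <= 1 / 2 ->
  `|expR s - 1 - s| <= 2 * s ^+ 2.
Proof.
rewrite ler_norml => /andP[s1 s2].
have h1 := expR_ge1Dx s; have h2 := expR_ge1Dx (- s).
rewrite ger0_norm; last by lra.
have h3 : expR s * (1 - s) <= 1.
  by rewrite -[leRHS](expRxMexpNx_1 s) ler_pM2l ?expR_gt0//; lra.
have : (expR s) <= 1 + s + 2 * s ^+ 2; last by lra.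
rewrite -(@ler_pM2r _ (1 - s)); last by lra.
apply: le_trans h3 _; nra.
Qed.

Lemma expR_at0 {R : realType} (w : R) : expR (w * h) @[h --> 0^'+] --> (1 : R).
Proof.
have -> : (1 : R) = expR (w * 0) by rewrite mulr0 expR0.
apply: cvg_at_right_filter; apply: continuous_cvg; first exact: continuous_expR.
by apply: cvgM; [exact: cvg_cst|exact: cvg_id].
Qed.

Lemma expR_quot {R : realType} (w : R) :
  h^-1 * (expR (w * h) - 1) @[h --> 0^'+] --> w.
Proof.
apply/(@cvg_at0P R R^o) => e e0.
have w0 := normr_ge0 w; have ww := real_normK (num_real w).
exists (Num.min (1 / (2 * (`|w| + 1))) (e / (2 * (w ^+ 2 + 1)))).
  by rewrite lt_min !divr_gt0 ?mulr_gt0//; nra.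
move=> h h0; rewrite lt_min !ltr_pdivlMr ?mulr_gt0//; [|nra..].
move=> /andP[h1 h2].
have wh : `|w * h| <= 1 / 2 by rewrite normrM (gtr0_norm h0); nra.
have := expR_quad wh => hq.
have -> : h^-1 * (expR (w * h) - 1) - w = h^-1 * (expR (w * h) - 1 - w * h).
  by rewrite [RHS]mulrBr mulrCA mulVf ?gt_eqF// mulr1.
rewrite normrM gtr0_norm ?invr_gt0// ltr_pdivrMl//.
apply: le_lt_trans hq _; rewrite exprMn; nra.
Qed.

Section Shift.
Context {R : realType} {V : normedModType R} (W : set V).
Hypothesis sW : linear_subspace W.

(** The product rule for [expR (w t)] and [S t x] at [t = 0]. *)
Lemma expR_generator (w : R) (S : R -> V -> V) x y :
  S h x @[h --> 0^'+] --> x ->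
  h^-1 *: (S h x - x) @[h --> 0^'+] --> y ->
  h^-1 *: (expR (w * h) *: S h x - x) @[h --> 0^'+] --> y + w *: x.
Proof.
move=> Sx hy.
have -> : (fun h => h^-1 *: (expR (w * h) *: S h x - x)) =
  (fun h => h^-1 *: (S h x - x) + (h^-1 * (expR (w * h) - 1)) *: S h x).
  apply/funext => h; rewrite -scalerA -scalerDr; congr (_ *: _).
  by rewrite scalerBl scale1r [RHS]addrC subrKA.
by apply: cvgD => //; apply: cvgZ => //; exact: expR_quot.
Qed.

Lemma C0_semigroup_shift (w : R) S : C0_semigroup W S ->
  C0_semigroup W (fun t x => expR (w * t) *: S t x).
Proof.
move=> [S1 S2 S3 S4]; split.
- move=> t t0; have [SW Sl [M SM]] := S1 t t0; split=> [x Wx|a x y Wx Wy|].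
  + by apply: (subspaceZ sW); exact: SW.
  + by rewrite Sl// scalerDr !scalerA mulrC.
  + exists (expR (w * t) * M) => x Wx.
    rewrite normrZ gtr0_norm ?expR_gt0// -mulrA ler_pM2l ?expR_gt0//; exact: SM.
- by move=> x Wx; rewrite mulr0 expR0 scale1r S2.
- move=> s t x s0 t0 Wx; have [SWs Sls _] := S1 s s0; have [SWt _ _] := S1 t t0.
  rewrite S3// mulrDr expRD -scalerA; congr (_ *: _).
  have Wy := SWt _ Wx; have := Sls (expR (w * t)) (S t x) 0 Wy sW.1.
  have S0 : S s 0 = 0.
    by have := Sls (-1) 0 0 sW.1 sW.1; rewrite scaler0 addr0 scaleN1r addNr.
  by rewrite S0 !addr0 => ->.
- move=> x Wx; rewrite -[X in _ --> X]scale1r.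
  by apply: cvgZ; [exact: expR_at0|exact: S4].
Qed.

Lemma generates_shift (w : R) (D : set V) (A : V -> V) :
  generates_C0_semigroup W D (fun x => A x - w *: x) ->
  generates_C0_semigroup W D A.
Proof.
move=> [S [SC SG]]; exists (fun t x => expR (w * t) *: S t x).
split; first exact: C0_semigroup_shift.
have [_ _ _ S4] := SC.
move=> x y; have := SG x (y - w *: x) => -[h1 h2]; split.
  move=> [Dx <-]; have [|Wx Wy hy] := (SG x (A x - w *: x)).1; first by split.
  split=> //; first by rewrite -[A x](subrK (w *: x)); apply: (subspaceD sW) => //; exact: subspaceZ.
  by have := expR_generator (w := w) (S4 _ Wx) hy; rewrite subrK.
move=> [Wx Wy hy]; have [|Dx Ax] := h2.
  split => //; first by apply: (subspaceB sW) => //; exact: subspaceZ.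
  have Sx' : expR (w * h) *: S h x @[h --> 0^'+] --> x.
    by have [_ _ _] := C0_semigroup_shift w SC; apply.
  have := @expR_generator (- w) (fun h u => expR (w * h) *: S h u) x y Sx' hy; rewrite scaleNr.
  set f := (X in X @ _ --> _); set g := (X in _ -> X @ _ --> _).
  suff -> : f = g by [].
  apply/funext => h; rewrite /f /g scalerA -expRD mulNr addNr expR0 scale1r.
  by [].
by split=> //; move/eqP: Ax; rewrite subr_eq subrK => /eqP.
Qed.

End Shift.

(** [A - k] is dissipative for [w <= k], and [1 - h (A - k)] is a multiple of
    [1 - h' A] with [h' = h / (1 + h k) < k^-1]: taking [h0^-1 <= k] as well,
    small steps for [A] give all steps for [A - k]. *)
Theorem lumer_phillips {R : realType} {V : normedModType R} (W D : set V)
    (A : V -> V) (ip : V -> V -> R) (w h0 : R) :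
  inner_product ip -> linear_subspace W -> linear_subspace D -> D `<=` W ->
  linear_on D A -> (forall x, D x -> W (A x)) -> seq_complete W ->
  (forall x, D x -> ip (A x) x <= w * ip x x) ->
  0 < h0 ->
  (forall (h : R) y, 0 < h -> h < h0 -> W y -> exists x, D x /\ x - h *: A x = y) ->
  generates_C0_semigroup W D A.
Proof.
move=> ipP sW sD DW lA AW cW dissA h00 rangeA.
pose k := `|w| + h0^-1; have h0i : 0 < h0^-1 by rewrite invr_gt0.
have w0 := normr_ge0 w; have wk : w <= k by have := ler_norm w; rewrite /k; lra.
have k0 : 0 < k by rewrite /k; lra.
apply: (generates_shift sW (w := k)); apply: (lumer_phillips_contr ipP) => //.
- move=> a x y Dx Dy; rewrite lA// scalerBr [k *: _]scalerDr opprD addrACA.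
  by rewrite !scalerA [k * a]mulrC.
- by move=> x Dx; apply: (subspaceB sW); [exact: AW|apply: (subspaceZ sW); exact: DW].
- move=> x Dx; rewrite (ipD ipP) (ipN ipP) (ipZ ipP).
  by have := dissA x Dx; have := ip_ge0 ipP x; nra.
move=> h y hp Wy; have d0 : 0 < 1 + h * k by nra.
pose h' := h / (1 + h * k).
have h'p : 0 < h' by rewrite divr_gt0.
have h'h : h' < h0.
  rewrite /h' ltr_pdivrMr// mulrDr mulr1 mulrCA.
  have -> : h0 * k = h0 * `|w| + 1 by rewrite /k mulrDr mulfV ?gt_eqF.
  by rewrite mulrDr mulr1; have := mulr_ge0 (ltW hp) (mulr_ge0 (ltW h00) w0); lra.
have [x [Dx hx]] := rangeA h' ((1 + h * k)^-1 *: y) h'p h'h (subspaceZ sW _ Wy).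
exists x; split=> //.
have : (1 + h * k) *: (x - h' *: A x) = y by rewrite hx scalerA mulfV ?gt_eqF// scale1r.
rewrite scalerBr scalerA /h' mulrCA mulfV ?gt_eqF// mulr1 => <-.
by rewrite scalerBr opprB scalerA scalerDl scale1r addrA.
Qed.

(** * Growth of semigroups *)

Section Growth.
Context {R : realType} {V : normedModType R} (W : set V).
Hypothesis sW : linear_subspace W.
Hypothesis cW : seq_complete W.

Lemma bounded_almost_max (T : V -> V) : linear_on W T ->
  (exists M : R, forall x, W x -> `|T x| <= M * `|x|) ->
  exists B : R, [/\ 0 <= B, forall x, W x -> `|T x| <= B * `|x| &
    exists x, [/\ W x, `|x| <= 1 & 3 / 4 * B <= `|T x|]].
Proof.
move=> lT [M hM]; pose E := [set `|T x| | x in [set x | W x /\ `|x| <= 1]].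
have W0 := sW.1; have T0 := linear_on0 sW lT.
have E0 : E 0 by exists 0; [split=> //; rewrite normr0|rewrite T0 normr0].
have hE : has_sup E.
  split; first by exists 0.
  exists `|M| => _ [x [Wx x1] <-]; apply: le_trans (hM x Wx) _.
  by have := ler_norm M; have := normr_ge0 x; have := normr_ge0 M; nra.
have B0 : 0 <= sup E by apply: (ub_le_sup hE.2).
exists (sup E); split=> //.
  move=> x Wx; have [->|x0] := eqVneq x 0; first by rewrite T0 !normr0 mulr0.
  have nx : 0 < `|x| by rewrite normr_gt0.
  rewrite -ler_pdivrMr//; apply: (ub_le_sup hE.2); exists (`|x|^-1 *: x).
    split; first exact: subspaceZ.
    by rewrite normrZ gtr0_norm ?invr_gt0// mulVf ?gt_eqF.
  by rewrite (linear_onZ sW _ lT)// normrZ gtr0_norm ?invr_gt0// mulrC.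
have [s0|s0] := eqVneq (sup E) 0.
  by exists 0; split=> //; rewrite ?normr0// s0 mulr0.
have sp : 0 < sup E by rewrite lt0r s0.
have [|_ [x [Wx x1] <-] hx] := @sup_adherent _ E (sup E / 4) _ hE.
  by rewrite divr_gt0.
by exists x; split=> //; lra.
Qed.

(** The uniform boundedness principle, by a series instead of category: vectors
    [y n] of norm about [3^-n], on which [T n] is nearly maximal, are added or
    subtracted so as to keep [T n] large on the partial sums; the tail of the
    series is too small to compensate. *)
Lemma gliding_hump (T : nat -> V -> V) : (forall n, linear_on W (T n)) ->
  (forall n, exists M : R, forall x, W x -> `|T n x| <= M * `|x|) ->
  (forall n, exists x, W x /\ 6 ^+ n * `|x| < `|T n x|) ->
  exists a, W a /\ forall n, 2 ^+ n / 4 <= `|T n a|.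
Proof.
move=> lT bT uT.
have /choice[Bx hBx] : forall n, exists p : R * V,
    [/\ 6 ^+ n <= p.1, forall x, W x -> `|T n x| <= p.1 * `|x|, W p.2,
     `|p.2| <= 1 & 3 / 4 * p.1 <= `|T n p.2|].
  move=> n; have [B [B0 hB [x [Wx x1 hx]]]] := bounded_almost_max (lT n) (bT n).
  exists (B, x); split=> //=; have [z [Wz hz]] := uT n.
  have := lt_le_trans hz (hB z Wz); have := normr_ge0 z; nra.
pose y n := (3^-1 ^+ n : R) *: (Bx n).2.
pose step n (a : V) := if `|T n (a - y n)| <= `|T n (a + y n)| then a + y n else a - y n.
pose fix a n := if n is k.+1 then step k (a k) else 0.
have t0 n : 0 < (3^-1 ^+ n : R) by rewrite exprn_gt0// invr_gt0.
have Wy n : W (y n) by apply: (subspaceZ sW); have [] := hBx n.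
have Wa n : W (a n).
  elim: n => [|n IH] /=; first exact: sW.1.
  by rewrite /step; case: ifP => _; [exact: subspaceD|exact: subspaceB].
have yn n : `|y n| <= 3^-1 ^+ n.
  rewrite normrZ gtr0_norm//; have [_ _ _ h _] := hBx n.
  by rewrite -[leRHS]mulr1 ler_pM2l.
have astep n : `|a n.+1 - a n| <= 3^-1 ^+ n.
  rewrite /= /step; case: ifP => _; first by rewrite addrC addKr.
  by rewrite addrC addKr normrN.
have tail n d : `|a n - a (n + d)%N| <= 3 / 2 * (3^-1 ^+ n - 3^-1 ^+ (n + d)).
  elim: d => [|d IH]; first by rewrite addn0 !subrr normr0 mulr0.
  have st := astep (n + d)%N; rewrite distrC in st.
  have tr := ler_distD (a (n + d)%N) (a n) (a (n + d).+1).
  by rewrite addnS (exprS _ (n + d)%N); lra.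
have tail' n p : (n <= p)%N -> `|a n - a p| <= 3 / 2 * 3^-1 ^+ n.
  move=> np; have := tail n (p - n)%N; rewrite subnKC//.
  by have := t0 p; lra.
have small (e : R) : 0 < e -> exists n, 3^-1 ^+ n < e.
  move=> e0; exists (Num.truncn e^-1).+1.
  rewrite exprVn invf_plt ?posrE ?exprn_gt0//.
  apply: lt_le_trans (truncnS_gt _) _; rewrite -natrX ler_nat.
  by apply: ltnW; exact: ltn_expl.
have [|l [Wl hl]] := cW Wa.
  move=> e e0; have [|n hn] := small (e / 3); first by rewrite divr_gt0.
  exists n => p q np nq; rewrite -(subrKA (a n)); apply: le_lt_trans (ler_normD _ _) _.
  by have := tail' n p np; have := tail' n q nq; rewrite (distrC (a p)); lra.
exists l; split=> // n; have [B6 hB Wx x1 hx] := hBx n.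
have la : `|l - a n.+1| <= 1 / 2 * 3^-1 ^+ n.
  apply/ler_addgt0Pr => e e0; have [k hk] := hl e e0.
  pose p := maxn k n.+1.
  have d1 := hk p (leq_maxl _ _); have d2 := tail' n.+1 p (leq_maxr k n.+1).
  have d3 := ler_distD (a p) l (a n.+1).
  by move: d1 d2 d3; rewrite exprS (distrC (a p) l) (distrC (a p) (a n.+1)); lra.
(* one of [T n (a n + y n)], [T n (a n - y n)] is at least as large as [T n (y n)] *)
have c1 : 3 / 4 * (Bx n).1 * 3^-1 ^+ n <= `|T n (a n.+1)|.
  have Ty : 3 / 4 * (Bx n).1 * 3^-1 ^+ n <= `|T n (y n)|.
    rewrite /y (linear_onZ sW _ (lT n))// normrZ gtr0_norm// mulrC ler_pM2l//.
  apply: le_trans Ty _.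
  have TD := linear_onD (lT n) (Wa n) (Wy n).
  have TB := linear_onB (lT n) (Wa n) (Wy n).
  have : 2 * `|T n (y n)| <= `|T n (a n + y n)| + `|T n (a n - y n)|.
    rewrite TD TB; apply: le_trans (ler_normB _ _).
    by rewrite opprB addrC subrKA -mulr2n -[X in _ <= `|X|]scaler_nat normrZ normr_nat.
  by rewrite /= /step; case: ifP => [|/negbT]; rewrite -?ltNge => h1 h2; lra.
have c2 : `|T n (l - a n.+1)| <= (Bx n).1 * (1 / 2 * 3^-1 ^+ n).
  apply: le_trans (hB _ (subspaceB sW Wl (Wa _))) _.
  by apply: ler_wpM2l la; apply: le_trans B6; rewrite exprn_ge0.
have c3 : `|T n (a n.+1)| <= `|T n l| + `|T n (l - a n.+1)|.
  rewrite (linear_onB (lT n) Wl (Wa _)) -{1}[T n (a n.+1)](subKr (T n l)).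
  exact: ler_normB.
have c4 : 2 ^+ n <= (Bx n).1 * 3^-1 ^+ n.
  have -> : (2 : R) = 6 * 3^-1 by field.
  by rewrite exprMn ler_pM2r.
lra.
Qed.

Lemma C0_semigroup_lin S t : C0_semigroup W S -> 0 <= t -> linear_on W (S t).
Proof. by move=> [S1 _ _ _] t0; have [_ ? _] := S1 t t0. Qed.

(** Otherwise the operators at some times tending to 0 are unbounded, hence
    unbounded on one vector, against the continuity of its orbit at 0. *)
Lemma C0_semigroup_local_bound S : C0_semigroup W S ->
  exists M d : R, [/\ 1 <= M, 0 < d &
    forall t x, 0 <= t -> t <= d -> W x -> `|S t x| <= M * `|x|].
Proof.
move=> SC; have [S1 S2 S3 S4] := SC; apply: contrapT => nb.
have /choice[t ht] : forall n, exists t, [/\ 0 <= t, t <= mesh n &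
    exists x, W x /\ 6 ^+ n * `|x| < `|S t x|].
  move=> n; apply: contrapT => nt; apply: nb.
  exists (6 ^+ n), (mesh n); split; rewrite ?mesh_gt0 ?exprn_ege1//; first by lra.
  move=> t x t0 tn Wx; rewrite leNgt; apply/negP => h; apply: nt.
  by exists t; split=> //; exists x.
have [|n|n|a [Wa ha]] := @gliding_hump (fun n => S (t n)).
- by move=> n; apply: C0_semigroup_lin => //; have [] := ht n.
- by have [t0 _ _] := ht n; have [_ _] := S1 _ t0.
- by have [_ _] := ht n.
have [d d0 hd] := (cvg_at0P _ _).1 (S4 _ Wa) 1 ltr01.
have [n1 h1] := @mesh_small R d d0.
pose n := maxn n1 (Num.truncn (4 * (`|a| + 1))).+1.
have [t0 tn _] := ht n; have := ha n.
have : `|S (t n) a| <= `|a| + 1.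
  move: t0; rewrite le_eqVlt => /predU1P[<-|tp]; first by rewrite S2//; lra.
  have := hd _ tp (le_lt_trans tn (h1 _ (leq_maxl _ _))).
  by have := ler_distD a (S (t n) a) 0; rewrite !subr0; lra.
have : 4 * (`|a| + 1) < 2 ^+ n; last by lra.
apply: lt_le_trans (truncnS_gt _) _; rewrite -natrX ler_nat.
by apply: leq_trans (leq_maxr n1 _) _; rewrite -/n; exact/ltnW/ltn_expl.
Qed.

Lemma C0_semigroup_growth S : C0_semigroup W S ->
  exists M w : R, [/\ 0 < M, 0 <= w &
    forall t x, 0 <= t -> W x -> `|S t x| <= M * expR (w * t) * `|x|].
Proof.
move=> SC; have [S1 S2 S3 S4] := SC.
have [M [d [M1 d0 hM]]] := C0_semigroup_local_bound SC.
have M0 : 0 < M by lra.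
have SW t x : 0 <= t -> W x -> W (S t x).
  by move=> t0 Wx; have [h _ _] := S1 t t0; exact: h.
exists M, (ln M / d); split; rewrite ?divr_ge0 ?ln_ge0 ?(ltW d0)// => t x t0 Wx.
have it n r : 0 <= r -> r <= d -> `|S (n%:R * d + r) x| <= M * M ^+ n * `|x|.
  move=> r0 rd; elim: n => [|n IH]; first by rewrite mul0r add0r mulr1; exact: hM.
  have nr0 : 0 <= n%:R * d + r by rewrite addr_ge0// mulr_ge0// ltW.
  rewrite -natr1 mulrDl mul1r addrAC addrC S3//; last exact: ltW.
  apply: le_trans (hM _ _ (ltW d0) (lexx d) (SW _ _ nr0 Wx)) _.
  by rewrite exprS [M * (M * _)]mulrCA -!mulrA ler_pM2l// mulrA.
pose n := Num.truncn (t / d).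
have /andP[n1 n2] : n%:R <= t / d < n.+1%:R by apply: truncn_itv; rewrite divr_ge0// ltW.
rewrite ler_pdivlMr// in n1; rewrite ltr_pdivrMr// -natr1 mulrDl mul1r in n2.
have := it n (t - n%:R * d); rewrite subrKC.
move=> /(_ _ _)/le_trans; apply; [lra|lra|].
rewrite ler_wpM2r// ler_pM2l// -[M in leLHS]lnK ?posrE// -expRM_natl ler_expR.
rewrite [leRHS]mulrAC -[leRHS]mulrA [leLHS]mulrC ler_wpM2l ?ln_ge0//.
by rewrite ler_pdivlMr.
Qed.

(** The resolvent estimate of Hille and Yosida, in discrete time:
    [expR (l h) x - S h x] is [h (l x - g)] up to a smaller term, and iterating
    [n] times bounds [expR (l n h) x - S (n h) x], where the first term
    dominates. *)
Lemma generator_resolvent_bound S M w l x g : C0_semigroup W S ->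
  0 < M -> 0 <= w -> (forall t x, 0 <= t -> W x -> `|S t x| <= M * expR (w * t) * `|x|) ->
  w < l -> W x -> h^-1 *: (S h x - x) @[h --> 0^'+] --> g ->
  (l - w) * `|x| <= M * `|l *: x - g|.
Proof.
move=> SC M0 w0 hM wl Wx hg; have [S1 S2 S3 S4] := SC.
have SW t y : 0 <= t -> W y -> W (S t y).
  by move=> t0 Wy; have [h _ _] := S1 t t0; exact: h.
apply/ler_addgt0Pr => e e0.
have eM : 0 < e / M / 2 by rewrite !divr_gt0.
have [d1 d10 h1] := (cvg_at0P _ _).1 hg _ eM.
have c2 : (h^-1 * (expR (l * h) - 1)) *: x @[h --> 0^'+] --> l *: x.
  by apply: cvgZ; [exact: expR_quot|exact: cvg_cst].
have [d2 d20 h2] := (cvg_at0P _ _).1 c2 _ eM.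
pose h := Num.min d1 d2 / 2.
have hp : 0 < h by rewrite divr_gt0// lt_min d10.
have hd1 : h < d1 by rewrite /h; have := ge_min d1 d1 d2; rewrite lexx /=; lra.
have hd2 : h < d2 by rewrite /h; have := ge_min d2 d1 d2; rewrite lexx orbT /=; lra.
have {}h1 := h1 h hp hd1; have {}h2 := h2 h hp hd2.
set F := `|l *: x - g| + e / M.
pose L := expR (l * h); pose O := expR (w * h).
have O0 : 0 < O by exact: expR_gt0.
have L0 : 0 < L by exact: expR_gt0.
have OL : O < L by rewrite ltr_expR ltr_pM2r.
have s1 : `|L *: x - S h x| <= h * F.
  have -> : L *: x - S h x = h *: (h^-1 *: ((L - 1) *: x) - h^-1 *: (S h x - x)).
    rewrite -scalerBr scalerA mulfV ?gt_eqF// scale1r.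
    by rewrite scalerBl scale1r opprB subrKA.
  rewrite normrZ gtr0_norm// ler_pM2l//.
  have -> : h^-1 *: ((L - 1) *: x) - h^-1 *: (S h x - x) = (l *: x - g) +
     (((h^-1 * (L - 1)) *: x - l *: x) - (h^-1 *: (S h x - x) - g)).
    by rewrite scalerA [in RHS]subrACA [RHS]addrC subrK.
  apply: le_trans (ler_normD _ _) _; rewrite lerD2l.
  by apply: le_trans (ler_normB _ _) _; rewrite /L; lra.
have F0 : 0 <= F by rewrite addr_ge0// divr_ge0// ltW.
set K := h * F * M / (L - O).
have K0 : 0 <= K.
  by rewrite /K divr_ge0 ?(mulr_ge0 (mulr_ge0 (ltW hp) F0)) ?(ltW M0) ?subr_ge0 ?(ltW OL)//.
have sn n : `|L ^+ n *: x - S (n%:R * h) x| <= K * (L ^+ n - O ^+ n).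
  elim: n => [|n IH].
    by rewrite mul0r S2// scale1r subrr normr0 expr0 subrr mulr0.
  have n0 : 0 <= n%:R * h by rewrite mulr_ge0// ltW.
  have -> : L ^+ n.+1 *: x - S (n.+1%:R * h) x =
      L *: (L ^+ n *: x - S (n%:R * h) x) + S (n%:R * h) (L *: x - S h x).
    have lS := C0_semigroup_lin SC n0.
    rewrite (linear_onB lS); [|exact: subspaceZ|exact/SW/Wx/ltW].
    rewrite (linear_onZ sW _ lS)// scalerBr scalerA -exprS addrA subrK.
    by rewrite -S3 ?(ltW hp)// -natr1 mulrDl mul1r.
  apply: le_trans (ler_normD _ _) _.
  have c1 : `|L *: (L ^+ n *: x - S (n%:R * h) x)| <= L * (K * (L ^+ n - O ^+ n)).
    by rewrite normrZ gtr0_norm// ler_pM2l.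
  have c3 : `|S (n%:R * h) (L *: x - S h x)| <= M * O ^+ n * (h * F).
    apply: le_trans (hM _ _ n0 _) _.
      by apply: (subspaceB sW); [exact: subspaceZ|exact/SW/Wx/ltW].
    rewrite mulrCA expRM_natl -/O ler_pM2l// mulr_gt0// exprn_gt0//.
  have KE : K * (L - O) = h * F * M by rewrite /K divfK// subr_eq0 gt_eqF.
  have E : M * O ^+ n * (h * F) = K * (L - O) * O ^+ n by rewrite KE; ring.
  by rewrite E in c3; rewrite !exprS; move: c1 c3; lra.
have xK : `|x| <= K.
  apply/ler_addgt0Pr => e' e'0.
  have q1 : 0 <= O / L by rewrite divr_ge0 ?ltW.
  have q2 : O / L < 1 by rewrite ltr_pdivrMr// mul1r.
  have := @cvg_expr R (O / L); rewrite ger0_norm// => /(_ q2)/cvgrPdist_lt.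
  have Mx : 0 < M * `|x| + 1 by rewrite ltr_wpDl// mulr_ge0// ltW.
  move=> /(_ (e' / (M * `|x| + 1))) [|n0 _ hn]; first by rewrite divr_gt0.
  have := hn n0 (leqnn n0); rewrite sub0r normrN ger0_norm ?exprn_ge0//.
  rewrite ltr_pdivlMr// => hq.
  have Ln : 0 < L ^+ n0 by rewrite exprn_gt0.
  have := sn n0; have := hM (n0%:R * h) x; rewrite mulr_ge0 ?(ltW hp)// => /(_ isT Wx).
  rewrite [w * _]mulrCA expRM_natl -/O.
  have : L ^+ n0 * `|x| <= `|L ^+ n0 *: x - S (n0%:R * h) x| + `|S (n0%:R * h) x|.
    have := ler_distD (S (n0%:R * h) x) (L ^+ n0 *: x) 0.
    by rewrite !subr0 normrZ gtr0_norm.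
  move=> a1 a2 a3; rewrite -(ler_pM2l Ln).
  have a4 : O ^+ n0 = L ^+ n0 * (O / L) ^+ n0 by rewrite -exprMn mulrC divfK// gt_eqF.
  have a5 : 0 <= O ^+ n0 by rewrite exprn_ge0// ltW.
  have a6 : M * `|x| * (O / L) ^+ n0 <= e'.
    by have : 0 <= (O / L) ^+ n0 by [rewrite exprn_ge0]; lra.
  have : L ^+ n0 * (M * `|x| * (O / L) ^+ n0) <= L ^+ n0 * e' by rewrite ler_pM2l.
  have : K * (L ^+ n0 - O ^+ n0) <= K * L ^+ n0 by rewrite ler_wpM2l// lerBlDr lerDl.
  by move: a2; rewrite a4; nra.
have O1 : 1 <= O by rewrite /O -[leLHS]expR0 ler_expR mulr_ge0// ltW.
have LO : (l - w) * h <= L - O.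
  have -> : L = O * expR ((l - w) * h) by rewrite -expRD -mulrDl addrC subrK.
  have := expR_ge1Dx ((l - w) * h).
  have : 0 < (l - w) * h by rewrite mulr_gt0// subr_gt0.
  by move: (_ * h) => k k0 k1; nra.
have LO0 : 0 < L - O by rewrite subr_gt0.
have : K * (L - O) = h * F * M by rewrite /K divfK// gt_eqF.
have MF : M * F = M * `|l *: x - g| + e by rewrite /F mulrDr mulrCA divff ?gt_eqF// mulr1.
rewrite -MF => KE; rewrite -(ler_pM2l hp).
have : h * ((l - w) * `|x|) <= (L - O) * K.
  by rewrite mulrA [h * _]mulrC; apply: ler_pM => //; rewrite mulr_ge0 ?subr_ge0 ?(ltW wl) ?(ltW hp).
by move/le_trans; apply; rewrite [leLHS]mulrC KE mulrAC -mulrA mulrC mulrA.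
Qed.

End Growth.

(** * Integration on the unit interval *)

Section IntegralsOnInterval.
Context {R : realType}.
Local Notation mu := (@mu01 R).
Local Notation leb := (@lebesgue_measure R).
Local Notation int1 f := (mu.-integrable setT (EFin \o f)).
Local Notation "'I' f" := (\int[mu]_x f x) (at level 10, f at level 8).
Implicit Types (f g h : R -> R).

Lemma mu01_setT : mu setT = 1%E.
Proof.
rewrite /mu01 /mrestr setTI lebesgue_measure_itv/= lte_fin ltr01.
by rewrite -EFinD subr0.
Qed.

Lemma ae_mu01 (P : R -> Prop) : (forall x, 0 < x < 1 -> P x) -> {ae mu, forall x, P x}.
Proof.
move=> h; exists (~` `]0, 1[%classic); split; first exact: measurableC.
  by rewrite /mu01/= /mrestr setICl measure0.
by move=> x /= nP; rewrite in_itv/= => x01; apply: nP; exact: h.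
Qed.

Lemma ae_leb_mu01 (P : R -> Prop) : {ae leb, forall x, P x} -> {ae mu, forall x, P x}.
Proof.
move=> [N [mN N0 hN]]; exists N; split => //.
apply/eqP; rewrite -measure_le0 /mu01 /mrestr /= -N0; apply: le_measure; rewrite ?inE//.
exact: measurableI.
Qed.

Lemma integral_mu01 (f : R -> \bar R) : measurable_fun setT f ->
  (\int[mu]_x f x = \int[leb]_(x in `]0%R, 1%R[) f x)%E.
Proof.
move=> mf.
have <- : (\int[mu]_(x in `]0%R, 1%R[) f x = \int[leb]_(x in `]0%R, 1%R[) f x)%E.
  apply: eq_measure_integral => A mA AD.
  by rewrite -[LHS]/(leb (A `&` _)) setIidl.
rewrite [RHS]integral_mkcond; apply: ae_eq_integral => //.
  by apply/(measurable_restrictT _ _).1 => //; exact: measurable_funS mf.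
apply: ae_mu01 => x x01 _; rewrite patchE mem_set//=.
Qed.

Lemma int1_measurable f : int1 f -> measurable_fun setT f.
Proof. by move/measurable_int => h; exact/measurable_EFinP. Qed.

Lemma int1_leb f : measurable_fun setT f ->
  int1 f <-> leb.-integrable `]0%R, 1%R[ (EFin \o f).
Proof.
move=> mf; have mF : measurable_fun setT (EFin \o f) by exact/measurable_EFinP.
have E : (\int[mu]_x `|(f x)%:E| = \int[leb]_(x in `]0%R, 1%R[) `|(f x)%:E|)%E.
  by apply: integral_mu01; exact: measurableT_comp.
split => /integrableP[_ h]; apply/integrableP; split => //.
- exact: measurable_funS mF.
- by rewrite -E.
- by rewrite E.
Qed.

Lemma Rint_mu01 f : measurable_fun setT f -> I f = \int[leb]_(x in `]0%R, 1%R[) f x.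
Proof. by move=> mf; congr fine; apply: integral_mu01; exact/measurable_EFinP. Qed.

Lemma int1D f g : int1 f -> int1 g -> int1 (fun x => f x + g x).
Proof. by move=> hf hg; have := integrableD measurableT hf hg. Qed.

Lemma int1Z (a : R) f : int1 f -> int1 (fun x => a * f x).
Proof. by move=> hf; have := integrableZl measurableT a hf. Qed.

Lemma int1B f g : int1 f -> int1 g -> int1 (fun x => f x - g x).
Proof. by move=> hf hg; have := integrableB measurableT hf hg. Qed.

Lemma int1_norm f : int1 f -> int1 (fun x => `|f x|).
Proof. by move=> hf; exact: (integrable_norm hf). Qed.

Lemma int1_cst (a : R) : int1 (fun _ => a).
Proof. exact: finite_measure_integrable_cst. Qed.

Lemma int1_le f g : measurable_fun setT f -> int1 g ->
  (forall x, `|f x| <= `|g x|) -> int1 f.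
Proof.
move=> mf hg fg; apply: le_integrable hg => //; first exact/measurable_EFinP.
by move=> x _; rewrite /= lee_fin.
Qed.

Lemma ID f g : int1 f -> int1 g -> I (fun x => f x + g x) = I f + I g.
Proof. exact: RintegralD. Qed.

Lemma IB f g : int1 f -> int1 g -> I (fun x => f x - g x) = I f - I g.
Proof. exact: RintegralB. Qed.

Lemma IZ (a : R) f : int1 f -> I (fun x => a * f x) = a * I f.
Proof. exact: RintegralZl. Qed.

Lemma I_cst (a : R) : I (fun _ => a) = a.
Proof. by rewrite Rintegral_cst// [X in fine X]mu01_setT mulr1. Qed.

Lemma I_ae f g : measurable_fun setT f -> measurable_fun setT g ->
  {ae mu, forall x, f x = g x} -> I f = I g.
Proof.
move=> mf mg fg; congr fine; apply: ae_eq_integral => //;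
  [exact/measurable_EFinP|exact/measurable_EFinP|].
by apply: (@filterS _ _ (ae_filter_ringOfSetsType mu) _ _ _ fg) => x e _ /=; rewrite e.
Qed.

Lemma int1_ae f g : measurable_fun setT g -> int1 f ->
  {ae mu, forall x, f x = g x} -> int1 g.
Proof.
move=> mg hf fg; apply/integrableP; split; first exact/measurable_EFinP.
move/integrableP: (hf) => [mf]; congr (_ < _)%E; apply: ae_eq_integral => //.
- exact: measurableT_comp.
- by apply: measurableT_comp => //; exact/measurable_EFinP.
- by apply: (@filterS _ _ (ae_filter_ringOfSetsType mu) _ _ _ fg) => x e _ /=; rewrite e.
Qed.

Lemma I_le f g : int1 f -> int1 g -> {ae mu, forall x, f x <= g x} -> I f <= I g.
Proof.
move=> hf hg fg.
have mf := int1_measurable hf; have mg := int1_measurable hg.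
have mm : measurable_fun setT (fun x => Num.min (f x) (g x)) by exact: measurable_minr.
have hm : {ae mu, forall x, f x = Num.min (f x) (g x)}.
  by apply: (@filterS _ _ (ae_filter_ringOfSetsType mu) _ _ _ fg) => x fgx; rewrite min_l.
rewrite (I_ae mf mm hm); apply: le_Rintegral => //; first exact: int1_ae hm.
by move=> x _; rewrite ge_min lexx orbT.
Qed.

Lemma I_ge0 f : (forall x, 0 <= f x) -> 0 <= I f.
Proof. by move=> f0; apply: Rintegral_ge0 => x _; exact: f0. Qed.

Lemma I_norm f : int1 f -> `|I f| <= I (fun x => `|f x|).
Proof. exact: le_normr_Rintegral. Qed.

Local Notation sq f := (f \in Lfun mu 2%:E).

Lemma sq_measurable f : sq f -> measurable_fun setT f.
Proof. by rewrite inE => /andP[]; rewrite inE. Qed.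

Lemma sqM f g : sq f -> sq g -> int1 (fun x => f x * g x).
Proof. by move=> hf hg; apply/Lfun1_integrable; exact: Lfun2_mul_Lfun1. Qed.

Lemma sq_int1 f : sq f -> int1 f.
Proof.
move=> hf; apply/Lfun1_integrable; apply: Lfun_subset12 hf.
by rewrite [X in X \is a _]mu01_setT.
Qed.

Lemma sqP f : sq f <-> measurable_fun setT f /\ int1 (fun x => f x ^+ 2).
Proof.
split=> [hf|[mf hf]]; first by split; [exact: sq_measurable|exact: Lfun2_integrable_sqr].
rewrite inE; apply/andP; split; first by rewrite inE.
rewrite inE/= /finite_norm unlock poweR_lty//.
move/integrableP: hf => [_]; congr (_ < _)%E; apply: eq_integral => x _.
by rewrite /= normrX powR_mulrn.
Qed.

Lemma sqD f g : sq f -> sq g -> sq (fun x => f x + g x).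
Proof. by move=> hf hg; apply: (rpredD hf hg); rewrite lee1n. Qed.

Lemma sqZ (a : R) f : sq f -> sq (fun x => a * f x).
Proof. by move=> hf; apply: (rpredZ a hf); rewrite lee1n. Qed.

Lemma cont_measurable f : continuous f -> measurable_fun setT f.
Proof. exact: continuous_measurable_fun. Qed.

Lemma cont_bounded f : continuous f -> exists M, forall x, 0 <= x <= 1 -> `|f x| <= M.
Proof.
move=> cf; have [|c _ cM] := @EVT_max R (fun x => `|f x|) 0 1 ler01.
  by apply: continuous_subspaceT => x; apply: cvg_norm; exact: cf.
by exists `|f c| => x x01; apply: cM; rewrite in_itv.
Qed.

Lemma int1_bounded_ae f g (M : R) : measurable_fun setT g ->
  {ae mu, forall x, `|g x| <= M} -> int1 f -> int1 (fun x => g x * f x).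
Proof.
move=> mg gM hf; pose g' x := Num.max (- `|M|) (Num.min (g x) `|M|).
have mg' : measurable_fun setT g'.
  by apply: measurable_maxr => //; exact: measurable_minr.
have mf := int1_measurable hf.
have h' : int1 (fun x => g' x * f x).
  apply: (@int1_le _ (fun x => `|M| * f x)) (int1Z _ hf) _.
    exact: measurable_funM.
  move=> x; rewrite !normrM normr_id ler_wpM2r// /g' ler_norml.
  by rewrite le_max lexx/= ge_max ge_min lexx orbT andbT ge0_cp.
apply: int1_ae h' _; first exact: measurable_funM.
apply: (@filterS _ _ (ae_filter_ringOfSetsType mu) _ _ _ gM) => x; rewrite ler_norml => /andP[h1 h2]; congr (_ * _).
have h3 := ler_norm M; rewrite /g' min_l; last by lra.
by rewrite max_r//; lra.
Qed.

Lemma int1_contM f g : continuous g -> int1 f -> int1 (fun x => g x * f x).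
Proof.
move=> cg; have [M hM] := cont_bounded cg.
apply: (@int1_bounded_ae _ _ M); first exact: cont_measurable.
by apply: ae_mu01 => x /andP[x0 x1]; apply: hM; rewrite !ltW.
Qed.

Lemma int1_cont f : continuous f -> int1 f.
Proof. by move=> cf; apply/sq_int1; exact: continuous_Lfun. Qed.

Lemma L1_dense f (e : R) : int1 f -> 0 < e ->
  exists g, continuous g /\ I (fun x => `|f x - g x|) < e.
Proof.
move=> hf e0; have mf := int1_measurable hf.
have H01 : (leb `]0%R, 1%R[ < +oo)%E.
  by rewrite lebesgue_measure_itv/= lte_fin ltr01 -EFinD ltry.
have [//|||g_ [cg ig]] := @approximation_continuous_integrable R `]0, 1[%classic f.
- exact: H01.
- exact/int1_leb.
have fin n : (\int[leb]_(z in `]0%R, 1%R[) `|(f z - g_ n z)%:E|)%E \is a fin_num.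
  rewrite ge0_fin_numE ?integral_ge0//.
  have hf' := (int1_leb mf).1 hf.
  have h := integrableB _ hf' (ig n).
  have /integrableP[_ h'] := h (measurable_itv _).
  exact: h'.
move/fine_cvgP => [_ /cvgrPdist_lt/(_ e e0)] [n _ hn].
exists (g_ n); split=> //; have := hn n (leqnn n).
rewrite sub0r normrN ger0_norm; last by rewrite fine_ge0// integral_ge0.
rewrite Rint_mu01//; apply: measurableT_comp => //; apply: measurable_funB => //.
exact: cont_measurable.
Qed.

End IntegralsOnInterval.

(** * Primitives of integrable functions *)

Section Primitive.
Context {R : realType}.
Local Notation mu := (@mu01 R).
Local Notation leb := (@lebesgue_measure R).
Local Notation int1 f := (mu.-integrable setT (EFin \o f)).
Local Notation "'I' f" := (\int[mu]_x f x) (at level 10, f at level 8).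
Implicit Types (f g h k l : R -> R).

(** Defined for all real [x], though the measure only sees the unit interval;
    the primitive is thus continuous on the whole line. *)
Definition prim k (x : R) : R := I (fun t => k t * (t <= x)%R%:R).

Let stepE (x : R) : (fun t => (t <= x)%R%:R) = \1_(`]-oo, x]%classic) :> (R -> R).
Proof. by apply/funext => t; rewrite indicE mem_setE in_itv. Qed.

Lemma step_measurable (x : R) : measurable_fun setT (fun t : R => (t <= x)%R%:R : R).
Proof. by rewrite stepE; exact: measurable_indic. Qed.

Lemma int1_step k x : int1 k -> int1 (fun t => k t * (t <= x)%R%:R).
Proof.
move=> hk; apply: (int1_le _ hk).
  by apply: measurable_funM; [exact: int1_measurable|exact: step_measurable].
by move=> t; case: (t <= x)%R; rewrite ?mulr1// mulr0 normr0.
Qed.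

Lemma primB k l x : int1 k -> int1 l -> prim (fun t => k t - l t) x = prim k x - prim l x.
Proof.
move=> hk hl; rewrite /prim -IB; [|exact: int1_step|exact: int1_step].
by apply: eq_Rintegral => t _; rewrite mulrBl.
Qed.

Lemma primD k l x : int1 k -> int1 l -> prim (fun t => k t + l t) x = prim k x + prim l x.
Proof.
move=> hk hl; rewrite /prim -ID; [|exact: int1_step|exact: int1_step].
by apply: eq_Rintegral => t _; rewrite mulrDl.
Qed.

Lemma primZ (a : R) k x : int1 k -> prim (fun t => a * k t) x = a * prim k x.
Proof.
move=> hk; rewrite /prim -IZ; last exact: int1_step.
by apply: eq_Rintegral => t _; rewrite mulrA.
Qed.

Lemma prim_ae k l x : measurable_fun setT k -> measurable_fun setT l ->
  {ae mu, forall t, k t = l t} -> prim k x = prim l x.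
Proof.
move=> mk ml kl; apply: I_ae.
- by apply: measurable_funM => //; exact: step_measurable.
- by apply: measurable_funM => //; exact: step_measurable.
- by apply: (@filterS _ _ (ae_filter_ringOfSetsType mu) _ _ _ kl) => t ->.
Qed.

Lemma prim_norm k x : int1 k -> `|prim k x| <= I (fun t => `|k t|).
Proof.
move=> hk; apply: le_trans (I_norm (int1_step x hk)) _.
apply: I_le; [exact/int1_norm/int1_step|exact: int1_norm|].
by apply: ae_mu01 => t _; case: (t <= x)%R; rewrite ?mulr1// mulr0 normr0.
Qed.

Lemma prim_le0 k x : int1 k -> x <= 0 -> prim k x = 0.
Proof.
move=> hk x0; rewrite -[RHS](I_cst (0 : R)); apply: I_ae => //.
  exact: int1_measurable (int1_step x hk).
by apply: ae_mu01 => t /andP[t0 _]; rewrite leNgt (le_lt_trans x0 t0) mulr0.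
Qed.

Lemma prim_ge1 k x : int1 k -> 1 <= x -> prim k x = I k.
Proof.
move=> hk x1; apply: I_ae; [exact: int1_measurable (int1_step x hk)|exact: int1_measurable|].
by apply: ae_mu01 => t /andP[_ t1]; rewrite (ltW (lt_le_trans t1 x1)) mulr1.
Qed.

Lemma int1_one : int1 (fun _ : R => 1 : R).
Proof. exact: int1_cst. Qed.

Lemma prim_one_lip x y : y <= x -> prim (fun _ => 1) x - prim (fun _ => 1) y <= x - y.
Proof.
move=> yx; rewrite /prim -IB; [|exact: int1_step int1_one|exact: int1_step int1_one].
have -> : (fun t : R => 1 * (t <= x)%R%:R - 1 * (t <= y)%R%:R) = \1_(`]y, x]%classic) :> (R -> R).
  apply/funext => t; rewrite indicE mem_setE in_itv/= !mul1r.
  have [ty|ty] := leP t y; last by rewrite subr0.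
  by rewrite (le_trans ty yx) subrr.
rewrite /Rintegral integral_indic// setIT.
have h : (mu `]y, x] <= (x - y)%:E)%E.
  have -> : ((x - y)%:E = leb `]y, x])%E.
    rewrite lebesgue_measure_itv/= lte_fin; case: ltP => // xy.
    by rewrite (_ : x = y) ?subrr//; apply/le_anti; rewrite xy.
  apply: le_measure; rewrite ?inE//; exact: measurableI.
by rewrite -lee_fin fineK// fin_num_measure.
Qed.

Lemma prim_lip g (M : R) x y : int1 g -> {ae mu, forall t, `|g t| <= M} -> y <= x ->
  `|prim g x - prim g y| <= M * (x - y).
Proof.
move=> hg gM yx; rewrite /prim -IB; [|exact: int1_step|exact: int1_step].
have h1 := int1_step x hg; have h2 := int1_step y hg.
have o1 := int1_step x int1_one; have o2 := int1_step y int1_one.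
have M0 : 0 <= M.
  rewrite -(I_cst M); apply: le_trans (I_ge0 (f := fun t => `|g t|) _) (I_le _ _ gM) => //.
  - exact: int1_norm.
  - exact: int1_cst.
apply: le_trans (I_norm (int1B h1 h2)) _.
apply: (@le_trans _ _ (I (fun t => M * (1 * (t <= x)%R%:R - 1 * (t <= y)%R%:R)))).
  apply: I_le; [exact/int1_norm/int1B|exact/int1Z/int1B|].
  apply: (@filterS _ _ (ae_filter_ringOfSetsType mu) _ _ _ gM) => t gt.
  rewrite -mulrBr !mul1r normrM; apply: ler_pM => //.
  have [ty|ty] := leP t y; last by rewrite subr0 normr_nat.
  by rewrite (le_trans ty yx) subrr normr0.
rewrite IZ ?IB//; last exact: int1B.
by apply: ler_wpM2l => //; exact: prim_one_lip.
Qed.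

(** The primitive of a continuous function is Lipschitz, and primitives depend
    uniformly on the function in L^1. *)
Lemma prim_continuous k : int1 k -> continuous (prim k).
Proof.
move=> hk x; apply/cvgrPdist_lt => e e0.
have [|g [cg kg]] := L1_dense hk (e := e / 3); first by rewrite divr_gt0.
have hg := int1_cont cg; have [M hM] := cont_bounded cg.
have gM : {ae mu, forall t, `|g t| <= M}.
  by apply: ae_mu01 => t /andP[t0 t1]; apply: hM; rewrite !ltW.
have M0 : 0 <= M by apply: le_trans (hM 0 _); rewrite ?lexx ?ler01.
have lip y z : `|prim g y - prim g z| <= M * `|y - z|.
  wlog zy : y z / z <= y => [h|].
    have [/h//|/ltW /h] := leP z y; by rewrite distrC (distrC y).
  by rewrite (@ger0_norm _ (y - z)) ?subr_ge0//; exact: prim_lip.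
have d y : `|prim k y - prim g y| < e / 3.
  rewrite -primB//; apply: le_lt_trans kg; apply: prim_norm; exact: int1B.
near=> y.
have h1 := d x; have h2 := d y; have h3 := lip x y.
have : M * `|x - y| < e / 3.
  have : `|x - y| < e / 3 / (M + 1).
    near: y; apply: (@cvgr_dist_lt _ _ _ (nbhs x) _ id) => //.
    by rewrite !divr_gt0//; lra.
  rewrite ltr_pdivlMr; last by lra.
  by have := normr_ge0 (x - y); nra.
have := ler_distD (prim g x) (prim k x) (prim k y).
have := ler_distD (prim g y) (prim g x) (prim k y).
rewrite (distrC (prim g y)); lra.
Unshelve. all: by end_near. Qed.

Lemma primE k x : measurable_fun setT k ->
  prim k x = \int[leb]_(t in `]-oo, x]) (k \_ `]0%R, 1%R[) t.
Proof.
move=> mk; rewrite /prim Rint_mu01; last first.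
  by apply: measurable_funM => //; exact: step_measurable.
rewrite Rintegral_mkcond [RHS]Rintegral_mkcond; apply: eq_Rintegral => t _.
rewrite !patchE !mem_setE !in_itv/=.
by case: (t <= x)%R; case: ifP; rewrite ?mulr1 ?mulr0.
Qed.

Let patch_integrable k : int1 k -> leb.-integrable setT (EFin \o (k \_ `]0%R, 1%R[)).
Proof.
move=> hk; have := (int1_leb (int1_measurable hk)).1 hk.
move/integrable_mkcond => /(_ (measurable_itv _)).
by rewrite restrict_EFin.
Qed.

(** Where the function extended by 0 outside the unit interval is continuous: at
    interior points and, for functions that vanish near 0 and 1, everywhere. *)
Lemma prim_derive_patch g (x : R) : continuous g ->
  {for x, continuous (g \_ `]0%R, 1%R[)} -> is_derive x 1 (prim g) ((g \_ `]0%R, 1%R[) x).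
Proof.
move=> cg cf; have hg := int1_cont cg; have mg := cont_measurable cg.
pose f := g \_ `]0%R, 1%R[.
have -> : prim g = fun y => \int[leb]_(t in [set` Interval -oo%O (BRight y)]) f t.
  by apply/funext => y; exact: primE.
have [] := @continuous_FTC1 R f -oo%O x (x + 1) _ _ _ cf.
- by rewrite ltrDl.
- apply: integrableS (patch_integrable hg) => //.
- by rewrite ltNyr.
rewrite derive1E => d1 d2.
by apply: DeriveDef => //; rewrite d2.
Qed.

Lemma prim_derive g (x : R) : continuous g -> 0 < x < 1 -> is_derive x 1 (prim g) (g x).
Proof.
move=> cg x01; pose f := g \_ `]0%R, 1%R[.
have fx : f x = g x by rewrite /f patchE mem_setE in_itv/= x01.
rewrite -fx; apply: prim_derive_patch => //.
have : g y @[y --> x] --> f x by rewrite fx; exact: cg.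
apply: cvg_trans; apply: near_eq_cvg; near=> y.
rewrite patchE mem_setE in_itv/= ifT//.
near: y; have := @near_in_itvoo R 0 1 x; rewrite in_itv/= x01 => /(_ isT).
by apply: filterS => y; rewrite in_itv.
Unshelve. all: by end_near. Qed.

Lemma cst_on_itv (f : R -> R) x : continuous f ->
  (forall y : R, 0 < y < 1 -> is_derive y 1 f 0) -> 0 <= x <= 1 -> f x = f 0.
Proof.
move=> cf df /andP[x0 x1]; apply/eqP; rewrite -subr_eq0.
have [||c _ ->] := @MVT_segment R f (fun _ => 0) 0 x x0.
- move=> y; rewrite in_itv/= => /andP[y0 yx]; apply: df.
  by rewrite y0 (lt_le_trans yx).
- by apply: continuous_subspaceT => y; exact: cf.
by rewrite mul0r.
Qed.

Lemma prim_out k x : int1 k -> prim k x = prim k (Num.max 0 (Num.min x 1)).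
Proof.
move=> hk; have [x1|x1] := leP x 1.
  have [x0|x0] := leP 0 x; first by [].
  by rewrite !prim_le0 ?lexx// ltW.
by rewrite max_r ?ler01// !prim_ge1 ?lexx// ltW.
Qed.

Let rem k l x := prim (fun t => prim k t * l t + k t * prim l t) x - prim k x * prim l x.

Let int1_bp k l : int1 k -> int1 l -> int1 (fun t => prim k t * l t + k t * prim l t).
Proof.
move=> hk hl; apply: int1D; first exact: int1_contM (prim_continuous hk) hl.
have := int1_contM (prim_continuous hl) hk.
by congr (mu.-integrable _ _); apply/funext => t; rewrite /= mulrC.
Qed.

Let remC k l x : rem k l x = rem l k x.
Proof.
rewrite /rem; apply: (congr2 (fun a b : R => a - b)); last exact: mulrC.
apply: (congr1 (fun h => prim h x)); apply/funext => t; rewrite [LHS]addrC; congr (_ + _); exact: mulrC.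
Qed.

Let rem_cont k l x : continuous k -> continuous l -> 0 <= x <= 1 -> rem k l x = 0.
Proof.
move=> ck cl x01; have hk := int1_cont ck; have hl := int1_cont cl.
have ckl : continuous (fun t => prim k t * l t + k t * prim l t).
  move=> t; apply: cvgD; apply: cvgM => //; [exact: prim_continuous|exact: cl|
    exact: ck|exact: prim_continuous].
transitivity (rem k l 0); last first.
  by rewrite /rem !prim_le0 ?mul0r ?subrr//; exact: int1_bp.
apply: (@cst_on_itv (rem k l)) => //.
  move=> t; apply: cvgB; first exact/prim_continuous/int1_bp.
  by apply: cvgM; exact: prim_continuous.
move=> y y01.
have d1 := prim_derive ckl y01; have d2 := prim_derive ck y01; have d3 := prim_derive cl y01.
apply: is_derive_eq; rewrite /GRing.scale/=; ring.
Qed.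

Let rem_bound k l x : int1 k -> int1 l ->
  `|rem k l x| <= 3 * (I (fun t => `|k t|) * I (fun t => `|l t|)).
Proof.
move=> hk hl; set K := I _; set L := I _.
have bk t : `|prim k t| <= K by exact: prim_norm.
have bl t : `|prim l t| <= L by exact: prim_norm.
have h1 : int1 (fun t => prim k t * l t) := int1_contM (prim_continuous hk) hl.
have h2 : int1 (fun t => prim l t * k t) := int1_contM (prim_continuous hl) hk.
have h2' : int1 (fun t => k t * prim l t).
  by move: h2; congr (mu.-integrable _ _); apply/funext => t; rewrite /= mulrC.
rewrite /rem primD//.
have b1 : `|prim (fun t => prim k t * l t) x| <= K * L.
  apply: le_trans (prim_norm x h1) _.
  rewrite -[leRHS]IZ; last exact: int1_norm.
  apply: I_le; [exact: int1_norm|exact/int1Z/int1_norm|].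
  by apply: ae_mu01 => t _; rewrite normrM ler_wpM2r.
have b2 : `|prim (fun t => k t * prim l t) x| <= K * L.
  apply: le_trans (prim_norm x h2') _.
  rewrite mulrC -[leRHS]IZ; last exact: int1_norm.
  apply: I_le; [exact: int1_norm|exact/int1Z/int1_norm|].
  by apply: ae_mu01 => t _; rewrite normrM mulrC ler_wpM2r.
have b3 : `|prim k x * prim l x| <= K * L by rewrite normrM ler_pM.
apply: le_trans (ler_normB _ _) _; have := ler_normD (prim (fun t => prim k t * l t) x)
  (prim (fun t => k t * prim l t) x); lra.
Qed.

Let remB k k' l x : int1 k -> int1 k' -> int1 l ->
  rem k l x - rem k' l x = rem (fun t => k t - k' t) l x.
Proof.
move=> hk hk' hl; rewrite /rem primB//.
have -> : prim (fun t => prim (fun t => k t - k' t) t * l t + (k t - k' t) * prim l t) x =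
  prim (fun t => (prim k t * l t + k t * prim l t) -
                 (prim k' t * l t + k' t * prim l t)) x.
  congr (prim _ x); apply/funext => t; rewrite primB//; ring.
rewrite primB; [ring|exact: int1_bp|exact: int1_bp].
Qed.

Let rem_dense k l x : int1 k -> int1 l ->
  (forall k', continuous k' -> rem k' l x = 0) -> rem k l x = 0.
Proof.
move=> hk hl h; apply/eqP; rewrite -normr_le0; apply/ler_addgt0Pr => e e0; rewrite add0r.
set L := I (fun t => `|l t|); have L0 : 0 <= L by apply: I_ge0.
have [|k' [ck' kk']] := L1_dense hk (e := e / (3 * (L + 1))).
  by rewrite divr_gt0// mulr_gt0//; lra.
have hk' := int1_cont ck'.
have := @remB k k' l x hk hk' hl; rewrite (h k' ck') subr0 => ->.
apply: le_trans (rem_bound x (int1B hk hk') hl) _; rewrite -/L.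
move: kk'; rewrite ltr_pdivlMr; last by lra.
by have := @I_ge0 _ (fun t => `|k t - k' t|) (fun=> normr_ge0 _); nra.
Qed.

(** The product rule for absolutely continuous functions. It is elementary for
    continuous [k] and [l], and the two sides are continuous in [k] and [l] for
    the L^1 norm. *)
Lemma prim_prod k l x : int1 k -> int1 l -> 0 <= x <= 1 ->
  prim (fun t => prim k t * l t + k t * prim l t) x = prim k x * prim l x.
Proof.
move=> hk hl x01; apply/eqP; rewrite -subr_eq0; apply/eqP; rewrite -/(rem k l x).
apply: rem_dense => // k' ck'; have hk' := int1_cont ck'.
rewrite remC; apply: rem_dense => // l' cl'; exact: rem_cont.
Qed.

Lemma prim_prod_cst (a b : R) k l x : int1 k -> int1 l -> 0 <= x <= 1 ->
  prim (fun t => (a + prim k t) * l t + k t * (b + prim l t)) x =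
  (a + prim k x) * (b + prim l x) - a * b.
Proof.
move=> hk hl x01.
have -> : (fun t => (a + prim k t) * l t + k t * (b + prim l t)) =
  (fun t => (prim k t * l t + k t * prim l t) + (a * l t + b * k t)).
  by apply/funext => t; ring.
rewrite primD; [|exact: int1_bp|by apply: int1D; exact: int1Z].
rewrite prim_prod// primD; [|exact: int1Z|exact: int1Z].
by rewrite !primZ//; ring.
Qed.

Lemma prim_C1 (f f' : R -> R) (x : R) : (forall y : R, is_derive y 1 f (f' y)) ->
  continuous f' -> 0 <= x <= 1 -> prim f' x = f x - f 0.
Proof.
move=> df cf' x01; have hf' := int1_cont cf'.
have cf : continuous f.
  by move=> y; apply: differentiable_continuous; apply/derivable1_diffP; exact: ex_derive.
have := @cst_on_itv (fun y => prim f' y - f y) x _ _ x01.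
rewrite (prim_le0 hf' (lexx 0)) => h; suff : prim f' x - f x = 0 - f 0 by lra.
apply: h; first by move=> y; apply: cvgB; [exact: prim_continuous|exact: cf].
move=> y y01; have d1 := prim_derive cf' y01; have d2 := df y.
by apply: is_derive_eq; rewrite subrr.
Qed.

Lemma prim_id (x : R) : 0 <= x <= 1 -> prim (fun _ => 1) x = x.
Proof.
move=> x01; have := @prim_C1 id (fun _ => 1) x; rewrite subr0; apply => //.
by move=> y; exact: cvg_cst.
Qed.

(** The weight [a + b t] times half the derivative of [f ^ 2], integrated by
    parts. *)
Lemma weighted_energy (a b c : R) k : int1 k ->
  let f t := c + prim k t in
  I (fun t => (a + b * t) * (f t * k t)) =
  2^-1 * ((a + b) * f 1 ^+ 2 - a * f 0 ^+ 2 - b * I (fun t => f t ^+ 2)).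
Proof.
move=> hk f.
have cf : continuous f by move=> t; apply: cvgD; [exact: cvg_cst|exact: prim_continuous].
have cf2 : continuous (fun t => f t ^+ 2).
  by under eq_fun do rewrite expr2; move=> t; apply: cvgM; exact: cf.
have hfk : int1 (fun t => f t * k t) := int1_contM cf hk.
have pfk t : 0 <= t <= 1 -> prim (fun t => f t * k t) t = (f t ^+ 2 - f 0 ^+ 2) / 2.
  move=> t01; have := prim_prod_cst c c hk hk t01; rewrite -/(f t).
  have -> : (fun t => (c + prim k t) * k t + k t * (c + prim k t)) =
     (fun t => 2 * (f t * k t)) by apply/funext => s; rewrite /f; ring.
  rewrite primZ// => E; have -> : f 0 = c by rewrite /f prim_le0// addr0.
  by lra.
have I1 : int1 (fun _ : R => b) := int1_cst b.
have := @prim_prod_cst 0 a _ _ 1 hfk I1; rewrite lexx ler01 => /(_ isT).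
have intA : int1 (fun t => (0 + prim (fun t0 => f t0 * k t0) t) * b).
  by under eq_fun do rewrite add0r mulrC; apply: int1Z; exact/int1_cont/prim_continuous.
have intB : int1 (fun t => (a + b * t) * (f t * k t)).
  apply: int1_contM => // t; apply: cvgD; first exact: cvg_cst.
  by apply: cvgM; [exact: cvg_cst|exact: cvg_id].
have pb t : 0 <= t <= 1 -> prim (fun=> b) t = b * t.
  move=> t01; have := primZ b t int1_one; rewrite prim_id// => <-.
  by congr (prim _ _); apply/funext => s; rewrite mulr1.
have -> : prim (fun t => (0 + prim (fun t0 => f t0 * k t0) t) * b +
    f t * k t * (a + prim (fun=> b) t)) 1 =
  I (fun t => (0 + prim (fun t0 => f t0 * k t0) t) * b) + I (fun t => (a + b * t) * (f t * k t)).
  rewrite -ID// -[RHS](@prim_ge1 _ 1) ?lexx//; last exact: int1D.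
  apply: prim_ae.
  - apply: measurable_funD; first exact: int1_measurable intA.
    apply: measurable_funM; first exact: int1_measurable hfk.
    by apply: cont_measurable => t; apply: cvgD; [exact: cvg_cst|exact: prim_continuous].
  - exact: int1_measurable (int1D intA intB).
  - by apply: ae_mu01 => t /andP[t0 t1]; rewrite pb ?ltW//; ring.
rewrite add0r mul0r subr0 pb ?lexx ?ler01// mulr1 pfk ?lexx ?ler01// => E.
have -> : I (fun t => (a + b * t) * (f t * k t)) =
  (f 1 ^+ 2 - f 0 ^+ 2) / 2 * (a + b) - I (fun t => (0 + prim (fun t0 => f t0 * k t0) t) * b).
  by rewrite -E; ring.
have -> : I (fun t => (0 + prim (fun t0 => f t0 * k t0) t) * b) =
  I (fun t => b / 2 * f t ^+ 2 - b / 2 * f 0 ^+ 2).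
  apply: I_ae.
  - exact: int1_measurable intA.
  - apply: int1_measurable; apply: int1B; [exact/int1Z/int1_cont|exact: int1_cst].
  - by apply: ae_mu01 => t /andP[t0 t1]; rewrite add0r pfk ?ltW//; field.
rewrite IB; [|exact/int1Z/int1_cont|exact: int1_cst].
by rewrite IZ ?I_cst; [field|exact: int1_cont].
Qed.

(** A special case of the differentiation theorem of Lebesgue. *)
Lemma prim_eq0 k : int1 k -> (forall x, 0 <= x <= 1 -> prim k x = 0) ->
  {ae mu, forall x, k x = 0}.
Proof.
move=> hk k0; have mk := int1_measurable hk; have ik := patch_integrable hk.
have p0 x : prim k x = 0.
  rewrite prim_out// k0// le_max lexx/= ge_max ler01 ge_min lexx orbT.
  by [].
have F := @FTC1Ny R (k \_ `]0%R, 1%R[).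
have {}F : {ae leb, forall x, (k \_ `]0%R, 1%R[) x = 0}.
  have {}F := F _ _; apply: (@filterS _ _ (ae_filter_ringOfSetsType leb) _ _ _ (F _ _)).
  - move=> x [_ <-]; rewrite derive1E.
    have -> : (fun y => \int[leb]_(t in `]-oo, y]) (k \_ `]0%R, 1%R[) t) = cst 0.
      by apply/funext => y; rewrite -primE.
    exact: derive_cst.
  - by move=> y; exact: integrableS ik.
  - by apply: integrable_locally => //; exact/int1_leb.
have {}F := ae_leb_mu01 F.
have D := @ae_mu01 R (fun x => 0 < x < 1) (fun x xx => xx).
apply: (@filterS2 _ _ (ae_filter_ringOfSetsType mu) _ _ _ _ F D) => x /= kx x01.
by move: kx; rewrite patchE mem_setE in_itv/= x01.
Qed.

End Primitive.

(** * The space L^2(0,1) *)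

Section L2Space.
Context {R : realType}.
Local Notation mu := (@mu01 R).
Local Notation int1 f := (mu.-integrable setT (EFin \o f)).
Local Notation sq f := (f \in Lfun mu 2%:E).
Local Notation "'I' f" := (\int[mu]_x f x) (at level 10, f at level 8).
Local Notation L2 := (L2 R).
Implicit Types (f g : L2).

Lemma L2_sq f : sq (repr f : R -> R).
Proof. exact: LfunP. Qed.

Lemma L2_int1 f : int1 (repr f).
Proof. exact/sq_int1/L2_sq. Qed.

Lemma L2_measurable f : measurable_fun setT (repr f : R -> R).
Proof. exact: sq_measurable (L2_sq f). Qed.

Lemma L2_ext f g : {ae mu, forall x, repr f x = repr g x} -> f = g.
Proof.
by move=> /L2_eqP/eqP; rewrite !reprK.
Qed.

Definition toL2 (p : R -> R) : L2 :=
  if pselect (sq p) is left h then (\pi_(L2) (Lfun_Sub (lee1n 2) h))%qT else 0.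

Lemma repr_toL2 (p : R -> R) : sq p -> {ae mu, forall x, repr (toL2 p) x = p x}.
Proof.
move=> hp; rewrite /toL2; case: pselect => // h.
apply: (@filterS _ _ (ae_filter_ringOfSetsType mu) _ _ _ (L2_reprP (Lfun_Sub (lee1n 2) h))) => x ->.
by rewrite (Lfun_valP (lee1n 2) h).
Qed.

Lemma repr_L2D f g : {ae mu, forall x, repr (f + g) x = repr f x + repr g x}.
Proof.
have := L2_repr_linear 1 f g; rewrite scale1r => h.
by apply: (@filterS _ _ (ae_filter_ringOfSetsType mu) _ _ _ h) => x ->; rewrite mul1r.
Qed.

Lemma repr_L2B f g : {ae mu, forall x, repr (f - g) x = repr f x - repr g x}.
Proof.
have := L2_repr_linear (-1) g f; rewrite scaleN1r addrC => h.
by apply: (@filterS _ _ (ae_filter_ringOfSetsType mu) _ _ _ h) => x ->; rewrite mulN1r addrC.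
Qed.

Lemma repr_L20 : {ae mu, forall x, repr (0 : L2) x = 0}.
Proof.
have := repr_L2B (0 : L2) 0; rewrite subrr => h.
by apply: (@filterS _ _ (ae_filter_ringOfSetsType mu) _ _ _ h) => x ->; rewrite subrr.
Qed.

Lemma repr_L2Z (a : R) f : {ae mu, forall x, repr (a *: f) x = a * repr f x}.
Proof.
have := L2_repr_linear a f 0; rewrite addr0 => h.
apply: (@filterS2 _ _ (ae_filter_ringOfSetsType mu) _ _ _ _ h repr_L20) => x -> ->.
by rewrite addr0.
Qed.

Lemma L2_norm_sqr f : `|f| ^+ 2 = I (fun x => repr f x ^+ 2).
Proof.
rewrite -[`|f|]/(L2norm f) /L2norm.
have -> : (fine 'N[mu]_2[EFin \o repr f]) ^+ 2 = fine ('N[mu]_2[EFin \o repr f] `^ 2)%E.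
  rewrite fine_poweR powR_mulrn// fine_ge0// Lnorm_ge0//.
rewrite powR_Lnorm//; congr fine; apply: eq_integral => x _.
by rewrite /= powR_mulrn// real_normK// num_real.
Qed.

Lemma L2_CS f g : I (fun x => `|repr f x * repr g x|) <= `|f| * `|g|.
Proof.
have sf := L2_sq f; have sg := L2_sq g.
have h := int1_norm (sqM sf sg).
have [_ hf] := (sqP _).1 sf; have [_ hg] := (sqP _).1 sg.
apply: quadratic_CS => // s t; rewrite !L2_norm_sqr.
rewrite -!IZ//; last exact: int1Z.
rewrite -ID; [|exact: int1Z|exact: int1Z].
apply: I_le; [exact/int1Z/int1Z|apply: int1D; exact: int1Z|].
apply: ae_mu01 => x _; rewrite normrM.
have := sqr_ge0 (s * `|repr f x| - t * `|repr g x|).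
rewrite sqrrB !exprMn !real_normK ?num_real//; lra.
Qed.

Lemma L2_int_le f : I (fun x => `|repr f x|) <= `|f|.
Proof.
have s1 : sq (fun _ : R => 1 : R) by apply: continuous_Lfun => x; exact: cvg_cst.
have h := repr_toL2 s1.
have n1 : `|toL2 (fun _ => 1)| = 1.
  apply/eqP; rewrite -(@eqrXn2 _ 2)// L2_norm_sqr.
  rewrite (@I_ae _ _ (fun _ => 1)).
  - by rewrite I_cst expr1n.
  - by apply: measurable_funX; exact: L2_measurable.
  - exact: measurable_cst.
  - by apply: (@filterS _ _ (ae_filter_ringOfSetsType mu) _ _ _ h) => x ->; rewrite expr1n.
have := L2_CS f (toL2 (fun _ => 1)); rewrite n1 mulr1; apply: le_trans.
apply: I_le; [exact/int1_norm/L2_int1|apply/int1_norm/sqM; exact: L2_sq|].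
by apply: (@filterS _ _ (ae_filter_ringOfSetsType mu) _ _ _ h) => x ->; rewrite mulr1.
Qed.

Lemma toL2_lin (a : R) (p q : R -> R) : sq p -> sq q ->
  toL2 (fun x => a * p x + q x) = a *: toL2 p + toL2 q.
Proof.
move=> hp hq; apply: L2_ext.
have h1 := repr_toL2 (sqD (sqZ a hp) hq).
have h2 : {ae mu, forall x, a * p x + q x = repr (a *: toL2 p + toL2 q) x}.
  have h3 : {ae mu, forall x, a * repr (toL2 p) x + repr (toL2 q) x = a * p x + q x}.
    apply: (@filterS2 _ _ (ae_filter_ringOfSetsType mu) _ _ _ _
      (repr_toL2 hp) (repr_toL2 hq)) => x -> ->.
    by [].
  apply: (@filterS2 _ _ (ae_filter_ringOfSetsType mu) _ _ _ _ h3
    (L2_repr_linear a (toL2 p) (toL2 q))) => x <- <-.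
  by [].
by apply: (@filterS2 _ _ (ae_filter_ringOfSetsType mu) _ _ _ _ h1 h2) => x -> ->.
Qed.

Lemma toL2_norm_sqr (f : R -> R) : sq f -> `|toL2 f| ^+ 2 = I (fun x => f x ^+ 2).
Proof.
move=> sf; rewrite L2_norm_sqr; apply: I_ae.
- exact: int1_measurable (sqM (L2_sq _) (L2_sq _)).
- exact: int1_measurable (sqM sf sf).
by apply: (@filterS _ _ (ae_filter_ringOfSetsType mu) _ _ _ (repr_toL2 sf)) => x ->.
Qed.

Lemma cauchy_subseq {V : normedModType R} (u : nat -> V) :
  (forall e : R, 0 < e -> exists N, forall p q, (N <= p)%N -> (N <= q)%N ->
    `|u p - u q| < e) ->
  exists s : nat -> nat, (forall j k, (j <= k)%N -> (s j <= s k)%N) /\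
    forall k p q, (s k <= p)%N -> (s k <= q)%N -> `|u p - u q| < mesh k.
Proof.
move=> cu; have /choice[s hs] : forall k, exists N, forall p q, (N <= p)%N -> (N <= q)%N ->
    `|u p - u q| < mesh k by move=> k; exact/cu/mesh_gt0.
exists (fun k => \sum_(j < k.+1) s j)%N; split=> [j k jk|k p q].
  by rewrite -(subnKC jk) -addSn big_split_ord /= leq_addr.
rewrite big_ord_recr/= => hp hq; apply: hs.
  exact: leq_trans (leq_addl _ _) hp.
exact: leq_trans (leq_addl _ _) hq.
Qed.

Lemma sum_mesh n : \sum_(0 <= k < n) mesh k <= 2 :> R.
Proof.
suff -> : \sum_(0 <= k < n) mesh k = 2 - 2 * mesh n :> R.
  by have := @mesh_gt0 R n; lra.
elim: n => [|n IH]; first by rewrite big_geq// /mesh expr0; lra.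
by rewrite big_nat_recr//= IH meshS; lra.
Qed.

Section Limit.
Variable v : nat -> L2.
Hypothesis hv : forall k m, (k <= m)%N -> `|v k - v m| <= mesh k.
Local Notation g k := (repr (v k) : R -> R).

Let d k x : R := `|g k.+1 x - g k x|.

Let d_ge0 k x : 0 <= d k x.
Proof. exact: normr_ge0. Qed.

Let int_d k : int1 (d k).
Proof. by apply: int1_norm; apply: int1B; exact: L2_int1. Qed.

Let I_d k : I (d k) <= mesh k.
Proof.
apply: le_trans (hv (leqnSn k)); rewrite distrC; apply: le_trans (L2_int_le _).
apply: I_le; [exact: int_d|exact/int1_norm/L2_int1|].
by apply: (@filterS _ _ (ae_filter_ringOfSetsType mu) _ _ _ (repr_L2B (v k.+1) (v k))) => x ->.
Qed.

Let md k : measurable_fun setT (EFin \o d k).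
Proof. by apply/measurable_EFinP; exact: (int1_measurable (int_d k)). Qed.

Let T x : \bar R := (\sum_(k <oo) (d k x)%:E)%E.

Let T_fin : {ae mu, forall x, T x \is a fin_num}.
Proof.
have hT : mu.-integrable setT T.
  apply/integrableP; split.
    apply: (@ge0_emeasurable_sum _ _ _ _ (fun k x => (d k x)%:E) xpredT) => [k x _ _|k _].
      by rewrite lee_fin d_ge0.
    exact: md.
  have -> : (\int[mu]_x `|T x| = \int[mu]_x T x)%E.
    apply: eq_integral => x _; rewrite gee0_abs// nneseries_ge0//.
    by move=> n _ _; rewrite lee_fin d_ge0.
  rewrite /T integral_nneseries//; last first.
    by move=> n x _; rewrite lee_fin d_ge0.
  apply: (@le_lt_trans _ _ 2%:E); last exact: ltry.
  apply: lime_le.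
    by apply: is_cvg_nneseries => n _ _; apply: integral_ge0 => x _; rewrite lee_fin d_ge0.
  apply: nearW => n; rewrite (le_trans _ (_ : (\sum_(0 <= k < n) mesh k)%:E <= _)%E)//; last first.
    by rewrite lee_fin; exact: sum_mesh.
  rewrite -sumEFin; apply: lee_sum => k _.
  have -> : (\int[mu]_x (d k x)%:E)%E = (I (d k))%:E.
    rewrite /Rintegral fineK//; apply: integrable_fin_num => //; exact: int_d.
  by rewrite lee_fin; exact: I_d.
have := integrable_ae measurableT hT.
by apply: (@filterS _ _ (ae_filter_ringOfSetsType mu)) => x; apply.
Qed.

Let f x : R := fine (limn_esup (fun k => (g k x)%:E)).

Let f_measurable : measurable_fun setT f.
Proof.
apply: (measurableT_comp (fine_measurable measurableT)).
apply: measurable_fun_limn_esup => k; apply/measurable_EFinP; exact: L2_measurable.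
Qed.

Let f_lim : {ae mu, forall x, g k x @[k --> \oo] --> f x}.
Proof.
apply: (@filterS _ _ (ae_filter_ringOfSetsType mu) _ _ _ T_fin) => x Tx.
have c : cvgn (fun k => g k x).
  have -> : (fun k => g k x) = (fun k => series (fun j => g j.+1 x - g j x) k + g 0%N x).
    by apply/funext => k; rewrite /series/= telescope_sumr// subrK.
  apply: is_cvgD; last exact: is_cvg_cst.
  apply: normed_cvg; apply: nondecreasing_is_cvgn.
    by apply: nondecreasing_series => n _ _; exact: normr_ge0.
  exists (fine (T x)) => _ [n _ <-]; rewrite -lee_fin fineK//.
  rewrite /series/= -sumEFin.
  by apply: (@nneseries_lim_ge _ (fun k => (d k x)%:E) xpredT) => k _ _; rewrite lee_fin d_ge0.
have [l hl] := (cvg_ex _).1 c; have -> : f x = l; last exact: hl.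
have : (g k x)%:E @[k --> \oo] --> l%:E by apply: cvg_EFin => //; exact: nearW.
by move=> /cvg_limn_einf_sup[_ h]; rewrite /f h.
Qed.

Let f_dist k : [/\ int1 (fun x => (g k x - f x) ^+ 2) &
  I (fun x => (g k x - f x) ^+ 2) <= mesh k ^+ 2].
Proof.
have mk m : measurable_fun setT (g m) by exact: L2_measurable.
pose F m x : \bar R := ((g k x - g m x) ^+ 2)%:E.
have mF m : measurable_fun setT (F m).
  by apply/measurable_EFinP; apply: measurable_funX; exact: measurable_funB.
have mf : measurable_fun setT (fun x => ((g k x - f x) ^+ 2)%:E).
  by apply/measurable_EFinP; apply: measurable_funX; exact: measurable_funB.
have fat : (\int[mu]_x ((g k x - f x) ^+ 2)%:E <= (mesh k ^+ 2)%:E)%E.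
  have -> : (\int[mu]_x ((g k x - f x) ^+ 2)%:E = \int[mu]_x limn_einf (F ^~ x))%E.
    apply: ae_eq_integral => //.
      rewrite /limn_einf.
      apply: measurableT_comp => //; apply: (@measurable_fun_limn_esup _ _ _ _ (fun m x => - F m x)%E) => m.
      apply: (@measurable_EFinP _ _ _ _ (fun x => - (g k x - g m x) ^+ 2)).2.
      by apply: measurable_funN; apply: measurable_funX; exact: measurable_funB.
    apply: (@filterS _ _ (ae_filter_ringOfSetsType mu) _ _ _ f_lim) => x hx _.
    apply/esym; apply: (cvg_limn_einf_sup _).1.
    apply: cvg_EFin; first exact: nearW.
    by apply: cvgM; apply: cvgB => //; exact: cvg_cst.
  apply: (le_trans (fatou mu measurableT mF _)).
    by move=> n x _; rewrite lee_fin sqr_ge0.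
  rewrite limn_einf_lim; apply: lime_le; first exact: is_cvg_einfs.
  apply: nearW => n; apply: (@le_trans _ _ (\int[mu]_x F (maxn n k) x)%E).
    by apply: ereal_inf_lbound; exists (maxn n k) => //=; rewrite leq_maxl.
  have nk : (k <= maxn n k)%N by rewrite leq_maxr.
  have hB := repr_L2B (v k) (v (maxn n k)).
  have sB : (\int[mu]_x F (maxn n k) x = (`|v k - v (maxn n k)| ^+ 2)%:E)%E.
    have [_ i2] := (sqP _).1 (L2_sq (v k - v (maxn n k))).
    rewrite L2_norm_sqr /Rintegral fineK; last exact: (integrable_fin_num measurableT i2).
    apply: ae_eq_integral => //; [exact: mF|exact: (measurable_int mu i2)|].
    by apply: (@filterS _ _ (ae_filter_ringOfSetsType mu) _ _ _ hB) => x e _; rewrite /F e.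
  by rewrite sB lee_fin lerXn2r ?nnegrE ?(ltW (mesh_gt0 _))// hv.
have i1 : int1 (fun x => (g k x - f x) ^+ 2).
  apply/integrableP; split=> //.
  have -> : (\int[mu]_x `|((g k x - f x) ^+ 2)%:E| = \int[mu]_x ((g k x - f x) ^+ 2)%:E)%E.
    by apply: eq_integral => x _; rewrite gee0_abs// lee_fin sqr_ge0.
  exact: le_lt_trans fat (ltry _).
split=> //; rewrite -lee_fin /Rintegral fineK//; exact: (integrable_fin_num measurableT i1).
Qed.

(** As the norms of the increments are summable, so are almost everywhere the
    increments themselves: the sequence converges almost everywhere, and
    Fatou's lemma bounds the distance to the limit. *)
Lemma L2_cauchy_limit : exists l : L2, forall k, `|v k - l| <= mesh k.
Proof.
have mk k : measurable_fun setT (g k) by exact: L2_measurable.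
have sf : sq f.
  have -> : f = (fun x => g 0%N x + (-1) * (g 0%N x - f x)) by apply/funext => x; ring.
  apply: sqD; first exact: L2_sq.
  apply: sqZ; apply/sqP; split; first exact: measurable_funB.
  by have [] := f_dist 0.
exists (toL2 f) => k; have [i1 h] := f_dist k.
rewrite -(@ler_pXn2r _ 2) ?nnegrE ?(ltW (mesh_gt0 _))//; apply: le_trans h.
rewrite L2_norm_sqr.
suff -> : I (fun x => repr (v k - toL2 f) x ^+ 2) = I (fun x => (g k x - f x) ^+ 2) by [].
apply: I_ae.
- by apply: measurable_funX; exact: L2_measurable.
- exact: int1_measurable i1.
- apply: (@filterS2 _ _ (ae_filter_ringOfSetsType mu) _ _ _ _ (repr_toL2 sf)
    (repr_L2B (v k) (toL2 f))) => x e1 e2.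
  by rewrite e2 e1.
Qed.

End Limit.

Lemma L2_complete : seq_complete [set: L2].
Proof.
move=> u _ cu; have [s [smono hs]] := cauchy_subseq cu.
have [|l hl] := @L2_cauchy_limit (fun k => u (s k)).
  by move=> k m km; apply/ltW/hs; rewrite ?smono.
exists l; split=> // e e0; have [k0 hk] := @mesh_small R (e / 2) (divr_gt0 e0 (ltr0Sn _ 1)).
have mk := hk k0 (leqnn _).
exists (s k0) => n hn; have h1 := hs k0 n (s k0) hn (leqnn _); have h2 := hl k0.
by have := ler_distD (u (s k0)) (u n) l; lra.
Qed.

End L2Space.

(** * Weak derivatives *)

Section DuBoisReymond.
Context {R : realType}.
Local Notation mu := (@mu01 R).
Local Notation int1 f := (mu.-integrable setT (EFin \o f)).
Local Notation "'I' f" := (\int[mu]_x f x) (at level 10, f at level 8).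
Implicit Types (f g h : R -> R).

(** The derivatives of test functions are the functions of zero mean with
    compact support. *)
Lemma prim_test g (a b : R) : continuous g -> 0 < a -> b < 1 ->
  (forall t, g t != 0 -> a <= t <= b) -> I g = 0 ->
  test_function (prim g) /\ derive1 (prim g) = g.
Proof.
move=> cg a0 b1 sg Ig; have hg := int1_cont cg.
have pE : g \_ `]0%R, 1%R[ = g.
  apply/funext => t; rewrite patchE mem_setE in_itv/=; case: ifPn => // t01.
  apply/esym/eqP; apply: contraNT t01 => /sg /andP[ta tb].
  by rewrite (lt_le_trans a0 ta) (le_lt_trans tb b1).
have d (x : R) : is_derive x 1 (prim g) (g x).
  by rewrite -{2}pE; apply: prim_derive_patch => //; rewrite pE; exact: cg.
have dE : derive1 (prim g) = g by apply/funext => x; rewrite derive1E derive_val.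
split=> //; split; [by move=> x; exact: ex_derive|by rewrite dE|].
exists a, b; split=> // x; rewrite in_itv/= negb_and -!ltNge => /orP[xa|bx].
  rewrite -[RHS](I_cst (0 : R)); apply: eq_Rintegral => t _.
  have [tx|] := leP t x; last by rewrite mulr0.
  rewrite mulr1; apply/eqP; apply: contraTT (le_lt_trans tx xa) => /sg /andP[ta _].
  by rewrite -leNgt.
rewrite -[RHS]Ig; apply: eq_Rintegral => t _.
have [tx|xt] := leP t x; first by rewrite mulr1.
rewrite mulr0; apply/esym/eqP; apply: contraTT (lt_trans bx xt) => /sg /andP[_ tb].
by rewrite -leNgt.
Qed.

(** Continuous approximations, as [d] tends to 0, of the indicator function of
    the interval from [a] to [b]. *)
Definition trapezoid (a b d x : R) : R :=
  Num.max 0 (Num.min 1 (Num.min ((x - a) / d) ((b - x) / d))).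

Lemma trapezoid_continuous a b d : continuous (trapezoid a b d).
Proof.
have c1 : continuous (fun x : R => (x - a) / d).
  by move=> x; apply: cvgMl; apply: cvgB; [exact: cvg_id|exact: cvg_cst].
have c2 : continuous (fun x : R => (b - x) / d).
  by move=> x; apply: cvgMl; apply: cvgB; [exact: cvg_cst|exact: cvg_id].
have c (r : R) : continuous (fun _ : R => r) by move=> x; exact: cvg_cst.
exact: (max_fun_continuous (c 0) (min_fun_continuous (c 1) (min_fun_continuous c1 c2))).
Qed.

Lemma trapezoid_supp a b d x : 0 < d -> trapezoid a b d x != 0 -> a < x < b.
Proof.
move=> d0; apply: contraNT; rewrite negb_and -!leNgt => /orP[xa|bx].
  rewrite /trapezoid max_l// ge_min; apply/orP; right; rewrite ge_min; apply/orP; left.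
  by rewrite pmulr_lle0 ?invr_gt0//; lra.
rewrite /trapezoid max_l// ge_min; apply/orP; right; rewrite ge_min; apply/orP; right.
by rewrite pmulr_lle0 ?invr_gt0//; lra.
Qed.

Lemma trapezoid_approx a b d t : 0 < d -> a <= b ->
  `|trapezoid a b d t - ((t <= b)%R%:R - (t <= a)%R%:R)| <=
  ((t <= a + d)%R%:R - (t <= a)%R%:R) + ((t <= b)%R%:R - (t <= b - d)%R%:R).
Proof.
move=> d0 ab.
have T0 : 0 <= trapezoid a b d t by rewrite le_max lexx.
have T1 : trapezoid a b d t <= 1 by rewrite ge_max ler01 ge_min lexx.
have out : ~~ (a < t < b) -> trapezoid a b d t = 0.
  by move=> h; apply/eqP; apply: contraNT h; exact: trapezoid_supp.
have le1 (c : bool) : c%:R <= 1 :> R by case: c.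
have ge0 (c : bool) : 0 <= c%:R :> R by case: c.
have [ta|ta] := leP t a.
  rewrite out; last by rewrite negb_and -!leNgt ta.
  have -> : (t <= b)%R by exact: le_trans ab.
  have -> : (t <= a + d)%R by lra.
  by rewrite !subrr normr0 add0r subr_ge0.
have [tb|tb] := ltP b t.
  rewrite out; last by rewrite negb_and -!leNgt (ltW tb) orbT.
  have -> : (t <= b - d)%R = false by apply/negbTE; rewrite -ltNge; lra.
  by rewrite !subr0 normr0 addr0.
have [tad|tad] := leP t (a + d).
  rewrite ler_norml !subr0; have := le1 (t <= b - d)%R; have := ge0 (t <= b - d)%R.
  by rewrite /=; lra.
have [tbd|tbd] := leP t (b - d).
  have -> : trapezoid a b d t = 1.
    rewrite /trapezoid min_l ?max_r ?ler01//.
    by rewrite le_min !ler_pdivlMr//; apply/andP; split; lra.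
  by rewrite !subr0 subrr normr0.
by rewrite ler_norml !subr0 /=; lra.
Qed.

Lemma cst_closure f : continuous f ->
  (forall a b : R, 0 < a -> a < b -> b < 1 -> f a = f b) ->
  forall x, 0 <= x <= 1 -> f x = f 0.
Proof.
move=> cf h x x01; apply: (cst_on_itv cf) x01 => y y01.
have : \forall z \near y, f y = f z.
  have := @near_in_itvoo R 0 1 y; rewrite in_itv/= y01 => /(_ isT).
  apply: filterS => z; rewrite in_itv/= => /andP[z0 z1]; have /andP[y0 y1] := y01.
  by have [yz|yz|->//] := ltgtP y z; [exact: h|apply/esym/h].
by move=> e; apply: (near_eq_is_derive (f := cst (f y))) => //; exact: is_derive_cst.
Qed.

(** In the limit [d = 0], the primitive of [y] takes the same value at [a] and at
    [b]; hence it is constant. *)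
Lemma cc_orthogonal y : int1 y ->
  (forall a b d, 0 < a -> a < b -> b < 1 -> 0 < d -> I (fun t => y t * trapezoid a b d t) = 0) ->
  {ae mu, forall x, y x = 0}.
Proof.
move=> hy h; apply: prim_eq0 => //.
have c := prim_continuous hy; have ny := int1_norm hy; have cn := prim_continuous ny.
suff eqp a b : 0 < a -> a < b -> b < 1 -> prim y a = prim y b.
  by move=> x x01; rewrite (cst_closure c eqp x01) prim_le0.
move=> a0 ab b1; apply/eqP; rewrite eq_sym -subr_eq0 -normr_le0.
apply/ler_addgt0Pr => e e0; rewrite add0r.
have e2 : 0 < e / 2 by lra.
have /cvgrPdist_lt/(_ _ e2)/nbhs_ballP[d1 d10 h1] := cn a.
have /cvgrPdist_lt/(_ _ e2)/nbhs_ballP[d2 d20 h2] := cn b.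
pose d := Num.min d1 d2 / 2.
have d0 : 0 < d by rewrite divr_gt0// lt_min; apply/andP.
have dd1 : d < d1.
  by rewrite /d; have := ge_min d1 d1 d2; rewrite lexx /=; have : 0 < d1 by []; lra.
have dd2 : d < d2.
  by rewrite /d; have := ge_min d2 d1 d2; rewrite lexx orbT /=; have : 0 < d2 by []; lra.
have {}h1 := h1 (a + d); have {}h2 := h2 (b - d).
rewrite /= /ball/= opprD addrA subrr sub0r normrN gtr0_norm// in h1.
rewrite /= /ball/= opprB addrC subrK gtr0_norm// in h2.
have {}h1 := h1 dd1; have {}h2 := h2 dd2.
have iT : int1 (fun t => y t * trapezoid a b d t).
  have := int1_contM (@trapezoid_continuous a b d) hy.
  by congr (mu.-integrable _ _); apply/funext => t /=; rewrite mulrC.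
have ia x := int1_step x hy; have ina x := int1_step x ny.
rewrite /prim -IB// -[X in `|X|]subr0 -(h a b d)// -IB//; last exact: int1B.
apply: le_trans (I_norm (int1B (int1B (ia b) (ia a)) iT)) _.
apply: (@le_trans _ _ (I (fun t => (`|y t| * (t <= a + d)%R%:R - `|y t| * (t <= a)%R%:R) +
   (`|y t| * (t <= b)%R%:R - `|y t| * (t <= b - d)%R%:R)))).
  apply: I_le.
  - apply: int1_norm; apply: int1B => //; exact: int1B.
  - by apply: int1D; exact: int1B.
  - apply: ae_mu01 => t _; rewrite -!mulrBr -mulrDr normrM distrC ler_wpM2l//.
    exact: trapezoid_approx (ltW ab).
rewrite ID ?IB//; [|exact: int1B|exact: int1B].
rewrite -![I (fun t => _ * _)]/(prim _ _).
by move: h1 h2; rewrite distrC !ltr_norml; lra.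
Qed.

(** Correcting a trapezoid by a multiple of a fixed one makes its mean vanish, so
    that [z] minus a suitable constant is orthogonal to all trapezoids. *)
Lemma du_bois_reymond (z : R -> R) : int1 z ->
  (forall phi, test_function phi -> I (fun x => z x * derive1 phi x) = 0) ->
  exists c, {ae mu, forall x, z x = c}.
Proof.
move=> hz h.
pose p0 := trapezoid (1 / 4) (3 / 4) (1 / 8).
have q0 : 0 < (1 / 8 : R) by lra.
have cp0 : continuous p0 by exact: trapezoid_continuous.
have K0 : 0 < I p0.
  have ab : 1 / 4 <= 3 / 4 :> R by lra.
  have st x : int1 (fun t : R => (t <= x)%R%:R).
    by have := int1_step x int1_one; congr (mu.-integrable _ _); apply/funext => t /=; rewrite mul1r.
  have Ist x : 0 <= x <= 1 -> I (fun t : R => (t <= x)%R%:R) = x.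
    move=> x01; rewrite -[RHS](prim_id x01); apply: eq_Rintegral => t _.
    by rewrite mul1r.
  have : `|I (fun t => p0 t - ((t <= 3 / 4)%R%:R - (t <= 1 / 4)%R%:R))| <=
      I (fun t => ((t <= 1 / 4 + 1 / 8)%R%:R - (t <= 1 / 4)%R%:R) +
                  ((t <= 3 / 4)%R%:R - (t <= 3 / 4 - 1 / 8)%R%:R)).
    apply: le_trans (I_norm _) (I_le _ _ _).
    - by apply: int1B; [exact: int1_cont|exact: int1B].
    - by apply: int1_norm; apply: int1B; [exact: int1_cont|exact: int1B].
    - by apply: int1D; exact: int1B.
    - by apply: ae_mu01 => t _; exact: trapezoid_approx.
  rewrite [leRHS]ID; [|exact: int1B|exact: int1B].
  rewrite IB; [|exact: int1_cont|exact: int1B].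
  rewrite !IB// !Ist; try (by apply/andP; split; lra).
  by rewrite ler_norml; lra.
pose C := I (fun t => z t * p0 t) / I p0.
have Mcont g : continuous g -> int1 (fun t => z t * g t).
  move=> cg; have := int1_contM cg hz.
  by congr (mu.-integrable _ _); apply/funext => t /=; rewrite mulrC.
exists C; suff : {ae mu, forall x, z x - C = 0}.
  apply: (@filterS _ _ (ae_filter_ringOfSetsType mu)) => x /eqP.
  by rewrite subr_eq0 => /eqP.
apply: cc_orthogonal; first by apply: int1B => //; exact: int1_cst.
move=> a b d a0 ab b1 d0; pose T := trapezoid a b d.
have cT : continuous T by exact: trapezoid_continuous.
have iT := int1_cont cT; have ip0 := int1_cont cp0.
pose k := I T / I p0; pose psi t := T t - k * p0 t.
have cpsi : continuous psi.
  move=> t; apply: cvgB; first exact: cT.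
  by apply: cvgM; [exact: cvg_cst|exact: cp0].
have Ipsi : I psi = 0.
  by rewrite /psi IB ?IZ//; [rewrite /k divfK ?subrr// gt_eqF|exact: int1Z].
have [||t|tpsi dpsi] := @prim_test psi (Num.min a (1 / 4)) (Num.max b (3 / 4)) cpsi _ _ _ Ipsi.
- by rewrite lt_min a0/=; lra.
- by rewrite gt_max b1/=; lra.
- rewrite /psi ge_min le_max; have [->|/trapezoid_supp] := eqVneq (T t) 0.
    have [->|/trapezoid_supp] := eqVneq (p0 t) 0; first by rewrite mulr0 subr0 eqxx.
    by move=> /(_ q0)/andP[/ltW -> /ltW ->]; rewrite !orbT.
  by move=> /(_ d0)/andP[/ltW -> /ltW ->].
have := h _ tpsi; rewrite dpsi.
have -> : (fun x => z x * psi x) = (fun x => z x * T x - k * (z x * p0 x)).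
  by apply/funext => x; rewrite /psi; ring.
rewrite IB; [|exact: Mcont|exact/int1Z/Mcont].
rewrite IZ; last exact: Mcont.
have -> : (fun t => (z t - C) * trapezoid a b d t) = (fun t => z t * T t - C * T t).
  by apply/funext => t; rewrite mulrBl.
rewrite IB; [|exact: Mcont|exact: int1Z].
by rewrite IZ// => <-; congr (_ - _); rewrite /C /k; field; rewrite gt_eqF.
Qed.

End DuBoisReymond.

Section H1Space.
Context {R : realType}.
Local Notation mu := (@mu01 R).
Local Notation int1 f := (mu.-integrable setT (EFin \o f)).
Local Notation sq f := (f \in Lfun mu 2%:E).
Local Notation "'I' f" := (\int[mu]_x f x) (at level 10, f at level 8).
Local Notation L2 := (L2 R).
Local Notation H1 := (H1 R).
Implicit Types (w : H1) (g : L2) (c : R).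

Lemma test_functionP phi : test_function phi ->
  [/\ forall x : R, is_derive x 1 phi (derive1 phi x), continuous (derive1 phi),
    phi 0 = 0 & phi 1 = 0].
Proof.
case=> d cd [a [b [a0 b1 h]]]; split=> //.
- by move=> x; rewrite derive1E; exact/derivableP.
- by apply: h; rewrite in_itv/= leNgt a0.
- by apply: h; rewrite in_itv/= negb_and [1 <= b]leNgt b1 orbT.
Qed.

Lemma prim_weak_derivative c g :
  weak_derivative (toL2 (fun x => c + prim (repr g) x)) g.
Proof.
move=> phi tphi; have [dphi cdphi phi0 phi1] := test_functionP tphi.
have hg := L2_int1 g; have cg := prim_continuous hg.
pose u x := c + prim (repr g) x.
have cu : continuous u by move=> x; apply: cvgD; [exact: cvg_cst|exact: cg].
have sqi : sq u by exact: continuous_Lfun.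
have cphi : continuous phi by have [] := test_continuous tphi.
have iphi := int1_cont cdphi.
have E1 : I (fun x => repr (toL2 u) x * derive1 phi x) = I (fun x => u x * derive1 phi x).
  apply: I_ae.
  - by apply: measurable_funM; [exact: L2_measurable|exact: cont_measurable].
  - by apply: measurable_funM; exact: cont_measurable.
  - by apply: (@filterS _ _ (ae_filter_ringOfSetsType mu) _ _ _ (repr_toL2 sqi)) => x ->.
have i1 : int1 (fun x => u x * derive1 phi x) by exact: int1_contM.
have i2 : int1 (fun x => repr g x * phi x).
  have := int1_contM cphi hg.
  by congr (mu.-integrable _ _); apply/funext => t /=; rewrite mulrC.
rewrite E1; apply/eqP; rewrite -subr_eq0 opprK -ID//; apply/eqP.
have := @prim_prod_cst R c 0 (repr g) (derive1 phi) 1 hg iphi.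
rewrite lexx ler01 => /(_ isT).
have pphi t : 0 <= t <= 1 -> prim (derive1 phi) t = phi t.
  by move=> t01; rewrite (prim_C1 dphi cdphi t01) phi0 subr0.
rewrite pphi ?lexx ?ler01// phi1 !addr0 !mulr0 subr0 => <-.
rewrite -[LHS](@prim_ge1 _ _ 1) ?lexx//; last exact: int1D.
apply: prim_ae.
- apply: int1_measurable; exact: int1D.
- apply: int1_measurable; apply: int1D => //.
  have := int1_contM (prim_continuous iphi) hg.
  by congr (mu.-integrable _ _); apply/funext => t /=; rewrite add0r mulrC.
- by apply: ae_mu01 => t /andP[t0 t1]; rewrite add0r pphi ?ltW.
Qed.

Lemma H1_weak w : weak_derivative (H1fun w) (wderiv w).
Proof. by case: w => -[u v] h; apply/(asboolP (weak_derivative u v)). Qed.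

(** The difference of an element of H^1 and of the primitive of its weak
    derivative has a zero weak derivative. *)
Lemma H1_primitive w :
  exists c, {ae mu, forall x, repr (H1fun w) x = c + prim (repr (wderiv w)) x}.
Proof.
set g := wderiv w; have hg := L2_int1 g; have cg := prim_continuous hg.
have hu := L2_int1 (H1fun w); have ip := int1_cont cg.
have [|c hc] := @du_bois_reymond R (fun x => repr (H1fun w) x - prim (repr g) x) (int1B hu ip).
  move=> phi tphi; have [dphi cdphi phi0 phi1] := test_functionP tphi.
  have h1 := @H1_weak w phi tphi.
  have h2 := @prim_weak_derivative 0 g phi tphi.
  have s0 : sq (fun x => 0 + prim (repr g) x).
    by apply: continuous_Lfun => x; apply: cvgD; [exact: cvg_cst|exact: cg].
  have E2 : I (fun x => repr (toL2 (fun x => 0 + prim (repr g) x)) x * derive1 phi x) =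
      I (fun x => prim (repr g) x * derive1 phi x).
    apply: I_ae.
    - by apply: measurable_funM; [exact: L2_measurable|exact: cont_measurable].
    - by apply: measurable_funM; exact: cont_measurable.
    - apply: (@filterS _ _ (ae_filter_ringOfSetsType mu) _ _ _ (repr_toL2 s0)) => x ->.
      by rewrite add0r.
  have -> : (fun x => (repr (H1fun w) x - prim (repr g) x) * derive1 phi x) =
    (fun x => repr (H1fun w) x * derive1 phi x - prim (repr g) x * derive1 phi x).
    by apply/funext => x; rewrite mulrBl.
  rewrite IB; [|exact: L2_integrable|].
    by rewrite -E2 h1 h2 subrr.
  by apply: int1_contM => //; exact: int1_cont.
exists c; apply: (@filterS _ _ (ae_filter_ringOfSetsType mu) _ _ _ hc) => x <-.
by rewrite subrK.
Qed.

End H1Space.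

(** * Traces *)

Section Traces.
Context {R : realType}.
Local Notation mu := (@mu01 R).
Local Notation leb := (@lebesgue_measure R).
Local Notation int1 f := (mu.-integrable setT (EFin \o f)).
Local Notation sq f := (f \in Lfun mu 2%:E).
Local Notation "'I' f" := (\int[mu]_x f x) (at level 10, f at level 8).
Local Notation L2 := (L2 R).
Local Notation H1 := (H1 R).
Implicit Types (w : H1) (g : L2) (c : R).

Lemma cont_ae_eq (f h : R -> R) :
  {within `[0, 1], continuous f} -> {within `[0, 1], continuous h} ->
  {ae mu, forall x, f x = h x} -> forall x, 0 <= x <= 1 -> f x = h x.
Proof.
move=> cf ch [N [mN N0 hN]] x x01; apply/eqP; rewrite -subr_eq0; apply/negPn/negP => n0.
have x01' : `[0, 1]%classic x by rewrite /= in_itv.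
have c : (f y - h y) @[y --> within `[0, 1] (nbhs x)] --> f x - h x.
  apply: cvgB; first by move/subspace_continuousP : cf; apply.
  by move/subspace_continuousP : ch; apply.
have := cvgr_neq0 _ c n0; rewrite near_withinE => /(_ (within_filter _ _))/nbhs_ballP.
move=> [e /= e0 he].
pose a := Num.max 0 (x - e); pose b := Num.min 1 (x + e).
have /andP[x0 x1] := x01.
have ab : a < b by rewrite /a /b gt_max !lt_min; apply/andP; split; apply/andP; split; lra.
have JN : `]a, b[ `<=` N.
  move=> y; rewrite /= in_itv/= gt_max lt_min => /andP[/andP[y0 yx] /andP[y1 xy]].
  apply: hN => /= E.
  have : f y - h y != 0.
    apply: he; last by rewrite /= in_itv/= !ltW.
    by rewrite /ball/= ltr_norml; apply/andP; split; lra.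
  by rewrite E subrr eqxx.
have J0 : mu `]a, b[ = 0%E.
  apply/eqP; rewrite eq_le measure_ge0 andbT -N0; apply: le_measure; rewrite ?inE//.
have : mu `]a, b[ = (b - a)%:E.
  rewrite -[LHS]/(leb (`]a, b[ `&` `]0, 1[)) setIidl.
    by rewrite lebesgue_measure_itv/= lte_fin ab.
  move=> y; rewrite /= !in_itv/= gt_max lt_min => /andP[/andP[-> _] /andP[-> _]].
  by [].
by rewrite J0 => -[]; lra.
Qed.

Lemma crep_spec w : {within `[0, 1], continuous (crep w)} /\
  {ae mu, forall x, repr (H1fun w) x = crep w x}.
Proof.
have [c hc] := H1_primitive w.
apply: (@getPex _ [set f : R -> R | {within `[0, 1], continuous f} /\
                        {ae mu, forall x, repr (H1fun w) x = f x}]).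
exists (fun x => c + prim (repr (wderiv w)) x); split=> //.
apply: continuous_subspaceT => x; apply: cvgD; first exact: cvg_cst.
exact/prim_continuous/L2_int1.
Qed.

Lemma crep_uniq w (f : R -> R) : continuous f ->
  {ae mu, forall x, repr (H1fun w) x = f x} -> forall x, 0 <= x <= 1 -> crep w x = f x.
Proof.
move=> cf hf; have [cc hc] := crep_spec w; apply: cont_ae_eq => //.
  exact: continuous_subspaceT.
by apply: (@filterS2 _ _ (ae_filter_ringOfSetsType mu) _ _ _ _ hc hf) => x <- <-.
Qed.

(** The fundamental theorem of calculus in H^1(0,1), from which all properties
    of boundary values are deduced. *)
Lemma crepE w x : 0 <= x <= 1 -> crep w x = crep w 0 + prim (repr (wderiv w)) x.
Proof.
have [c hc] := H1_primitive w; have hg := L2_int1 (wderiv w).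
have cp : continuous (fun x => c + prim (repr (wderiv w)) x).
  by move=> y; apply: cvgD; [exact: cvg_cst|exact: prim_continuous].
move=> x01; rewrite !(crep_uniq cp hc)// ?lexx ?ler01//.
by rewrite (prim_le0 hg (lexx 0)) addr0.
Qed.

Lemma H1_repr w : {ae mu, forall x, repr (H1fun w) x = crep w 0 + prim (repr (wderiv w)) x}.
Proof.
have [_ hc] := crep_spec w.
have D := @ae_mu01 R (fun x => 0 < x < 1) (fun x xx => xx).
apply: (@filterS2 _ _ (ae_filter_ringOfSetsType mu) _ _ _ _ hc D) => x -> /andP[x0 x1].
by apply: crepE; rewrite !ltW.
Qed.

Lemma H1_ext w w' : wderiv w = wderiv w' -> crep w 0 = crep w' 0 -> w = w'.
Proof.
move=> e e0; apply: val_inj => /=.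
rewrite [LHS]surjective_pairing [RHS]surjective_pairing -/(H1fun w) -/(H1fun w').
congr (_, _); last exact: e.
apply: L2_ext; have h := H1_repr w; have h' := H1_repr w'; rewrite e e0 in h.
by apply: (@filterS2 _ _ (ae_filter_ringOfSetsType mu) _ _ _ _ h h') => x -> ->.
Qed.

(** Weak derivatives are unique. *)
Lemma H1fun_inj : injective (@H1fun R).
Proof.
move=> w w' e; have ce : crep w = crep w' by rewrite /crep e.
apply: H1_ext; last by rewrite ce.
have hg := L2_int1 (wderiv w); have hg' := L2_int1 (wderiv w').
apply: L2_ext; have : {ae mu, forall x, repr (wderiv w) x - repr (wderiv w') x = 0}.
  apply: prim_eq0; first exact: int1B.
  move=> x x01; rewrite primB//.
  by have := crepE w x01; have := crepE w' x01; rewrite ce; lra.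
by apply: (@filterS _ _ (ae_filter_ringOfSetsType mu)) => x /eqP; rewrite subr_eq0 => /eqP.
Qed.

Lemma H1fun_lin (a : R) w w' : H1fun (a *: w + w') = a *: H1fun w + H1fun w'.
Proof. by []. Qed.

Lemma wderiv_lin (a : R) w w' : wderiv (a *: w + w') = a *: wderiv w + wderiv w'.
Proof. by []. Qed.

Lemma toH1K w : toH1 (H1fun w) = w.
Proof.
apply: H1fun_inj.
exact: (@getPex _ [set w' | H1fun w' = H1fun w] (ex_intro _ w erefl)).
Qed.

Lemma isH1P (f : L2) : isH1 f -> H1fun (toH1 f) = f.
Proof. by move=> [w <-]; rewrite toH1K. Qed.

Lemma toH1_lin (a : R) (f g : L2) : isH1 f -> isH1 g ->
  toH1 (a *: f + g) = a *: toH1 f + toH1 g /\ isH1 (a *: f + g).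
Proof.
by move=> [w <-] [w' <-]; rewrite -H1fun_lin !toH1K; split=> //; eexists.
Qed.

Lemma crep_lin (a : R) w w' x : 0 <= x <= 1 ->
  crep (a *: w + w') x = a * crep w x + crep w' x.
Proof.
move=> x01; pose f v y := crep v 0 + prim (repr (@wderiv R v)) y.
have cf v : continuous (f v).
  by move=> y; apply: cvgD; [exact: cvg_cst|exact/prim_continuous/L2_int1].
rewrite (crepE w x01) (crepE w' x01) -/(f w x) -/(f w' x).
apply: (@crep_uniq _ (fun x => a * f w x + f w' x)) => //.
  move=> y; apply: cvgD; last exact: cf.
  by apply: cvgM; [exact: cvg_cst|exact: cf].
have h := L2_repr_linear a (H1fun w) (H1fun w').
have h2 := H1_repr w; have h3 := H1_repr w'.
have h23 : {ae mu, forall x, a * repr (H1fun w) x + repr (H1fun w') x = a * f w x + f w' x}.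
  by apply: (@filterS2 _ _ (ae_filter_ringOfSetsType mu) _ _ _ _ h2 h3) => y -> ->.
by apply: (@filterS2 _ _ (ae_filter_ringOfSetsType mu) _ _ _ _ h h23) => y ->.
Qed.

Lemma crep0 x : 0 <= x <= 1 -> crep (0 : H1) x = 0.
Proof. by move=> x01; have := crep_lin (-1) 0 0 x01; rewrite scaler0 addr0; lra. Qed.

Lemma crepB w w' x : 0 <= x <= 1 -> crep (w - w') x = crep w x - crep w' x.
Proof. by move=> x01; rewrite addrC -scaleN1r crep_lin// mulN1r addrC. Qed.

Lemma H1_exists c g : exists w, [/\ wderiv w = g,
  H1fun w = toL2 (fun x => c + prim (repr g) x) &
  forall x, 0 <= x <= 1 -> crep w x = c + prim (repr g) x].
Proof.
have hw : (toL2 (fun x => c + prim (repr g) x), g) \in @H1graph R.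
  by apply/asboolP; exact: prim_weak_derivative.
exists (MkH1 hw); split=> //; apply: crep_uniq.
  by move=> y; apply: cvgD; [exact: cvg_cst|exact/prim_continuous/L2_int1].
apply: repr_toL2; apply: continuous_Lfun => y; apply: cvgD; first exact: cvg_cst.
exact/prim_continuous/L2_int1.
Qed.

Lemma H1_norm_sqr w : `|w| ^+ 2 = `|H1fun w| ^+ 2 + `|wderiv w| ^+ 2.
Proof. by rewrite -[`|w|]/(H1norm w) sqr_sqrtr// addr_ge0// sqr_ge0. Qed.

Lemma H1fun_le w : `|H1fun w| <= `|w|.
Proof.
rewrite -(@ler_pXn2r _ 2) ?nnegrE// H1_norm_sqr lerDl sqr_ge0.
by [].
Qed.

Lemma wderiv_le w : `|wderiv w| <= `|w|.
Proof.
rewrite -(@ler_pXn2r _ 2) ?nnegrE// H1_norm_sqr lerDr sqr_ge0.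
by [].
Qed.

(** Average over [y] of the bound of [crep w x] by [crep w y] and the integral of
    the derivative. *)
Lemma sobolev w x : 0 <= x <= 1 -> `|crep w x| <= 2 * `|w|.
Proof.
move=> x01; set g := wderiv w; have hg := L2_int1 g.
have h y : 0 <= y <= 1 -> `|crep w x| <= `|crep w y| + I (fun t => `|repr g t|).
  move=> y01; have : `|crep w x - crep w y| <= I (fun t => `|repr g t|).
    rewrite (crepE w x01) (crepE w y01) opprD addrACA subrr add0r.
    wlog yx : x y x01 y01 / y <= x => [h|].
      by have [/h->//|/ltW yx] := leP y x; rewrite distrC h.
    rewrite /prim -IB; [|exact: int1_step|exact: int1_step].
    apply: le_trans (I_norm (int1B (int1_step x hg) (int1_step y hg))) _.
    apply: I_le; [apply: int1_norm; apply: int1B; exact: int1_step|exact: int1_norm|].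
    apply: ae_mu01 => t _; rewrite -mulrBr normrM -[leRHS]mulr1 ler_wpM2l//.
    have [ty|ty] := leP t y; first by rewrite (le_trans ty yx) subrr normr0.
    by rewrite subr0; case: (t <= x)%R; rewrite ?normr1 ?normr0.
  by have := ler_distD (crep w y) (crep w x) 0; rewrite !subr0; lra.
have hu := H1_repr w.
have hu' : {ae mu, forall y, `|crep w x| <= `|repr (H1fun w) y| + I (fun t => `|repr g t|)}.
  have D := @ae_mu01 R (fun x => 0 < x < 1) (fun x xx => xx).
  apply: (@filterS2 _ _ (ae_filter_ringOfSetsType mu) _ _ _ _ hu D) => y -> /andP[y0 y1].
  by rewrite -crepE ?h// !ltW.
have iu := int1_norm (L2_int1 (H1fun w)).
have := I_le (int1_cst `|crep w x|) (int1D iu (int1_cst (I (fun t => `|repr g t|)))) hu'.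
rewrite ID ?I_cst//; last exact: int1_cst.
have := L2_int_le (H1fun w); have := L2_int_le g; have := H1fun_le w; have := wderiv_le w.
by rewrite -/g; lra.
Qed.

Lemma seq_complete_limit {V : normedModType R} (W : set V) (u : nat -> V) :
  seq_complete W -> (forall n, W (u n)) ->
  (forall e : R, 0 < e -> exists N, forall p q, (N <= p)%N -> (N <= q)%N -> `|u p - u q| < e) ->
  exists l, W l /\ u n @[n --> \oo] --> l.
Proof.
move=> cW Wu cu; have [l [Wl hl]] := cW u Wu cu; exists l; split=> //.
apply/cvgrPdist_lt => e e0; have [N hN] := hl e e0.
by exists N => // n /hN; rewrite distrC.
Qed.

Lemma weak_derivative_closed (u g : nat -> L2) (u' g' : L2) :
  (forall n, weak_derivative (u n) (g n)) ->
  u n @[n --> \oo] --> u' -> g n @[n --> \oo] --> g' -> weak_derivative u' g'.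
Proof.
move=> h hu hg phi tphi.
have [cphi cdphi] := test_continuous tphi.
have lim (v : nat -> L2) (v' : L2) (f : R -> R) : continuous f -> v n @[n --> \oo] --> v' ->
    I (fun x => repr (v n) x * f x) @[n --> \oo] --> I (fun x => repr v' x * f x).
  move=> cf hv; have sf := continuous_Lfun cf; pose F := toL2 f.
  apply/cvgrPdist_le => e e0.
  have d0 : 0 < e / (`|F| + 1) by rewrite divr_gt0// ltr_pwDr.
  move/cvgrPdist_le: hv => /(_ _ d0); apply: filterS => n hn.
  have iv := L2_integrable (v' - v n) cf.
  have <- : I (fun x => repr (v' - v n) x * f x) =
      I (fun x => repr v' x * f x) - I (fun x => repr (v n) x * f x).
    have -> : v' - v n = -1 *: v n + v' by rewrite scaleN1r addrC.
    by rewrite L2_int_linear// mulN1r addrC.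
  apply: le_trans (I_norm iv) _.
  have -> : I (fun x => `|repr (v' - v n) x * f x|) =
      I (fun x => `|repr (v' - v n) x * repr F x|).
    apply: I_ae.
    - exact: int1_measurable (int1_norm iv).
    - apply: int1_measurable; apply: int1_norm; apply: sqM; exact: L2_sq.
    - by apply: (@filterS _ _ (ae_filter_ringOfSetsType mu) _ _ _ (repr_toL2 sf)) => x ->.
  apply: le_trans (L2_CS _ _) _; move: hn; rewrite ler_pdivlMr ?ltr_pwDr//.
  by have := normr_ge0 (v' - v n); have := normr_ge0 F; nra.
have l1 := lim u u' _ cdphi hu; have l2 := lim g g' _ cphi hg.
have l3 : - I (fun x => repr (g n) x * phi x) @[n --> \oo] --> - I (fun x => repr g' x * phi x).
  exact: cvgN.
have E : (fun n => I (fun x => repr (u n) x * derive1 phi x)) =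
  (fun n => - I (fun x => repr (g n) x * phi x)) by apply/funext => n; exact: h.
by rewrite E in l1; exact: (cvg_unique _ l1 l3).
Qed.

Lemma H1_complete : seq_complete [set: H1].
Proof.
move=> u _ cu.
have cf (F : H1 -> L2) : (forall v w, F (v - w) = F v - F w) -> (forall w, `|F w| <= `|w|) ->
    exists l : L2, F (u n) @[n --> \oo] --> l.
  move=> FB Fle; have [|//|l [_ hl]] := @seq_complete_limit _ [set: L2] (fun n => F (u n)) (@L2_complete R).
    by [].
    by move=> e e0; have [N hN] := cu e e0; exists N => p q Np Nq;
      rewrite -FB (le_lt_trans (Fle _))// hN.
  by exists l.
have [a ha] := cf (@H1fun R) (fun v w => erefl) H1fun_le.
have [b hb] := cf (@wderiv R) (fun v w => erefl) wderiv_le.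
have hw : (a, b) \in @H1graph R.
  by apply/asboolP; exact: (weak_derivative_closed (fun n => H1_weak (u n)) ha hb).
exists (MkH1 hw); split=> // e e0.
have e2 : 0 < e / 2 by lra.
have [N1 _ h1] := (cvgrPdist_lt _ _).1 ha _ e2.
have [N2 _ h2] := (cvgrPdist_lt _ _).1 hb _ e2.
exists (maxn N1 N2) => n; rewrite geq_max => /andP[n1 n2].
have {}h1 := h1 n n1; have {}h2 := h2 n n2.
rewrite -(@ltr_pXn2r _ 2) ?nnegrE ?(ltW e0)// H1_norm_sqr.
rewrite -[H1fun _]/(H1fun (u n) - a) -[wderiv _]/(wderiv (u n) - b).
rewrite (distrC _ a) (distrC _ b).
have := normr_ge0 (a - H1fun (u n)); have := normr_ge0 (b - wderiv (u n)); nra.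
Qed.

Lemma H1_C1 (f f' : R -> R) : (forall y : R, is_derive y 1 f (f' y)) -> continuous f' ->
  exists w, [/\ H1fun w = toL2 f, wderiv w = toL2 f' &
    forall x, 0 <= x <= 1 -> crep w x = f x].
Proof.
move=> df cf'; have sf' := continuous_Lfun cf'.
have cf : continuous f.
  by move=> y; apply: differentiable_continuous; apply/derivable1_diffP; exact: ex_derive.
have [w [w1 w2 w3]] := H1_exists (f 0) (toL2 f').
have pE x : 0 <= x <= 1 -> f 0 + prim (repr (toL2 f')) x = f x.
  move=> x01; rewrite (@prim_ae _ _ f').
  - by rewrite (prim_C1 df cf' x01) addrC subrK.
  - exact: L2_measurable.
  - exact: cont_measurable.
  - exact: repr_toL2.
exists w; split=> // [|x x01]; last by rewrite w3// pE.
rewrite w2; apply: L2_ext; have sf := continuous_Lfun cf.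
have cp : continuous (fun x => f 0 + prim (repr (toL2 f')) x).
  by move=> y; apply: cvgD; [exact: cvg_cst|exact/prim_continuous/L2_int1].
have h1 := repr_toL2 sf; have h2 := repr_toL2 (continuous_Lfun cp).
have D := @ae_mu01 R (fun x => 0 < x < 1) (fun x xx => xx).
have h3 : {ae mu, forall x, repr (toL2 f) x = f 0 + prim (repr (toL2 f')) x}.
  apply: (@filterS2 _ _ (ae_filter_ringOfSetsType mu) _ _ _ _ h1 D) => x -> /andP[x0 x1].
  by rewrite pE// !ltW.
by apply: (@filterS2 _ _ (ae_filter_ringOfSetsType mu) _ _ _ _ h2 h3) => x -> ->.
Qed.

Lemma is_derive_expRM (k x : R) : is_derive x 1 (fun y => expR (k * y)) (k * expR (k * x)).
Proof.
by apply: is_derive_eq; rewrite /GRing.scale/=; ring.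
Qed.

(** Variation of constants, with the integrating factor [expR (r^-1 * x)]. *)
Lemma H1_ode (r : R) g : r != 0 -> exists w, H1fun w + r *: wderiv w = g.
Proof.
move=> r0; have hg := L2_int1 g; have sg := L2_sq g.
pose E (x : R) : R := expR (- r^-1 * x).
pose E' (x : R) : R := - r^-1 * E x.
pose k (x : R) : R := expR (r^-1 * x) * (r^-1 * repr g x).
have dE (x : R) : is_derive x 1 E (E' x) by exact: is_derive_expRM.
have dE2 (x : R) := is_derive_expRM r^-1 x.
have cE : continuous E.
  by move=> y; apply: differentiable_continuous; apply/derivable1_diffP; exact: ex_derive.
have cE2 : continuous (fun x => expR (r^-1 * x)).
  by move=> y; apply: differentiable_continuous; apply/derivable1_diffP; exact: ex_derive.
have cE' : continuous E' by move=> y; apply: cvgM; [exact: cvg_cst|exact: cE].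
have hk : int1 k by apply: int1_contM => //; exact: int1Z.
have ck := prim_continuous hk.
have hE' := int1_cont cE'.
pose f (x : R) : R := E x * prim k x.
pose f' (x : R) : R := r^-1 * (repr g x - f x).
have cf : continuous f by move=> y; apply: cvgM; [exact: cE|exact: ck].
have sf := continuous_Lfun cf.
have sf' : sq f'.
  apply: sqZ; have -> : (fun x => repr g x - f x) = (fun x => repr g x + (-1) * f x).
    by apply/funext => x; ring.
  by apply: sqD => //; exact: sqZ.
have pf' x : 0 <= x <= 1 -> prim f' x = f x.
  move=> x01; have := @prim_prod_cst R 1 0 E' k x hE' hk x01.
  have E0 : E 0 = 1 by rewrite /E mulr0 expR0.
  have EE y : 0 <= y <= 1 -> 1 + prim E' y = E y.
    by move=> y01; rewrite (prim_C1 dE cE' y01) E0 addrC subrK.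
  rewrite EE// mulr0 subr0 add0r -/(f x) => <-.
  have i1 : int1 (fun t => (1 + prim E' t) * k t + E' t * (0 + prim k t)).
    apply: int1D.
      apply: int1_contM => // y; apply: cvgD; first exact: cvg_cst.
      exact: prim_continuous.
    apply: int1_contM => //; apply: int1_cont => y; apply: cvgD; first exact: cvg_cst.
    exact: ck.
  apply: prim_ae; [exact: sq_measurable|exact: int1_measurable i1|].
  apply: ae_mu01 => t /andP[t0 t1]; rewrite EE ?ltW// add0r /f' /f /E' /k.
  rewrite mulrA -expRD mulNr addNr expR0; ring.
have [w [w1 w2 w3]] := H1_exists 0 (toL2 f').
pose h (x : R) : R := 0 + prim (repr (toL2 f')) x.
exists w; rewrite w2 w1 -/h; apply: L2_ext.
have cp : continuous h.
  by move=> y; apply: cvgD; [exact: cvg_cst|exact/prim_continuous/L2_int1].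
have h1 := repr_toL2 (continuous_Lfun cp); have h2 := repr_toL2 sf'.
have hf : {ae mu, forall x, repr (toL2 h) x = f x}.
  have D := @ae_mu01 R (fun x => 0 < x < 1) (fun x xx => xx).
  apply: (@filterS2 _ _ (ae_filter_ringOfSetsType mu) _ _ _ _ h1 D) => x -> /andP[x0 x1].
  rewrite /h add0r -pf' ?ltW//; apply: prim_ae => //; [exact: L2_measurable|exact: sq_measurable].
have h3 := repr_L2D (toL2 h) (r *: toL2 f').
have h4 := repr_L2Z r (toL2 f').
have h5 : {ae mu, forall x, repr (toL2 h) x + repr (r *: toL2 f') x = repr g x}.
  have h6 : {ae mu, forall x, repr (r *: toL2 f') x = r * f' x}.
    by apply: (@filterS2 _ _ (ae_filter_ringOfSetsType mu) _ _ _ _ h4 h2) => x -> ->.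
  apply: (@filterS2 _ _ (ae_filter_ringOfSetsType mu) _ _ _ _ hf h6) => x -> ->.
  by rewrite /f' mulrA mulfV// mul1r addrC subrK.
by apply: (@filterS2 _ _ (ae_filter_ringOfSetsType mu) _ _ _ _ h3 h5) => x -> ->.
Qed.

End Traces.

(** * Weighted energies *)

Section WeightedProduct.
Context {R : realType}.
Local Notation mu := (@mu01 R).
Local Notation int1 f := (mu.-integrable setT (EFin \o f)).
Local Notation "'I' f" := (\int[mu]_x f x) (at level 10, f at level 8).
Local Notation L2 := (L2 R).
Implicit Types (f g k : L2) (a b : R).

Definition wip a b f g : R := I (fun t => (a + b * t) * (repr f t * repr g t)).

Let cw a b : continuous (fun t : R => a + b * t).
Proof.
move=> t; apply: cvgD; first exact: cvg_cst.
by apply: cvgM; [exact: cvg_cst|exact: cvg_id].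
Qed.

Let int_w a b f g : int1 (fun t => (a + b * t) * (repr f t * repr g t)).
Proof. by apply: int1_contM => //; apply: sqM; exact: L2_sq. Qed.

Lemma wipC a b f g : wip a b f g = wip a b g f.
Proof. by apply: eq_Rintegral => t _; rewrite [repr f t * _]mulrC. Qed.

Lemma wip_lin a b (r : R) f g k : wip a b (r *: f + g) k = r * wip a b f k + wip a b g k.
Proof.
rewrite /wip -IZ// -ID//; last exact: int1Z.
apply: I_ae.
- exact: int1_measurable (int_w _ _ _ _).
- by apply: int1_measurable; apply: int1D => //; exact: int1Z.
- apply: (@filterS _ _ (ae_filter_ringOfSetsType mu) _ _ _ (L2_repr_linear r f g)) => t ->.
  by ring.
Qed.

Lemma wipD a b f g k : wip a b (f + g) k = wip a b f k + wip a b g k.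
Proof. by have := wip_lin a b 1 f g k; rewrite scale1r mul1r. Qed.

Lemma wip0 a b k : wip a b 0 k = 0.
Proof. by have := wipD a b 0 0 k; rewrite addr0; lra. Qed.

Lemma wipZ a b (r : R) f k : wip a b (r *: f) k = r * wip a b f k.
Proof. by have := wip_lin a b r f 0 k; rewrite addr0 wip0 addr0. Qed.

Lemma wipN a b f k : wip a b (- f) k = - wip a b f k.
Proof. by rewrite -scaleN1r wipZ mulN1r. Qed.

Lemma wipDr a b f g k : wip a b k (f + g) = wip a b k f + wip a b k g.
Proof. by rewrite wipC wipD !(wipC _ _ k). Qed.

Lemma wipNr a b f k : wip a b k (- f) = - wip a b k f.
Proof. by rewrite wipC wipN (wipC _ _ k). Qed.

Lemma wip_norm f : wip 1 0 f f = `|f| ^+ 2.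
Proof.
by rewrite L2_norm_sqr; apply: eq_Rintegral => t _; rewrite mul0r addr0 mul1r expr2.
Qed.

Lemma wip_bounds a b (lo hi : R) f : lo <= a <= hi -> lo <= a + b <= hi ->
  lo * `|f| ^+ 2 <= wip a b f f <= hi * `|f| ^+ 2.
Proof.
move=> /andP[l1 h1] /andP[l2 h2]; rewrite -!wip_norm.
have i1 := int_w 1 0 f f; have w := int_w a b f f.
rewrite /wip -!IZ//; apply/andP; split; (apply: I_le; [by [exact: int1Z|]|by [exact: int1Z|]|]).
- apply: ae_mu01 => t /andP[t0 t1]; rewrite mul0r addr0 mul1r -expr2 ler_wpM2r ?sqr_ge0//.
  by nra.
- apply: ae_mu01 => t /andP[t0 t1]; rewrite mul0r addr0 mul1r -expr2 ler_wpM2r ?sqr_ge0//.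
  by nra.
Qed.

Lemma wip_CS f g : wip 1 0 f g <= `|f| * `|g|.
Proof.
apply: le_trans (L2_CS f g); apply: I_le => //.
  by apply: int1_norm; apply: sqM; exact: L2_sq.
by apply: ae_mu01 => t _; rewrite mul0r addr0 mul1r ler_norm.
Qed.

(** The work of a transport operator against the weighted product: the energies
    at the two ends, and a bounded term due to the slope of the weight. *)
Lemma wip_energy a b (w : H1 R) : wip a b (wderiv w) (H1fun w) =
  2^-1 * ((a + b) * crep w 1 ^+ 2 - a * crep w 0 ^+ 2 - b * `|H1fun w| ^+ 2).
Proof.
have hg := L2_int1 (wderiv w); have := weighted_energy a b (crep w 0) hg.
rewrite /= -crepE ?lexx ?ler01// (prim_le0 hg (lexx 0)) addr0.
set f := fun t => crep w 0 + prim (repr (wderiv w)) t => E.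
have cf : continuous f.
  by move=> y; apply: cvgD; [exact: cvg_cst|exact: prim_continuous].
have hw := H1_repr w.
have -> : wip a b (wderiv w) (H1fun w) = I (fun t => (a + b * t) * (f t * repr (wderiv w) t)).
  apply: I_ae.
  - exact: int1_measurable (int_w _ _ _ _).
  - by apply: int1_measurable; apply: int1_contM => //; exact: int1_contM.
  - by apply: (@filterS _ _ (ae_filter_ringOfSetsType mu) _ _ _ hw) => t ->; rewrite -/(f t) mulrC [f t * _]mulrC mulrC.
rewrite E L2_norm_sqr; congr (_ * (_ - _ * _)).
apply: I_ae.
- by apply: measurable_funX; exact: cont_measurable.
- by apply: measurable_funX; exact: L2_measurable.
- by apply: (@filterS _ _ (ae_filter_ringOfSetsType mu) _ _ _ hw) => t ->.
Qed.

Lemma L2_parallelogram f g : `|f + g| ^+ 2 + `|f - g| ^+ 2 = 2 * (`|f| ^+ 2 + `|g| ^+ 2).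
Proof.
rewrite -!wip_norm !wipD !wipDr !wipN !wipNr (wipC _ _ g f); ring.
Qed.

End WeightedProduct.

Section FiniteBounds.
Context {R : realType} {I : finType}.

Lemma finite_lower_bound (f : I -> R) : (forall i, 0 < f i) ->
  exists2 k, 0 < k & forall i, k <= f i.
Proof.
move=> f0; have s0 : 0 <= \sum_i (f i)^-1 by apply: sumr_ge0 => i _; rewrite invr_ge0 ltW.
exists (1 + \sum_i (f i)^-1)^-1; first by rewrite invr_gt0; lra.
move=> i; rewrite invf_ple ?posrE//; last by lra.
rewrite (bigD1 i)//=; have : 0 <= \sum_(j | j != i) (f j)^-1.
  by apply: sumr_ge0 => j _; rewrite invr_ge0 ltW.
lra.
Qed.

Lemma finite_upper_bound (f : I -> R) : exists2 k, 0 < k & forall i, f i <= k.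
Proof.
have s0 : 0 <= \sum_i `|f i| by exact: sumr_ge0.
exists (1 + \sum_i `|f i|); first by lra.
move=> i; rewrite (bigD1 i)//=; have := ler_norm (f i).
by have : 0 <= \sum_(j | j != i) `|f j|; [exact: sumr_ge0|lra].
Qed.

End FiniteBounds.

(** * The normed space of states *)

Section States.
Context {R : realType} {m : nat}.
Local Notation state := (state R m).
Implicit Types (x y : state) (i j : edge m).

Lemma state_norm_sqr x : `|x| ^+ 2 = \sum_i (`|(x i).1| ^+ 2 + `|(x i).2| ^+ 2).
Proof.
by rewrite -[`|x|]/(state_norm x) sqr_sqrtr// sumr_ge0// => i _; rewrite addr_ge0// sqr_ge0.
Qed.

Lemma stateE (a : R) x y i : (a *: x + y) i = (a *: (x i).1 + (y i).1, a *: (x i).2 + (y i).2).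
Proof. by rewrite !ffunE. Qed.

Lemma stateB x y i : (x - y) i = ((x i).1 - (y i).1, (x i).2 - (y i).2).
Proof. by rewrite !ffunE. Qed.

Lemma state_fst_le x i : `|(x i).1| <= `|x|.
Proof.
rewrite -(@ler_pXn2r _ 2) ?nnegrE// state_norm_sqr (bigD1 i)//= -addrA lerDl.
by rewrite addr_ge0 ?sqr_ge0// sumr_ge0// => j _; rewrite addr_ge0// sqr_ge0.
Qed.

Lemma state_snd_le x i : `|(x i).2| <= `|x|.
Proof.
rewrite -(@ler_pXn2r _ 2) ?nnegrE// state_norm_sqr (bigD1 i)//= addrAC lerDr.
by rewrite addr_ge0 ?sqr_ge0// sumr_ge0// => j _; rewrite addr_ge0// sqr_ge0.
Qed.

Lemma state_complete : seq_complete [set: state].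
Proof.
move=> u _ cu.
have /choice[l1 h1] : forall i, exists l, forall e : R, 0 < e -> exists N, forall n, (N <= n)%N ->
    `|(u n i).1 - l| < e.
  move=> i; have [//|e e0|l [_ hl]] := @H1_complete R (fun n => (u n i).1).
    have [N hN] := cu e e0; exists N => p q Np Nq; apply: le_lt_trans (hN p q Np Nq).
    by have := state_fst_le (u p - u q) i; rewrite stateB.
  by exists l.
have /choice[l2 h2] : forall i, exists l, forall e : R, 0 < e -> exists N, forall n, (N <= n)%N ->
    `|(u n i).2 - l| < e.
  move=> i; have [//|e e0|l [_ hl]] := @L2_complete R (fun n => (u n i).2).
    have [N hN] := cu e e0; exists N => p q Np Nq; apply: le_lt_trans (hN p q Np Nq).
    by have := state_snd_le (u p - u q) i; rewrite stateB.
  by exists l.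
exists [ffun i => (l1 i, l2 i)]; split=> // e e0.
pose M := (m.+1)%:R : R; have M0 : 0 < M by rewrite ltr0n.
have e1 : 0 < e / 2 / M by rewrite !divr_gt0.
have /choice[N1 k1] : forall i, exists N, forall n, (N <= n)%N -> `|(u n i).1 - l1 i| < e / 2 / M.
  by move=> i; exact: h1.
have /choice[N2 k2] : forall i, exists N, forall n, (N <= n)%N -> `|(u n i).2 - l2 i| < e / 2 / M.
  by move=> i; exact: h2.
exists (\max_i maxn (N1 i) (N2 i)) => n hn.
have hi i : `|(u n i).1 - l1 i| ^+ 2 + `|(u n i).2 - l2 i| ^+ 2 < e ^+ 2 / M.
  have : (maxn (N1 i) (N2 i) <= n)%N by apply: leq_trans hn; exact: (leq_bigmax i).
  rewrite geq_max => /andP[/(k1 i) a1 /(k2 i) a2].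
  have b1 := normr_ge0 ((u n i).1 - l1 i); have b2 := normr_ge0 ((u n i).2 - l2 i).
  have M1 : 1 <= M by rewrite ler1n.
  have eM : (e / 2 / M) ^+ 2 <= e ^+ 2 / M / 4.
    have -> : (e / 2 / M) ^+ 2 = e ^+ 2 / M / 4 / M by field; rewrite gt_eqF.
    by rewrite ler_pdivrMr// ler_peMr// !mulr_ge0 ?invr_ge0 ?sqr_ge0// ltW.
  have : 0 < e ^+ 2 / M by rewrite divr_gt0// exprn_gt0.
  have a3 : `|(u n i).1 - l1 i| ^+ 2 <= (e / 2 / M) ^+ 2.
    by rewrite lerXn2r ?nnegrE ?(ltW a1) ?(ltW e1).
  have a4 : `|(u n i).2 - l2 i| ^+ 2 <= (e / 2 / M) ^+ 2.
    by rewrite lerXn2r ?nnegrE ?(ltW a2) ?(ltW e1).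
  have aux (A B D E : R) : D <= E / 4 -> A <= D -> B <= D -> 0 < E -> A + B < E.
    by clear; lra.
  exact: aux eM a3 a4.
rewrite -(@ltr_pXn2r _ 2) ?nnegrE ?(ltW e0)// state_norm_sqr.
have -> : e ^+ 2 = \sum_(i < m.+1) e ^+ 2 / M.
  by rewrite sumr_const card_ord -[RHS]mulr_natr mulfVK// gt_eqF.
apply: ltr_sum; last by move=> i _; rewrite stateB ffunE; exact: hi.
by apply/hasP; exists ord0 => //; rewrite mem_index_enum.
Qed.

Lemma closed_complete (W : set state) :
  (forall (u : nat -> state) l, (forall n, W (u n)) ->
    (forall e : R, 0 < e -> exists n, `|u n - l| < e) -> W l) -> seq_complete W.
Proof.
move=> cW u Wu cu; have [//|l [_ hl]] := state_complete _ cu.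
exists l; split=> //; apply: (cW u) => // e e0; have [N hN] := hl e e0.
by exists N; exact: hN.
Qed.

End States.

(** * Linear feedback *)

Section FiniteLinear.
Context {R : realType} {K : finType}.
Local Notation vec := {ffun K -> R^o}.

Lemma linear_bound (L : vec -> vec) : linear L ->
  exists2 C : R, 0 <= C & forall a, \sum_k (L a k) ^+ 2 <= C * \sum_k (a k) ^+ 2.
Proof.
move=> lL; pose F : {linear vec -> vec} := HB.pack L (GRing.isLinear.Build R _ _ _ L lL).
pose d l : vec := [ffun k => (k == l)%:R].
have dE a k : L a k = \sum_l a l * L (d l) k.
  have -> : L a = \sum_l (a l : R) *: L (d l).
    have -> : \sum_l (a l : R) *: L (d l) = F (\sum_l (a l : R) *: d l).
      by rewrite linear_sum; apply: eq_bigr => l _; rewrite linearZ.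
    congr (L _); apply/ffunP => j; rewrite sum_ffunE (bigD1 j)//= big1.
      by rewrite !ffunE eqxx addr0 /GRing.scale/= mulr1.
    by move=> l lj; rewrite !ffunE eq_sym (negbTE lj) /GRing.scale/= mulr0.
  by rewrite sum_ffunE; apply: eq_bigr => l _; rewrite !ffunE.
pose S k := \sum_l (L (d l) k : R) ^+ 2.
have S0 k : 0 <= S k by apply: sumr_ge0 => l _; exact: sqr_ge0.
exists (\sum_k S k); first exact: sumr_ge0.
move=> a; rewrite mulr_suml; apply: ler_sum => k _.
have A0 : 0 <= \sum_k (a k : R) ^+ 2 by apply: sumr_ge0 => l _; exact: sqr_ge0.
have cs1 := sum_cauchy (fun l => a l : R) (fun l => L (d l) k : R).
have cs2 := sum_cauchy (fun l => - a l : R) (fun l => L (d l) k : R).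
have e : Num.sqrt (\sum_i (- a i : R) ^+ 2) = Num.sqrt (\sum_i (a i : R) ^+ 2).
  by congr Num.sqrt; apply: eq_bigr => l _; rewrite sqrrN.
have e2 : \sum_i (- a i : R) * (L (d i) k : R) = - (L a k : R).
  by rewrite dE -sumrN; apply: eq_bigr => l _; rewrite mulNr.
rewrite e e2 in cs2; rewrite -dE in cs1.
have : `|L a k : R| <= Num.sqrt (\sum_i (a i : R) ^+ 2) * Num.sqrt (S k).
  by rewrite ler_norml; apply/andP; split; [rewrite lerNl|].
move=> h; rewrite -(real_normK (num_real (L a k : R))).
rewrite mulrC -(sqr_sqrtr A0) -(sqr_sqrtr (S0 k)) -exprMn lerXn2r// nnegrE.
by rewrite mulr_ge0 ?sqrtr_ge0.
Qed.

Lemma linear_inj_surj (f : vec -> vec) : linear f ->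
  (forall a, f a = 0 -> a = 0) -> forall b, exists a, f a = b.
Proof.
move=> lf f0 b; pose F : {linear vec -> vec} := HB.pack f (GRing.isLinear.Build R _ _ _ f lf).
have k0 : lker (linfun F) == 0%VS.
  apply/lker0P => x y; rewrite !lfunE/= => e; apply/eqP; rewrite -subr_eq0; apply/eqP.
  by apply: f0; rewrite -[f _]/(F _) linearB/= e subrr.
have : b \in limg (linfun F) by rewrite (lker0_limgf k0) memvf.
by move=> /memv_imgP[a _ ->]; exists a; rewrite lfunE.
Qed.

(** The system is [(1 - L E) a = L r], where [L E] is a strict contraction for the
    Euclidean norm: the linear map is injective, hence onto. *)
Lemma linear_feedback (L : vec -> vec) (C e : R) (E : K -> R) (r : vec) : linear L ->
  (forall a, \sum_k (L a k) ^+ 2 <= C * \sum_k (a k) ^+ 2) -> 0 <= C ->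
  (forall k, 0 <= E k <= e) -> C * e ^+ 2 < 1 ->
  exists a : vec, a = L [ffun k => E k * a k + r k].
Proof.
move=> lL hC C0 hE Ce.
pose F : {linear vec -> vec} := HB.pack L (GRing.isLinear.Build R _ _ _ L lL).
pose D (a : vec) : vec := [ffun k => E k * a k].
have lD : linear D.
  by move=> s a b; apply/ffunP => k; rewrite !ffunE /GRing.scale/=; ring.
pose f a := a - L (D a).
have lf : linear f.
  move=> s a b; rewrite /f lD -[L (_ + _)]/(F _) linearP/= scalerBr opprD addrACA.
  by [].
have finj a : f a = 0 -> a = 0.
  move=> /subr0_eq fa; have := hC (D a); rewrite -fa.
  have A0 : 0 <= \sum_k (a k : R) ^+ 2 by apply: sumr_ge0 => l _; exact: sqr_ge0.
  have : \sum_k (D a k : R) ^+ 2 <= e ^+ 2 * \sum_k (a k : R) ^+ 2.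
    rewrite mulr_sumr; apply: ler_sum => k _; rewrite ffunE exprMn ler_wpM2r ?sqr_ge0//.
    by have /andP[h1 h2] := hE k; rewrite lerXn2r// nnegrE (le_trans h1).
  move=> h1 h2; have {}h2 : \sum_k (a k : R) ^+ 2 <= C * e ^+ 2 * \sum_k (a k : R) ^+ 2.
    by apply: le_trans h2 _; rewrite -mulrA ler_wpM2l.
  have : \sum_k (a k : R) ^+ 2 == 0.
    rewrite eq_le A0 andbT; move: (C * e ^+ 2) Ce h2 => q q1; nra.
  rewrite psumr_eq0; last by move=> k _; exact: sqr_ge0.
  move=> /allP h; apply/ffunP => k; rewrite ffunE; apply/eqP.
  by have := h k (mem_index_enum _); rewrite sqrf_eq0.
have [a ha] := linear_inj_surj lf finj (L r).
exists a; have -> : [ffun k => E k * a k + r k] = D a + r.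
  by apply/ffunP => k; rewrite !ffunE.
rewrite -[L _]/(F _) linearD/= -ha /f addrC.
by rewrite subrK.
Qed.

End FiniteLinear.

(** * Incidence in the tree *)

Section TreeStructure.
Context {m : nat} (T : tree m).
Implicit Types (i j : edge m).

Lemma fin_pt_inj : injective (@fin_pt m).
Proof. exact: lift_inj. Qed.

Lemma init_root i : (init_pt T i == root_node) = (i == edge1).
Proof.
apply/eqP/eqP => [ir|->]; last exact: init_edge1.
have := root_simple T; rewrite /degree => d.
have : (#|[pred i | init_pt T i == root_node]| <= 1)%N by rewrite -d leq_addr.
move=> /card_le1_eqP; apply; rewrite inE ?ir//.
by rewrite init_edge1.
Qed.

(** The edge whose final point is the initial point of [i]; meaningful for
    [i != edge1]. *)
Definition parent i : edge m := odflt edge1 (unlift ord0 (init_pt T i)).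

Lemma out_edgesE i j : (i \in outgoing T (fin_pt j)) = (i != edge1) && (parent i == j).
Proof.
rewrite inE -init_root /parent; case: unliftP => [k ->|->]/=.
  by rewrite (inj_eq fin_pt_inj) eq_sym; case: eqVneq.
by [].
Qed.

Lemma out_parent i : i != edge1 -> i \in outgoing T (fin_pt (parent i)).
Proof. by move=> i1; rewrite out_edgesE i1 eqxx. Qed.

Lemma degree_fin_pt j : degree (init_pt T) (fin_pt j) = knode T (fin_pt j).
Proof.
rewrite /degree /knode /outgoing /out_edges cardsE -[RHS]addn1; congr (_ + _)%N.
rewrite -(card1 j); apply: eq_card => i; rewrite !inE.
by rewrite (inj_eq fin_pt_inj).
Qed.

Lemma simple_out j : simple_node T (fin_pt j) <-> #|outgoing T (fin_pt j)| = 0%N.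
Proof. by rewrite /simple_node degree_fin_pt /knode; split=> [[]|->]. Qed.

Lemma multiple_out j : multiple_node T (fin_pt j) <-> (0 < #|outgoing T (fin_pt j)|)%N.
Proof. by rewrite /multiple_node degree_fin_pt /knode ltnS. Qed.

Lemma multiple_fin_pt n : multiple_node T n -> exists j, n = fin_pt j.
Proof.
rewrite /multiple_node; case: (unliftP ord0 n) => [j ->|->]; first by exists j.
by rewrite -[ord0]/root_node (root_simple T).
Qed.

(** As [fin_pt i] is the final point of [i] alone, a loop would make this node
    out of reach of the root. *)
Lemma no_loop i : init_pt T i != fin_pt i.
Proof.
apply/negP => /eqP ii.
have /connectP[p pp lp] := tree_connected T (fin_pt i).
have : root_node != fin_pt i by [].
elim: p (root_node : node m) pp lp => [|b p IH] a /=; first by move=> _ <-; rewrite eqxx.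
move=> /andP[/existsP[e /andP[/eqP ea /eqP eb]] pp] lp ai; apply: (IH b) => //.
apply: contraNneq ai => bi; have ei : e = i by apply: fin_pt_inj; rewrite eb.
by rewrite -ea ei ii.
Qed.

End TreeStructure.

(** * Waves and scattering *)

(* Identities and inequalities for the energy of one edge *)
Fact sum3_lin (R : realType) (a A A' B B' C C' : R) :
  (a * A + A') + (a * B + B') + (a * C + C') = a * (A + B + C) + (A' + B' + C').
Proof. by ring. Qed.

Fact energy_lower (R : realType) (q k C A B V W : R) : q <= 1 -> q <= 2 * k -> 0 <= q ->
  0 <= A -> 0 <= B -> 0 <= V -> k <= C ->
  2 * (V + C * B) <= W -> q * (A + B + V) <= A + W.
Proof.
move=> q1 q2 q0 A0 B0 V0 kC h.
have h1 : q * A <= A by rewrite ler_piMl.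
have h2 : q * V <= V by rewrite ler_piMl.
have h3 : q * B <= 2 * C * B by apply: ler_wpM2r => //; lra.
lra.
Qed.

Fact energy_upper (R : realType) (th k C A B V W : R) : 0 <= th -> 0 <= k -> C <= k ->
  0 <= A -> 0 <= B -> 0 <= V ->
  W <= (1 + th) * (2 * (V + C * B)) -> A + W <= 2 * (1 + th) * (1 + k) * (A + B + V).
Proof.
move=> th0 k0 Ck A0 B0 V0 h.
have h1 : V + C * B <= (1 + k) * (B + V).
  have : C * B <= k * B by exact: ler_wpM2r.
  have := mulr_ge0 k0 V0; lra.
have h2 : (1 + th) * (2 * (V + C * B)) <= (1 + th) * (2 * ((1 + k) * (B + V))).
  by apply: ler_wpM2l; lra.
have h3 : A <= (2 * (1 + th) * (1 + k)) * A.
  apply: ler_peMl => //; have := mulr_ge0 th0 k0; lra.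
lra.
Qed.

Section Generation.
Context {R : realType} {m : nat} (T : tree m).
Context (c : edge m -> R) (c_gt0 : forall i : edge m, 0 < c i) (alpha : node m -> R).
Local Notation state := (state R m).
Local Notation out j := (outgoing T (fin_pt j)).
Implicit Types (x y : state) (i j : edge m) (b th : R).

Let z01 : 0 <= (0 : R) <= 1.
Proof. by rewrite lexx ler01. Qed.

Let o01 : 0 <= (1 : R) <= 1.
Proof. by rewrite lexx ler01. Qed.

Definition velocity x i : H1 R := toH1 (x i).2.
Definition slope x i : H1 R := dx (x i).1.

(** The Riemann invariants: [v - c u_x] is transported to the right and
    [v + c u_x] to the left, with speed [c]. *)
Definition rightw x i : H1 R := - c i *: slope x i + velocity x i.
Definition leftw x i : H1 R := c i *: slope x i + velocity x i.

Lemma crep_rightw x i (t : R) : 0 <= t <= 1 ->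
  crep (rightw x i) t = - c i * crep (slope x i) t + crep (velocity x i) t.
Proof. exact: crep_lin. Qed.

Lemma crep_leftw x i (t : R) : 0 <= t <= 1 ->
  crep (leftw x i) t = c i * crep (slope x i) t + crep (velocity x i) t.
Proof. exact: crep_lin. Qed.

(** The boundary conditions at the final point of [j] express the common
    velocity of the waves there, multiplied by this factor, as the sum of the
    incoming waves. At external nodes there is one incoming wave, and the
    condition is that it is not reflected. *)
Definition kappa j : R :=
  if #|out j| == 0%N then 2 else (knode T (fin_pt j))%:R - alpha (fin_pt j).

Lemma kappa_neq0 : (forall n, multiple_node T n -> alpha n <> (knode T n)%:R) ->
  forall j, kappa j != 0.
Proof.
move=> h j; rewrite /kappa; have [n0|o0] := posnP #|out j|.
  by rewrite pnatr_eq0.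
rewrite subr_eq0 eq_sym; apply/eqP; apply: h.
exact/multiple_out.
Qed.

(** The boundary conditions at all nodes but the root, for the velocities and
    the waves: at each node the incoming waves determine the velocity, hence the
    outgoing waves, provided [kappa] does not vanish. *)
Definition scattering x : Prop := forall j,
  kappa j * crep (velocity x j) 1 =
    crep (rightw x j) 1 + \sum_(i in out j) crep (leftw x i) 0 /\
  forall i, i \in out j -> crep (velocity x i) 0 = crep (velocity x j) 1.

Lemma scatteringP x : scattering x <->
  [/\ outer_cond T c x, inner_cond T c alpha x &
    forall j i, i \in out j -> crep (velocity x i) 0 = crep (velocity x j) 1].
Proof.
have simple j : #|out j| = 0%N -> \sum_(i in out j) crep (leftw x i) 0 = 0.
  by move=> o0; rewrite big1// => i io; move: (card0_eq o0 i); rewrite io.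
have mult j : (forall i, i \in out j -> crep (velocity x i) 0 = crep (velocity x j) 1) ->
    \sum_(i in out j) crep (leftw x i) 0 =
    \sum_(i in out j) c i * crep (slope x i) 0 + #|out j|%:R * crep (velocity x j) 1.
  move=> h; rewrite mulr_natl -sumr_const -big_split/=; apply: eq_bigr => i io.
  by rewrite crep_leftw// h.
split=> [h|[ho hi hc] j].
  split=> [j /simple_out o0|j /multiple_out o0|j]; last by have [] := h j.
    have [] := h j; rewrite /kappa o0 eqxx (simple j)// crep_rightw//.
    by rewrite -/(slope x j) -/(velocity x j); lra.
  have [] := h j; rewrite /kappa -[_ == _]negbK -lt0n o0/= => e /mult e'; move: e.
  rewrite e' crep_rightw// /knode -natr1.
  by rewrite -/(slope x j) -/(velocity x j); under eq_bigr do rewrite -/(slope x _); lra.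
split; last by move=> i; exact: hc.
have [n0|o0] := posnP #|out j|.
  have := ho j ((simple_out T j).2 n0); rewrite /kappa n0 eqxx (simple j)// crep_rightw//.
  by rewrite -/(slope x j) -/(velocity x j); lra.
have := hi j ((multiple_out T j).2 o0); rewrite mult; last by move=> i; exact: hc.
rewrite /kappa -[_ == _]negbK -lt0n o0/= crep_rightw// /knode -natr1.
rewrite -/(slope x j) -/(velocity x j); under eq_bigr do rewrite -/(slope x _).
by lra.
Qed.

(** The three domains differ only in the space and in the reflection coefficient
    [b] at the root: the end is transparent, free or fixed according as [b] is
    0, 1 or -1. *)
Definition dom b (W : set state) : set state := [set x |
  [/\ W x, H2_H1 x, scattering x & crep (rightw x edge1) 0 = b * crep (leftw x edge1) 0]].

Let common_domainE x : common_domain T c alpha x <->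
  [/\ spaceH T x, H2_H1 x & scattering x].
Proof.
split=> [[h2 ho hi hc]|[W h2 /scatteringP[ho hi hc]]].
  have mo j i : i \in out j -> multiple_node T (fin_pt j).
    by move=> io; apply/multiple_out/card_gt0P; exists i.
  split=> //; first by move=> j mj i io; have [] := hc j mj i io.
  by apply/scatteringP; split=> // j i io; have [] := hc j (mo j i io) i io.
by split=> // j mj i io; split; [exact: W|exact: hc].
Qed.

Lemma domain_TE : domain_T T c alpha = dom 0 (spaceH T).
Proof.
apply/seteqP; split=> x /=; rewrite /dom/= => -[].
  move=> /common_domainE[W h2 sc] e; split=> //.
  by rewrite crep_rightw// -/(slope x _) -/(velocity x _) in e *; lra.
move=> W h2 sc e; split; first exact/common_domainE.
by move: e; rewrite crep_rightw// -/(slope x _) -/(velocity x _); lra.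
Qed.

Lemma domain_NE : domain_N T c alpha = dom 1 (spaceH T).
Proof.
have c1 := c_gt0 edge1.
apply/seteqP; split=> x /=; rewrite /dom/= => -[].
  move=> /common_domainE[W h2 sc] e; split=> //.
  by rewrite crep_rightw// crep_leftw// [crep (slope x _) 0]e; lra.
move=> W h2 sc e; split; first exact/common_domainE.
move: e; rewrite crep_rightw// crep_leftw// -/(slope x _); nra.
Qed.

Lemma domain_DE : domain_D T c alpha = dom (-1) (spaceH0 T).
Proof.
apply/seteqP; split=> x /=; rewrite /dom/= => -[].
  move=> /common_domainE[W h2 sc] [e1 e2]; split=> //.
  by rewrite crep_rightw// crep_leftw// [crep (velocity x _) 0]e2; lra.
move=> [W W0] h2 sc e; split; first exact/common_domainE.
split=> //; move: e; rewrite crep_rightw// crep_leftw// -/(velocity x _); lra.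
Qed.

Let spaceH_linear : linear_subspace (spaceH T : set state).
Proof.
split=> [j mj i io|a x y Wx Wy j mj i io]; first by rewrite !ffunE/= !crep0.
by rewrite !stateE/= !crep_lin// (Wx j mj i io) (Wy j mj i io).
Qed.

Let spaceH0_linear : linear_subspace (spaceH0 T : set state).
Proof.
have [h0 hl] := spaceH_linear; split=> [|a x y [Wx x0] [Wy y0]].
  by split=> //; rewrite ffunE/= crep0.
by split; [exact: hl|rewrite stateE/= crep_lin// x0 y0 mulr0 addr0].
Qed.

Let trace_closed (u : nat -> state) l i j (s t : R) : 0 <= s <= 1 -> 0 <= t <= 1 ->
  (forall n, crep (u n i).1 s = crep (u n j).1 t) ->
  (forall e : R, 0 < e -> exists n, `|u n - l| < e) -> crep (l i).1 s = crep (l j).1 t.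
Proof.
move=> s01 t01 hu hl; apply/eqP; rewrite -subr_eq0 -normr_le0.
apply/ler_addgt0Pr => e e0; rewrite add0r.
have [n hn] := hl (e / 4) (divr_gt0 e0 (ltr0Sn _ 3)).
have d k r : 0 <= r <= 1 -> `|crep (u n k).1 r - crep (l k).1 r| <= 2 * `|u n - l|.
  move=> r01; have := sobolev ((u n k).1 - (l k).1) r01.
  rewrite crepB// => /le_trans; apply; rewrite ler_pM2l//.
  by have := state_fst_le (u n - l) k; rewrite stateB.
have d1 := d i s s01; have d2 := d j t t01; rewrite hu in d1.
have := ler_distD (crep (u n j).1 t) (crep (l i).1 s) (crep (l j).1 t).
rewrite (distrC (crep (l i).1 s) (crep (u n j).1 t)); lra.
Qed.

Let spaceH_complete : seq_complete (spaceH T : set state).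
Proof.
apply: closed_complete => u l Wu hl j mj i io.
by apply: (trace_closed z01 o01 _ hl) => n; exact: Wu.
Qed.

Let spaceH0_complete : seq_complete (spaceH0 T : set state).
Proof.
apply: closed_complete => u l Wu hl; split.
  move=> j mj i io; apply: (trace_closed z01 o01 _ hl) => n.
  by have [h _] := Wu n; exact: h.
apply/eqP; rewrite -normr_le0; apply/ler_addgt0Pr => e e0; rewrite add0r.
have [n hn] := hl (e / 2) (divr_gt0 e0 (ltr0Sn _ 1)).
have := sobolev ((u n edge1).1 - (l edge1).1) z01.
rewrite crepB//; have [_ ->] := Wu n; rewrite sub0r normrN => /le_trans; apply.
have := state_fst_le (u n - l) edge1; rewrite stateB/=; lra.
Qed.

Section Linearity.
Context (a : R) (x y : state) (hx : H2_H1 x) (hy : H2_H1 y).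

Lemma H2_H1_lin : H2_H1 (a *: x + y).
Proof.
move=> i; rewrite stateE/=; have [x1 x2] := hx i; have [y1 y2] := hy i; split.
  by rewrite /isH2 wderiv_lin; exact: (toH1_lin a x1 y1).2.
exact: (toH1_lin a x2 y2).2.
Qed.

Lemma velocity_lin i : velocity (a *: x + y) i = a *: velocity x i + velocity y i.
Proof.
rewrite /velocity stateE/=; have [x1 x2] := hx i; have [y1 y2] := hy i.
exact: (toH1_lin a x2 y2).1.
Qed.

Lemma slope_lin i : slope (a *: x + y) i = a *: slope x i + slope y i.
Proof.
rewrite /slope /dx stateE/= wderiv_lin; have [x1 x2] := hx i; have [y1 y2] := hy i.
exact: (toH1_lin a x1 y1).1.
Qed.

Lemma wave_op_lin : wave_op c (a *: x + y) = a *: wave_op c x + wave_op c y.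
Proof.
apply/ffunP => i; rewrite stateE [in LHS]ffunE.
rewrite -/(velocity _ i) velocity_lin /dxx -/(slope _ i) slope_lin wderiv_lin.
by rewrite ![wave_op _ _ i]ffunE/= scalerDr !scalerA mulrC.
Qed.

Lemma rightw_lin i : rightw (a *: x + y) i = a *: rightw x i + rightw y i.
Proof.
rewrite /rightw velocity_lin slope_lin !scalerDr !scalerA mulrC -!addrA; congr (_ + _).
by rewrite addrCA.
Qed.

Lemma leftw_lin i : leftw (a *: x + y) i = a *: leftw x i + leftw y i.
Proof.
rewrite /leftw velocity_lin slope_lin !scalerDr !scalerA mulrC -!addrA; congr (_ + _).
by rewrite addrCA.
Qed.

Lemma scattering_lin : scattering x -> scattering y -> scattering (a *: x + y).
Proof.
move=> sx sy j; have [x1 x2] := sx j; have [y1 y2] := sy j.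
rewrite velocity_lin rightw_lin !crep_lin//; split.
  have -> : \sum_(i in out j) crep (leftw (a *: x + y) i) 0 =
      a * \sum_(i in out j) crep (leftw x i) 0 + \sum_(i in out j) crep (leftw y i) 0.
    by rewrite mulr_sumr -big_split/=; apply: eq_bigr => i _; rewrite leftw_lin crep_lin.
  by rewrite mulrDr mulrCA x1 y1 !crep_rightw//; ring.
by move=> i io; rewrite velocity_lin crep_lin// x2// y2.
Qed.

End Linearity.

Lemma H2_H1_0 : H2_H1 (0 : state).
Proof.
move=> i; rewrite ffunE/=; split; first by exists 0.
by exists 0.
Qed.

Lemma wave0 i : velocity 0 i = 0 /\ slope 0 i = 0.
Proof.
have v := velocity_lin (-1) H2_H1_0 H2_H1_0 i; have s := slope_lin (-1) H2_H1_0 H2_H1_0 i.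
rewrite !scaler0 !addr0 in v s.
by split; [rewrite v|rewrite s]; rewrite scaleN1r addNr.
Qed.

Lemma scattering0 : scattering 0.
Proof.
move=> j; have [v0 s0] := wave0 j; split.
  rewrite v0 /rightw s0 v0 scaler0 addr0 crep0// mulr0 add0r big1// => i _.
  by have [v s] := wave0 i; rewrite /leftw v s scaler0 addr0 crep0.
by move=> i _; have [v _] := wave0 i; rewrite v v0 !crep0.
Qed.

Lemma dom_linear b (W : set state) : linear_subspace W -> linear_subspace (dom b W).
Proof.
move=> [W0 sW]; split.
  split=> //; [exact: H2_H1_0|exact: scattering0|].
  have [v s] := wave0 edge1.
  by rewrite /rightw /leftw v s !scaler0 addr0 crep0// mulr0.
move=> a x y [Wx hx sx bx] [Wy hy sy by']; split.
- exact: sW.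
- exact: H2_H1_lin.
- exact: scattering_lin.
- rewrite (rightw_lin a hx hy) (leftw_lin a hx hy).
  rewrite (crep_lin a (rightw x edge1) (rightw y edge1) z01).
  by rewrite (crep_lin a (leftw x edge1) (leftw y edge1) z01) bx by' mulrDr mulrCA.
Qed.

Lemma wave_op_linear b (W : set state) : linear_on (dom b W) (wave_op c).
Proof. by move=> a x y [_ hx _ _] [_ hy _ _]; exact: wave_op_lin. Qed.

(** At a fixed root the displacement vanishes, and so must the velocity for the
    operator to map the domain to the space. *)
Definition admissible b (W : set state) : Prop :=
  W = spaceH T \/ (W = spaceH0 T /\ b = -1).

Lemma admissible_linear b W : admissible b W -> linear_subspace W.
Proof. by case=> [->|[-> _]]; [exact: spaceH_linear|exact: spaceH0_linear]. Qed.

Lemma admissible_complete b W : admissible b W -> seq_complete W.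
Proof. by case=> [->|[-> _]]; [exact: spaceH_complete|exact: spaceH0_complete]. Qed.

Lemma wave_op_space b W x : admissible b W -> dom b W x -> W (wave_op c x).
Proof.
have main : scattering x -> spaceH T (wave_op c x).
  by move=> sx j mj i io; rewrite !ffunE/=; have [_] := sx j; apply.
case=> [->|[-> ->]] [_ hx sx e]; first exact: main.
split; first exact: main.
rewrite ffunE/= -/(velocity x edge1).
by move: e; rewrite crep_rightw// crep_leftw//; lra.
Qed.

(** * The energy *)

Definition rightf x i : L2 R := - c i *: wderiv (x i).1 + (x i).2.
Definition leftf x i : L2 R := c i *: wderiv (x i).1 + (x i).2.

Lemma rightw_fun x i : H2_H1 x -> H1fun (rightw x i) = rightf x i.
Proof.
move=> /(_ i)[h1 h2].
by rewrite H1fun_lin /slope /velocity /dx !isH1P.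
Qed.

Lemma leftw_fun x i : H2_H1 x -> H1fun (leftw x i) = leftf x i.
Proof.
move=> /(_ i)[h1 h2].
by rewrite H1fun_lin /slope /velocity /dx !isH1P.
Qed.

Lemma rightf_wave x i : H2_H1 x -> rightf (wave_op c x) i = - c i *: wderiv (rightw x i).
Proof.
move=> _; rewrite /rightf ffunE/= wderiv_lin scalerDr scalerA mulrNN -expr2 addrC.
by [].
Qed.

Lemma leftf_wave x i : H2_H1 x -> leftf (wave_op c x) i = c i *: wderiv (leftw x i).
Proof.
by move=> _; rewrite /leftf ffunE/= wderiv_lin scalerDr scalerA -expr2 addrC.
Qed.

(** The waves carry the weights [1 + th t] and [1 + th (1 - t)], which grow in the
    direction of propagation. For a large [th], the energy that waves take out
    of an edge exceeds the energy that the scattered waves bring in. *)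
Definition energy th x y : R := \sum_i
  (wip 1 0 (H1fun (x i).1) (H1fun (y i).1) + wip 1 th (rightf x i) (rightf y i)
   + wip (1 + th) (- th) (leftf x i) (leftf y i)).

Lemma rightf_lin a x y i : rightf (a *: x + y) i = a *: rightf x i + rightf y i.
Proof.
rewrite /rightf stateE/= wderiv_lin !scalerDr !scalerA mulrC -!addrA; congr (_ + _).
by rewrite addrCA.
Qed.

Lemma leftf_lin a x y i : leftf (a *: x + y) i = a *: leftf x i + leftf y i.
Proof.
rewrite /leftf stateE/= wderiv_lin !scalerDr !scalerA mulrC -!addrA; congr (_ + _).
by rewrite addrCA.
Qed.

Lemma waves_norm x i : `|rightf x i| ^+ 2 + `|leftf x i| ^+ 2 =
  2 * (`|(x i).2| ^+ 2 + c i ^+ 2 * `|wderiv (x i).1| ^+ 2).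
Proof.
have := L2_parallelogram (x i).2 (c i *: wderiv (x i).1).
rewrite normrZ exprMn real_normK ?num_real// => <-.
by rewrite addrC /rightf /leftf scaleNr (addrC (c i *: _)) (addrC (- _)).
Qed.

Lemma wave_energy_bounds th x i : 0 <= th ->
  `|rightf x i| ^+ 2 + `|leftf x i| ^+ 2 <=
  wip 1 th (rightf x i) (rightf x i) + wip (1 + th) (- th) (leftf x i) (leftf x i) <=
  (1 + th) * (`|rightf x i| ^+ 2 + `|leftf x i| ^+ 2).
Proof.
move=> th0.
have /andP[h1 h2] := @wip_bounds R 1 th 1 (1 + th) (rightf x i) ltac:(lra) ltac:(lra).
have /andP[h3 h4] := @wip_bounds R (1 + th) (- th) 1 (1 + th) (leftf x i) ltac:(lra) ltac:(lra).
rewrite !mul1r in h1 h3; rewrite mulrDr; apply/andP; split; exact: lerD.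
Qed.

Lemma energy_inner_product th : 0 <= th -> inner_product (energy th).
Proof.
move=> th0; split.
- by move=> x y; apply: eq_bigr => i _; rewrite !(wipC _ _ _ (_ (y i).1)) !(wipC _ _ _ (_ y i)).
- move=> a x y z; rewrite mulr_sumr -big_split/=; apply: eq_bigr => i _.
  rewrite rightf_lin leftf_lin stateE/= H1fun_lin.
  rewrite (wip_lin 1 0).
  rewrite (wip_lin 1 th).
  rewrite (wip_lin (1 + th)).
  exact: sum3_lin.
- have c2 i : 0 < c i ^+ 2 by rewrite exprn_gt0.
  have [k k0 hk] := finite_lower_bound c2.
  exists (Num.min 1 (2 * k)); first by rewrite lt_min ltr01/= mulr_gt0.
  move=> x; rewrite state_norm_sqr mulr_sumr; apply: ler_sum => i _.
  rewrite -addrA wip_norm H1_norm_sqr.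
  have /andP[+ _] := wave_energy_bounds x i th0; rewrite waves_norm.
  by apply: energy_lower => //; rewrite ?sqr_ge0// ?ge_min ?lexx ?orbT// le_min ler01 mulr_ge0// ltW.
have [k k0 hk] := finite_upper_bound (fun i => c i ^+ 2).
exists (2 * (1 + th) * (1 + k)) => [|x]; first by rewrite !mulr_gt0//; lra.
rewrite state_norm_sqr mulr_sumr.
apply: ler_sum => i _; rewrite -addrA wip_norm H1_norm_sqr.
have /andP[_ ] := wave_energy_bounds x i th0; rewrite waves_norm.
by apply: energy_upper => //; rewrite ?sqr_ge0// ltW.
Qed.

End Generation.

(** * Quasi-dissipativity *)

(* Arithmetic of the energy estimate on one edge. *)
Fact edge_estimate (R : realType) (th c cm vu u v p q p0 p1 q0 q1 E : R) :
  0 <= th -> 0 < c -> c <= cm ->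
  0 <= u -> 0 <= v -> 0 <= p -> 0 <= q ->
  2 * vu <= v + u -> 2 * v <= p + q -> u + (p + q) <= E ->
  vu + - c * (2^-1 * ((1 + th) * p1 - 1 * p0 - th * p))
     + c * (2^-1 * ((1 + th + - th) * q1 - (1 + th) * q0 - - th * q)) <=
  (1 + cm * th) * E + (2^-1 * (c * p0 + c * q1) - 2^-1 * ((1 + th) * (c * p1 + c * q0))).
Proof.
move=> th0 c0 ccm u0 v0 p0' q0' h1 h2 h3.
suff : vu + 2^-1 * (c * th * (p + q)) <= (1 + cm * th) * E by lra.
have h4 : c * th * (p + q) <= cm * th * (p + q).
  by apply: ler_wpM2r; [lra|exact: ler_wpM2r].
have cth : 0 <= cm * th by rewrite mulr_ge0//; lra.
have h5 : (1 + cm * th) * (u + (p + q)) <= (1 + cm * th) * E by apply: ler_wpM2l => //; lra.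
have h6 : 0 <= cm * th * (p + q) by rewrite mulr_ge0//; lra.
have h7 : 0 <= cm * th * u by rewrite mulr_ge0.
lra.
Qed.

Section Dissipation.
Context {R : realType} {m : nat} (T : tree m).
Context (c : edge m -> R) (c_gt0 : forall i : edge m, 0 < c i) (alpha : node m -> R).
Hypothesis kappa0 : forall j, kappa T alpha j != 0.
Local Notation state := (state R m).
Local Notation out j := (outgoing T (fin_pt j)).
Local Notation vec := {ffun edge m * bool -> R^o}.
Implicit Types (x y : state) (i j : edge m) (b th : R) (a : vec).

Let z01 : 0 <= (0 : R) <= 1.
Proof. by rewrite lexx ler01. Qed.

Let o01 : 0 <= (1 : R) <= 1.
Proof. by rewrite lexx ler01. Qed.

(** Waves are indexed by their edge and direction: [(i, true)] propagates to the
    right on the edge [i], and [(i, false)] to the left. *)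
Definition arriving x : vec :=
  [ffun k => if k.2 then crep (rightw c x k.1) 1 else crep (leftw c x k.1) 0].
Definition departing x : vec :=
  [ffun k => if k.2 then crep (rightw c x k.1) 0 else crep (leftw c x k.1) 1].

Definition nodal_velocity a j : R :=
  (kappa T alpha j)^-1 * (a (j, true) + \sum_(i in out j) a (i, false)).

(** At a node, the wave departing on an edge is twice the velocity minus the wave
    arriving on this edge. The root reflects. *)
Definition scatter b a : vec := [ffun k =>
  if k.2 then
    if k.1 == edge1 then b * a (edge1, false)
    else 2 * nodal_velocity a (parent T k.1) - a (k.1, false)
  else 2 * nodal_velocity a k.1 - a (k.1, true)].

Lemma scatter_linear b : linear (scatter b).
Proof.
move=> s a a'.
have nl j : nodal_velocity (s *: a + a') j = s * nodal_velocity a j + nodal_velocity a' j.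
  rewrite /nodal_velocity !ffunE /GRing.scale/=.
  under eq_bigr do rewrite !ffunE /GRing.scale/=.
  by rewrite big_split/= -mulr_sumr; ring.
apply/ffunP => -[i d]; rewrite !ffunE /GRing.scale/=.
case: d; last by rewrite nl; ring.
by case: ifP => _; rewrite ?nl; ring.
Qed.

Lemma velocity_waves x i (t : R) : 0 <= t <= 1 ->
  crep (rightw c x i) t + crep (leftw c x i) t = 2 * crep (velocity x i) t.
Proof. by move=> t01; rewrite crep_rightw// crep_leftw//; ring. Qed.

(** When [kappa] does not vanish, the boundary conditions are explicit: the
    departing waves are a linear function of the arriving waves. *)
Lemma scatter_boundary b x :
  (scattering T c alpha x /\
    crep (rightw c x edge1) 0 = b * crep (leftw c x edge1) 0) <->
  departing x = scatter b (arriving x).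
Proof.
have nvE j : nodal_velocity (arriving x) j = (kappa T alpha j)^-1 *
    (crep (rightw c x j) 1 + \sum_(i in out j) crep (leftw c x i) 0).
  by rewrite /nodal_velocity ffunE/=; under eq_bigr do rewrite ffunE/=.
split=> [[sx bx]|e].
  have nv j : nodal_velocity (arriving x) j = crep (velocity x j) 1.
    by have [k _] := sx j; rewrite nvE -k mulKf.
  apply/ffunP => -[i d]; rewrite !ffunE/=; case: d; last first.
    by rewrite nv -velocity_waves// addrC addKr.
  have [->//|i1] := eqVneq i edge1.
  rewrite nv; have [_ /(_ i (out_parent T i1)) <-] := sx (parent T i).
  by rewrite -velocity_waves// addrK.
have eR i : departing x (i, true) = scatter b (arriving x) (i, true) by rewrite e.
have eL i : departing x (i, false) = scatter b (arriving x) (i, false) by rewrite e.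
have nv j : crep (velocity x j) 1 = nodal_velocity (arriving x) j.
  apply: (@mulfI _ (2 : R)); rewrite ?pnatr_eq0// -velocity_waves//.
  by have := eL j; rewrite !ffunE/= => ->; rewrite addrC subrK.
split; last by have := eR edge1; rewrite !ffunE.
move=> j; split=> [|i]; first by rewrite nv nvE mulVKf.
rewrite out_edgesE => /andP[i1 /eqP pj].
apply: (@mulfI _ (2 : R)); rewrite ?pnatr_eq0// -velocity_waves// nv -pj.
by have := eR i; rewrite !ffunE/= (negbTE i1) => ->; rewrite subrK.
Qed.

(** The departing waves are bounded by the arriving waves, since [scatter] is a
    linear map between spaces of finite dimension. *)
Lemma boundary_balance b : exists2 th, 0 <= th & forall x, dom T c alpha b setT x ->
  \sum_i (c i * crep (rightw c x i) 0 ^+ 2 + c i * crep (leftw c x i) 1 ^+ 2) <=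
  (1 + th) * \sum_i (c i * crep (rightw c x i) 1 ^+ 2 + c i * crep (leftw c x i) 0 ^+ 2).
Proof.
have [C C0 hC] := linear_bound (scatter_linear b).
have [lo lo0 hlo] := finite_lower_bound c_gt0.
have [hi hi0 hhi] := finite_upper_bound c.
have th0 : 0 <= hi * C / lo by rewrite divr_ge0 ?mulr_ge0// ltW.
exists (hi * C / lo) => // x [_ _ sx bx].
have e := (scatter_boundary b x).1 (conj sx bx).
have pairE (f : edge m * bool -> R) : \sum_k f k = \sum_i (f (i, true) + f (i, false)).
  transitivity (\sum_i \sum_(d : bool) f (i, d)).
    by rewrite pair_bigA; apply: eq_bigr => -[].
  by apply: eq_bigr => i _; rewrite big_bool.
have dE : \sum_i (c i * crep (rightw c x i) 0 ^+ 2 + c i * crep (leftw c x i) 1 ^+ 2) =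
    \sum_k c k.1 * (departing x k : R) ^+ 2.
  by rewrite pairE; apply: eq_bigr => i _; rewrite !ffunE.
have aE : \sum_i (c i * crep (rightw c x i) 1 ^+ 2 + c i * crep (leftw c x i) 0 ^+ 2) =
    \sum_k c k.1 * (arriving x k : R) ^+ 2.
  by rewrite pairE; apply: eq_bigr => i _; rewrite !ffunE.
rewrite dE aE.
have S0 : 0 <= \sum_k c k.1 * (arriving x k : R) ^+ 2.
  by apply: sumr_ge0 => k _; rewrite mulr_ge0 ?sqr_ge0// ltW.
have h1 : \sum_k c k.1 * (departing x k : R) ^+ 2 <= hi * \sum_k (departing x k : R) ^+ 2.
  by rewrite mulr_sumr; apply: ler_sum => k _; rewrite ler_wpM2r ?sqr_ge0.
have h2 : lo * \sum_k (arriving x k : R) ^+ 2 <= \sum_k c k.1 * (arriving x k : R) ^+ 2.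
  by rewrite mulr_sumr; apply: ler_sum => k _; rewrite ler_wpM2r ?sqr_ge0.
have h3 := hC (arriving x); rewrite -e in h3.
apply: (le_trans h1); apply: (@le_trans _ _ (hi * C / lo * \sum_k c k.1 * (arriving x k : R) ^+ 2)).
  apply: (@le_trans _ _ (hi * (C * \sum_k (arriving x k : R) ^+ 2))).
    by rewrite ler_pM2l.
  rewrite -!mulrA ler_pM2l// ler_wpM2l// mulrC ler_pdivlMr// mulrC.
  by [].
by rewrite mulrDl mul1r lerDr.
Qed.

(** On each edge, integration by parts gives boundary terms, which have a
    nonpositive sum, and terms bounded by the energy. *)
Lemma energy_dissipation b : exists th w, [/\ 0 <= th, 0 <= w &
  forall x, dom T c alpha b setT x ->
    energy c th (wave_op c x) x <= w * energy c th x x].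
Proof.
have [th th0 hb] := boundary_balance b.
have [cm cm0 hcm] := finite_upper_bound c.
exists th, (1 + cm * th); split=> //; first by rewrite addr_ge0// mulr_ge0// ltW.
move=> x dx; have hx : H2_H1 x by case: dx.
have {hb} := hb x dx; rewrite -subr_le0 => hb.
pose B i := 2^-1 * (c i * crep (rightw c x i) 0 ^+ 2 + c i * crep (leftw c x i) 1 ^+ 2) -
  2^-1 * ((1 + th) * (c i * crep (rightw c x i) 1 ^+ 2 + c i * crep (leftw c x i) 0 ^+ 2)).
have B0 : \sum_i B i <= 0.
  by rewrite sumrB -!mulr_sumr -mulrBr pmulr_rle0.
apply: (@le_trans _ _ (\sum_i ((1 + cm * th) *
  (wip 1 0 (H1fun (x i).1) (H1fun (x i).1) + wip 1 th (rightf c x i) (rightf c x i)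
   + wip (1 + th) (- th) (leftf c x i) (leftf c x i)) + B i))); last first.
  by rewrite big_split/= -mulr_sumr gerDl.
apply: ler_sum => i _.
rewrite rightf_wave// leftf_wave// [wave_op c x i]ffunE/=.
rewrite (isH1P (hx i).2) !wipZ -(rightw_fun c i hx) -(leftw_fun c i hx) !wip_energy.
apply: (edge_estimate (u := `|H1fun (x i).1| ^+ 2) (v := `|(x i).2| ^+ 2)) => //.
- apply: (le_trans (ler_wpM2l _ (wip_CS _ _))) => //.
  have := sqr_ge0 (`|(x i).2| - `|H1fun (x i).1|); lra.
- rewrite (rightw_fun c i hx) (leftw_fun c i hx) waves_norm ler_pM2l// lerDl.
  by rewrite mulr_ge0 ?sqr_ge0.
rewrite wip_norm -!addrA lerD2l (rightw_fun c i hx) (leftw_fun c i hx).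
by have /andP[] := wave_energy_bounds c x i th0.
Qed.

End Dissipation.

(** * The range condition *)

Section Transport.
Context {R : realType}.
Implicit Types (r s o : R) (g : L2 R).

Lemma H1_exp r : r != 0 -> exists e : H1 R, H1fun e + r *: wderiv e = 0 /\
  forall x, 0 <= x <= 1 -> crep e x = expR (- r^-1 * x).
Proof.
move=> rn0; pose E (x : R) : R := expR (- r^-1 * x); pose E' (x : R) : R := - r^-1 * E x.
have dE (x : R) : is_derive x 1 E (E' x) by exact: is_derive_expRM.
have cE : continuous E.
  by move=> y; apply: differentiable_continuous; apply/derivable1_diffP; exact: ex_derive.
have cE' : continuous E' by move=> y; apply: cvgM; [exact: cvg_cst|exact: cE].
have [e [e1 e2 e3]] := H1_C1 dE cE'.
exists e; split=> //; rewrite e1 e2 addrC -toL2_lin; [|exact: continuous_Lfun..].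
have -> : (fun x => r * E' x + E x) = (fun x => -1 * E x + E x).
  by apply/funext => x; rewrite /E' mulrA mulrN divff.
by rewrite toL2_lin; [rewrite scaleN1r addNr|exact: continuous_Lfun..].
Qed.

(** The general solution on one edge is the sum of a particular one and of a
    multiple of an exponential. A step [h] damps the departing value [o] by
    [expR (- r^-1)], where [r] is [h] times the speed. *)
Lemma transport_right r g : 0 < r -> exists s, forall o, exists w : H1 R,
  [/\ H1fun w + r *: wderiv w = g, crep w 0 = o & crep w 1 = expR (- r^-1) * o + s].
Proof.
move=> r0; have rn0 : r != 0 by rewrite gt_eqF.
have [w0 hw0] := H1_ode g rn0; have [e [he eE]] := H1_exp rn0.
exists (crep w0 1 - expR (- r^-1) * crep w0 0) => o.
exists ((o - crep w0 0) *: e + w0); split.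
- by rewrite H1fun_lin wderiv_lin scalerDr addrACA (scalerA r) (mulrC r) -scalerA -scalerDr he scaler0 add0r.
- by rewrite crep_lin ?lexx ?ler01// eE ?lexx ?ler01// mulr0 expR0 mulr1 subrK.
- by rewrite crep_lin ?lexx ?ler01// eE ?lexx ?ler01// mulr1; ring.
Qed.

Lemma transport_left r g : 0 < r -> exists s, forall o, exists w : H1 R,
  [/\ H1fun w - r *: wderiv w = g, crep w 1 = o & crep w 0 = expR (- r^-1) * o + s].
Proof.
move=> r0; have rn0 : - r != 0 by rewrite oppr_eq0 gt_eqF.
have [w0 hw0] := H1_ode g rn0; have [e [he eE]] := H1_exp rn0.
exists (crep w0 0 - expR (- r^-1) * crep w0 1) => o.
exists ((expR (- r^-1) * (o - crep w0 1)) *: e + w0); split.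
- rewrite -scaleNr; move: (expR _ * _) => a; rewrite H1fun_lin wderiv_lin scalerDr addrACA.
  by rewrite (scalerA (- r)) (mulrC (- r)) -scalerA -scalerDr he scaler0 add0r.
- rewrite crep_lin ?lexx ?ler01// eE ?lexx ?ler01// mulr1 invrN opprK.
  by rewrite mulrAC -expRD addNr expR0 mul1r subrK.
- by rewrite crep_lin ?lexx ?ler01// eE ?lexx ?ler01// mulr0 expR0; ring.
Qed.

Lemma expRNV_le r : 0 < r -> 0 <= expR (- r^-1) <= r.
Proof.
move=> r0; rewrite expR_ge0/= expRN invf_ple ?posrE ?expR_gt0//.
have := expR_ge1Dx r^-1; lra.
Qed.

End Transport.

Fact sum_waves1 (V : zmodType) (a v q p : V) :
  a + v + q - (- a + v - p) = (a + a) + (q + p).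
Proof. by rewrite !opprD !opprK addrACA (addrACA a) subrr addr0. Qed.

Fact sum_waves2 (V : zmodType) (a v q p : V) :
  a + v + q + (- a + v - p) = (v + v) + (q - p).
Proof. by rewrite addrACA (addrACA a) subrr add0r. Qed.

Section Range.
Context {R : realType} {m : nat} (T : tree m).
Context (c : edge m -> R) (c_gt0 : forall i : edge m, 0 < c i) (alpha : node m -> R).
Hypothesis kappa0 : forall j, kappa T alpha j != 0.
Local Notation state := (state R m).
Local Notation vec := {ffun edge m * bool -> R^o}.
Implicit Types (x y : state) (i j : edge m) (b : R).

Let z01 : 0 <= (0 : R) <= 1.
Proof. by rewrite lexx ler01. Qed.

Let o01 : 0 <= (1 : R) <= 1.
Proof. by rewrite lexx ler01. Qed.

(** In terms of waves, the equation [x - h A x = y] decouples into two transport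
    equations on each edge; the displacement is recovered from the velocity. *)
Lemma euler_state b (h : R) y (p q : edge m -> H1 R) :
  (forall i, H1fun (p i) + (h * c i) *: wderiv (p i) = rightf c y i) ->
  (forall i, H1fun (q i) - (h * c i) *: wderiv (q i) = leftf c y i) ->
  ([ffun k => if k.2 then crep (p k.1) 0 else crep (q k.1) 1] : vec) =
    scatter T alpha b [ffun k => if k.2 then crep (p k.1) 1 else crep (q k.1) 0] ->
  exists x, [/\ dom T c alpha b setT x, x - h *: wave_op c x = y &
    forall i, (x i).1 = (y i).1 + h *: velocity x i].
Proof.
move=> hp hq e.
pose v i : H1 R := 2^-1 *: (q i + p i).
pose s i : H1 R := (2 * c i)^-1 *: (q i - p i).
pose x : state := [ffun i => ((y i).1 + h *: v i, H1fun (v i))].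
have c0 i : c i != 0 by rewrite gt_eqF.
have half (V : lmodType R) (w : V) : 2^-1 *: (w + w) = w.
  by rewrite scalerDr -scalerDl (_ : 2^-1 + 2^-1 = 1 :> R) ?scale1r//; field.
have Pe i : H1fun (p i) = - c i *: wderiv (y i).1 + (y i).2 - (h * c i) *: wderiv (p i).
  by rewrite -[- c i *: _ + _]/(rightf c y i) -hp addrK.
have Qe i : H1fun (q i) = c i *: wderiv (y i).1 + (y i).2 + (h * c i) *: wderiv (q i).
  by rewrite -[c i *: _ + _]/(leftf c y i) -hq subrK.
have hc i : h * c i ^+ 2 * (2 * c i)^-1 = 2^-1 * (h * c i) by have := c0 i => ?; field.
have hc2 i : (2 * c i)^-1 * (h * c i) = h * 2^-1 by have := c0 i => ?; field.
have dE i : wderiv ((y i).1 + h *: v i) = H1fun (s i).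
  rewrite -[wderiv _]/(wderiv (y i).1 + h *: (2^-1 *: (wderiv (q i) + wderiv (p i)))).
  rewrite -[H1fun _]/((2 * c i)^-1 *: (H1fun (q i) - H1fun (p i))).
  rewrite Pe Qe scaleNr sum_waves1 -!scalerDr (scalerDr (2 * c i)^-1) !scalerA hc2.
  by rewrite (_ : (2 * c i)^-1 * c i = 2^-1) ?half//; field.
have xs i : slope x i = s i by rewrite /slope /dx ffunE/= dE toH1K.
have xv i : velocity x i = v i by rewrite /velocity ffunE/= toH1K.
have xp i : rightw c x i = p i.
  rewrite /rightw xs xv scalerA (_ : - c i * _ = - 2^-1); last by have := c0 i => ?; field.
  by rewrite scaleNr -scalerN opprB -scalerDr addrA subrK half.
have xq i : leftw c x i = q i.
  rewrite /leftw xs xv scalerA (_ : c i * _ = 2^-1); last by have := c0 i => ?; field.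
  by rewrite -scalerDr (addrC (q i) (p i)) addrA subrK half.
have hx : H2_H1 x.
  by move=> i; rewrite ffunE/=; split; [exists (s i); rewrite dE|exists (v i)].
have [sx bx] : scattering T c alpha x /\
    crep (rightw c x edge1) 0 = b * crep (leftw c x edge1) 0.
  apply/(scatter_boundary c kappa0); rewrite /departing /arriving.
  have -> : [ffun k : edge m * bool => if k.2 then crep (rightw c x k.1) 0 else crep (leftw c x k.1) 1] =
    [ffun k : edge m * bool => if k.2 then crep (p k.1) 0 else crep (q k.1) 1] :> vec.
    by apply/ffunP => k; rewrite !ffunE xp xq.
  rewrite e; congr (scatter _ _ _ _).
  by apply/ffunP => k; rewrite !ffunE xp xq.
exists x; split=> // [|i]; last by rewrite xv ffunE.
apply/ffunP => i; rewrite -scaleNr addrC stateE [wave_op c x i]ffunE/=.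
rewrite /x [RHS]surjective_pairing !ffunE/= !scaleNr.
rewrite toH1K addrC addrK /dxx /dx dE toH1K; congr (_, _); rewrite addrC.
rewrite -[H1fun _]/(2^-1 *: (H1fun (q i) + H1fun (p i))).
rewrite -[wderiv (s i)]/((2 * c i)^-1 *: (wderiv (q i) - wderiv (p i))).
rewrite Pe Qe scaleNr sum_waves2 -scalerBr scalerDr half !scalerA hc.
by rewrite addrK.
Qed.

(** The departing waves [o] determine the waves on the edges, hence the arriving
    waves, and must be scattered from them. The arriving waves depend on [o]
    only through the factors [expR (- r^-1)], which are small with [h]: the
    system of equations for [o] is solvable. *)
Lemma euler_range b (W : set state) : admissible T b W ->
  exists2 h0 : R, 0 < h0 & forall h y, 0 < h -> h < h0 -> W y ->
    exists x, dom T c alpha b W x /\ x - h *: wave_op c x = y.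
Proof.
move=> adm; have lL := @scatter_linear R m T alpha b.
have [C C0 hC] := linear_bound lL; have [cm cm0 hcm] := finite_upper_bound c.
have C1 : 0 < C + 1 by lra.
exists (cm * (C + 1))^-1; first by rewrite invr_gt0 mulr_gt0.
move=> h y h0 hh Wy.
have r0 i : 0 < h * c i by rewrite mulr_gt0.
have /choice[s hs] := fun i => transport_right (rightf c y i) (r0 i).
have /choice[t ht] := fun i => transport_left (leftf c y i) (r0 i).
have [k||o ho] := @linear_feedback R _ _ C (h * cm) (fun k => expR (- (h * c k.1)^-1))
  [ffun k => if k.2 then s k.1 else t k.1] lL hC C0.
- have /andP[-> le] := expRNV_le (r0 k.1).
  by apply: le_trans le _; rewrite ler_pM2l.
- have e0 : 0 < h * cm by rewrite mulr_gt0.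
  have e1 : h * cm * (C + 1) < 1 by rewrite -mulrA -ltr_pdivlMr ?mulr_gt0// div1r.
  have e2 := mulr_ge0 (ltW e0) C0; rewrite expr2 mulrA (mulrC C).
  by apply: (@le_lt_trans _ _ (h * cm * (C + 1))) => //; nra.
have /choice[p hp] := fun i => hs i (o (i, true)).
have /choice[q hq] := fun i => ht i (o (i, false)).
have [x [dx xy xu]] : exists x, [/\ dom T c alpha b setT x, x - h *: wave_op c x = y &
    forall i, (x i).1 = (y i).1 + h *: velocity x i].
  apply: (euler_state (p := p) (q := q)).
  - by move=> i; have [] := hp i.
  - by move=> i; have [] := hq i.
  transitivity o.
    apply/ffunP => -[i d]; rewrite ffunE/=.
    by case: d; [have [_ ->] := hp i|have [_ ->] := hq i].
  rewrite [LHS]ho; congr scatter.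
  apply/ffunP => -[i d]; rewrite !ffunE/=.
  by case: d; [have [_ _ ->] := hp i|have [_ _ ->] := hq i].
exists x; split=> //; have [_ hx sx bx] := dx; split=> //.
have main : spaceH T y -> spaceH T x.
  move=> Hy j mj i io; have [_ /(_ i io) sv] := sx j.
  by rewrite !xu !(addrC _ (h *: _)) !crep_lin// sv (Hy j mj i io).
move: adm Wy => [->|[-> b1]]; first exact: main.
move=> [Hy y0]; split; first exact: main.
rewrite xu addrC crep_lin// y0; have := velocity_waves c x edge1 z01.
rewrite bx b1 mulN1r addNr => /esym/eqP; rewrite mulf_eq0 pnatr_eq0/= => /eqP ->.
by rewrite mulr0 addr0.
Qed.
End Range.

Section Sufficiency.
Context {R : realType} {m : nat} (T : tree m).
Context (c : edge m -> R) (c_gt0 : forall i : edge m, 0 < c i) (alpha : node m -> R).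

Lemma wave_generates b (W : set (state R m)) : admissible T b W ->
  (forall n, multiple_node T n -> alpha n <> (knode T n)%:R) ->
  generates_C0_semigroup W (dom T c alpha b W) (wave_op c).
Proof.
move=> adm hal; have k0 := kappa_neq0 hal.
have [th [w [th0 w0 hd]]] := energy_dissipation c_gt0 k0 b.
have [h0 h00 hr] := euler_range c_gt0 k0 adm.
apply: (@lumer_phillips _ _ W _ _ (energy c th) w h0) => //.
- exact: energy_inner_product.
- exact: admissible_linear adm.
- exact/dom_linear/(admissible_linear adm).
- by move=> x [].
- exact: wave_op_linear.
- by move=> x; exact: wave_op_space.
- exact: admissible_complete adm.
- by move=> x [_ hx sx bx]; apply: hd.
Qed.

End Sufficiency.

(** * Boundary layers *)

Fact cutoff_sqr_ge (R : realType) (t : R) : 0 <= t <= 1 ->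
  1 - 6 * t <= (1 - 3 * (t * t) + 2 * (t * (t * t))) ^+ 2.
Proof.
move=> /andP[t0 t1]; set chi := 1 - _ + _.
have h1 := sqr_ge0 (chi - 1); have h2 : 0 <= t * (1 - t) by rewrite mulr_ge0//; lra.
have h3 : 0 <= t * (t * t) by rewrite !mulr_ge0.
rewrite sqrrB1 in h1; rewrite /chi in h1 *; lra.
Qed.

Fact layer_norm_arith (R : realType) (k n x f e : R) : 6 <= k -> 0 <= n -> 0 <= e ->
  2 * (k * n) = 1 - e -> 2 * (k * x) = 1 + 5 * e - 6 * n -> x <= f ->
  n <= 2 * f /\ 0 < f.
Proof.
move=> k6 n0 e0 h1 h2 xf; have n1 : 6 * n <= k * n by exact: ler_wpM2r.
have k0 : 0 < k by lra.
have h3 : 4^-1 <= k * x by lra.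
have x0 : 0 < x by rewrite -(pmulr_rgt0 _ k0); lra.
have : k * n <= k * (2 * x) by lra.
by rewrite ler_pM2l// => h; split; lra.
Qed.

Fact residual_arith (R : realType) (k t chi : R) : 6 <= k -> 0 <= t <= 1 ->
  (- k ^+ 2 * chi + (12 * t - 6 + 12 * k * (t * (1 - t)) + k ^+ 2 * chi)) ^+ 2 <= (4 * k) ^+ 2.
Proof.
move=> k6 /andP[t0 t1]; rewrite (_ : - _ * _ + _ = 12 * t - 6 + 12 * k * (t * (1 - t))); last by ring.
have h1 : 0 <= t * (1 - t) by rewrite mulr_ge0//; lra.
have h2 : k * (t * (1 - t)) <= k * 4^-1.
  apply: ler_wpM2l; first lra.
  by have := sqr_ge0 (2 * t - 1); lra.
have h3 : 0 <= k * (t * (1 - t)) by rewrite mulr_ge0//; lra.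
rewrite -subr_ge0 subr_sqr mulr_ge0//; lra.
Qed.

Section BoundaryLayer.
Context {R : realType}.
Local Notation mu01 := (@mu01 R).
Local Notation I f := (\int[mu01]_x f x).
Local Notation sq f := (f \in Lfun mu01 2%:E).

Variables (k o s : R).
Hypothesis end_pt : o = 0 /\ s = 1 \/ o = 1 /\ s = - 1.
Hypothesis k_ge6 : 6 <= k.

Let chi (t : R) : R := 1 - 3 * (t * t) + 2 * (t * (t * t)).
Let E (x : R) : R := expR (- k * (o + s * x)).
Let E1 (x : R) : R := - k * s * E x.
Let F (x : R) : R := chi (o + s * x) * E x.
Let F1 (x : R) : R := s * (- 6 * (o + s * x) * (1 - (o + s * x)) - k * chi (o + s * x)) * E x.
Let F2 (x : R) : R := s ^+ 2 * ((12 * (o + s * x) - 6 +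
   12 * k * ((o + s * x) * (1 - (o + s * x)))) + k ^+ 2 * chi (o + s * x)) * E x.

Let dE (x : R) : is_derive x 1 E (E1 x).
Proof. by rewrite /E1 /E; apply: is_derive_eq; rewrite /GRing.scale/=; ring. Qed.

Let dF (x : R) : is_derive x 1 F (F1 x).
Proof. by rewrite /F /F1 /chi /E; apply: is_derive_eq; rewrite /GRing.scale/=; ring. Qed.

Let dF1 (x : R) : is_derive x 1 F1 (F2 x).
Proof. by rewrite /F2 /F1 /chi /E; apply: is_derive_eq; rewrite /GRing.scale/=; ring. Qed.

Let derive_continuous (f f' : R -> R) : (forall x : R, is_derive x 1 f (f' x)) -> continuous f.
Proof.
move=> df y; apply: differentiable_continuous; apply/derivable1_diffP; exact: ex_derive.
Qed.

Let cE := derive_continuous dE.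
Let cF := derive_continuous dF.
Let cF1 := derive_continuous dF1.

Let cE1 : continuous E1.
Proof. by move=> x; apply: cvgM; [exact: cvg_cst|exact: cE]. Qed.

Let cF2 : continuous F2.
Proof.
have cs : continuous (fun x : R => o + s * x).
  by move=> x; apply: cvgD; [exact: cvg_cst|apply: cvgM; [exact: cvg_cst|exact: cvg_id]].
pose P (t : R) : R := s ^+ 2 * (12 * t - 6 + 12 * k * (t * (1 - t)) + k ^+ 2 * chi t).
have cP : continuous P.
  pose P' (t : R) : R := s ^+ 2 * (12 + 12 * k * (1 - 2 * t) + k ^+ 2 * (6 * t ^+ 2 - 6 * t)).
  apply: (@derive_continuous P P') => x.
  by rewrite /P /P' /chi; apply: is_derive_eq; rewrite /GRing.scale/=; ring.
move=> x; apply: cvgM; last exact: cE.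
by apply: (@cvg_comp _ _ _ (fun x : R => o + s * x) P); [exact: cs|exact: cP].
Qed.

Let s2 : s ^+ 2 = 1.
Proof. by case: end_pt => -[_ ->]; rewrite ?sqrrN expr1n. Qed.

Let shift01 (x : R) : 0 <= x <= 1 -> 0 <= o + s * x <= 1.
Proof. by case: end_pt => -[-> ->]; lra. Qed.

(* By [wip_energy], the integrals of [E ^ 2] with the weights [1] and [1 - 6 t] are
   known explicitly; the second one is a lower bound for the cut-off function,
   as [1 - 6 t <= chi t ^ 2]. *)
Let layer_norm : `|toL2 E| ^+ 2 <= 2 * `|toL2 F| ^+ 2 /\ 0 < `|toL2 F| ^+ 2.
Proof.
have [e [e1 e2 e3]] := H1_C1 dE cE1.
have e2' : wderiv e = - k * s *: H1fun e.
  rewrite e1 e2 (_ : E1 = fun x => (- k * s - 1) * E x + E x).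
    by rewrite toL2_lin ?continuous_Lfun// scalerBl scale1r subrK.
  by apply/funext => x; rewrite /E1; ring.
have N := wip_energy 1 0 e.
have X := wip_energy (1 - 6 * o) (- 6 * s) e.
rewrite e2' wipZ wip_norm e1 in N; rewrite e2' wipZ e1 in X.
rewrite !e3 ?lexx ?ler01// in N; rewrite !e3 ?lexx ?ler01// in X.
have le : wip (1 - 6 * o) (- 6 * s) (toL2 E) (toL2 E) <= `|toL2 F| ^+ 2.
  have qF := continuous_Lfun cF; have qE := repr_toL2 (continuous_Lfun cE).
  rewrite toL2_norm_sqr//; apply: I_le; last 1 first.
  - have D := @ae_mu01 R (fun x => 0 < x < 1) (fun x xx => xx).
    apply: (@filterS2 _ _ (ae_filter_ringOfSetsType mu01) _ _ _ _ qE D) => x -> /andP[x0 x1].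
    have t01 : 0 <= o + s * x <= 1 by rewrite shift01// !ltW.
    rewrite (_ : 1 - 6 * o + - 6 * s * x = 1 - 6 * (o + s * x)); last by ring.
    by rewrite /F exprMn -expr2 ler_wpM2r ?sqr_ge0// cutoff_sqr_ge.
  - apply: int1_contM; last exact: sqM (L2_sq _) (L2_sq _).
    move=> x; apply: cvgD; first exact: cvg_cst.
    by apply: cvgM; [exact: cvg_cst|exact: cvg_id].
  - exact: (sqM qF qF).
have := sqr_ge0 `|toL2 E|.
move: le N X; set n := `|toL2 E| ^+ 2; set x := wip _ _ _ _; set f := `|toL2 F| ^+ 2 => le N X n0.
have h0 : E o = 1.
  by rewrite /E (_ : o + s * o = 0) ?mulr0 ?expR0//; case: end_pt => -[-> ->]; ring.
have [e' [e'0 h1 h2]] : exists e' : R, [/\ 0 <= e', 2 * (k * n) = 1 - e' &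
    2 * (k * x) = 1 + 5 * e' - 6 * n].
  exists (E (1 - o) ^+ 2); split; first exact: sqr_ge0.
    move: N h0; case: end_pt => -[-> ->]; rewrite ?subr0 ?subrr => N h0; rewrite h0 expr1n in N; lra.
  by move: X h0; case: end_pt => -[-> ->]; rewrite ?subr0 ?subrr => X h0; rewrite h0 expr1n in X; lra.
exact: layer_norm_arith h1 h2 le.
Qed.

(** The function [chi t * expR (- k t)] of the distance [t] to the end point [o],
    where [chi t = 1 - 3 t^2 + 2 t^3] cuts it off at the other end while
    leaving its value and its slope at [o] those of the exponential. It
    satisfies [w'' = k^2 w] up to a term of order [k], whereas each of the two
    sides is of order [k^2]. *)
Lemma boundary_layer : exists w w1 : H1 R, [/\ wderiv w = H1fun w1,
  crep w o = 1 /\ crep w (1 - o) = 0, crep w1 o = - (s * k) /\ crep w1 (1 - o) = 0,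
  0 < `|H1fun w| & `|wderiv w1 - k ^+ 2 *: H1fun w| <= 6 * k * `|H1fun w|].
Proof.
have [w [w_fun w_der w_crep]] := H1_C1 dF cF1.
have [w1 [w1_fun w1_der w1_crep]] := H1_C1 dF1 cF2.
have o01 : 0 <= o <= 1 /\ 0 <= 1 - o <= 1 by case: end_pt => -[-> _]; lra.
have e1 : o + s * o = 0 by case: end_pt => -[-> ->]; ring.
have e2 : o + s * (1 - o) = 1 by case: end_pt => -[-> ->]; ring.
have [n1 n2] := layer_norm.
exists w, w1; split.
- by rewrite w_der w1_fun.
- rewrite !w_crep; try by case: o01.
  by rewrite /F /chi /E e1 e2 !mulr0 expR0; split; ring.
- rewrite !w1_crep; try by case: o01.
  by rewrite /F1 /chi /E e1 e2 !mulr0 expR0; split; ring.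
- by rewrite w_fun lt_neqAle normr_ge0 andbT eq_sym -sqrf_eq0 gt_eqF.
rewrite w_fun w1_der -scaleNr addrC -toL2_lin ?continuous_Lfun//.
have k0 : 0 <= k by apply: le_trans k_ge6.
rewrite -(@ler_pXn2r _ 2) ?nnegrE// ?mulr_ge0//.
have sG : sq (fun x => - k ^+ 2 * F x + F2 x).
  by apply: sqD; [apply/sqZ|]; exact: continuous_Lfun.
apply: (@le_trans _ _ ((4 * k) ^+ 2 * `|toL2 E| ^+ 2)); last first.
  apply: (@le_trans _ _ ((4 * k) ^+ 2 * (2 * `|toL2 F| ^+ 2))).
    by rewrite ler_wpM2l ?sqr_ge0.
  have := mulr_ge0 (sqr_ge0 k) (ltW n2); rewrite !exprMn; lra.
have sE := continuous_Lfun cE.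
rewrite !toL2_norm_sqr// -IZ; last exact: (sqM sE sE).
apply: I_le; [exact: (sqM sG sG)|exact/int1Z/(sqM sE sE)|].
apply: ae_mu01 => x /andP[x0 x1].
have t01 : 0 <= o + s * x <= 1 by rewrite shift01// !ltW.
rewrite /F /F2 s2 mul1r [X in X ^+ 2 <= _](_ : _ = (- k ^+ 2 * chi (o + s * x) +
  (12 * (o + s * x) - 6 + 12 * k * ((o + s * x) * (1 - (o + s * x))) +
   k ^+ 2 * chi (o + s * x))) * E x); last by ring.
rewrite exprMn ler_wpM2r ?sqr_ge0//.
exact: residual_arith.
Qed.
End BoundaryLayer.

(** * Necessity *)

Section Necessity.
Context {R : realType} {m : nat} (T : tree m).
Context (c : edge m -> R) (c_gt0 : forall i : edge m, 0 < c i) (alpha : node m -> R).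
Local Notation state := (state R m).
Local Notation out j := (outgoing T (fin_pt j)).
Implicit Types (x y : state) (i j : edge m) (b l : R).

Let z01 : 0 <= (0 : R) <= 1.
Proof. by rewrite lexx ler01. Qed.

Let o01 : 0 <= (1 : R) <= 1.
Proof. by rewrite lexx ler01. Qed.

(** The components of the test state: a boundary layer at the final point of [j]
    on each edge that meets it, and 0 elsewhere. The waves arriving at this
    node vanish, for [c i * crep w1] and [l * crep w] are opposite or equal
    there. *)
Lemma edge_layer j i l : (forall k, 6 * c k <= l) -> exists w w1 : H1 R,
  [/\ wderiv w = H1fun w1,
    crep w 0 = (i \in out j)%:R /\ crep w 1 = (i == j)%:R,
    c i * crep w1 0 = - (l * (i \in out j)%:R) /\ c i * crep w1 1 = l * (i == j)%:R,
    i = j -> 0 < `|H1fun w| &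
    `|wderiv w1 - (l / c i) ^+ 2 *: H1fun w| <= 6 * (l / c i) * `|H1fun w|].
Proof.
move=> hl; have l6 : 6 <= l / c i by rewrite ler_pdivlMr.
have c0 : c i != 0 by rewrite gt_eqF.
have [ij|ij] := eqVneq i j.
  subst i.
  have -> : j \in out j = false by rewrite inE; exact/negbTE/no_loop.
  have [w [w1 [h1 [h2 h3] [h4 h5] h6 h7]]] := boundary_layer (or_intror (conj erefl erefl)) l6.
  rewrite subrr in h3 h5; exists w, w1; split=> //.
  - by rewrite h4 h5 mulr1 !mulr0 oppr0; split=> //; rewrite mulN1r opprK mulrC divfK.
have [io|io] := boolP (i \in out j).
  have [w [w1 [h1 [h2 h3] [h4 h5] h6 h7]]] := boundary_layer (or_introl (conj erefl erefl)) l6.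
  rewrite subr0 in h3 h5.
  exists w, w1; split=> //.
  - by rewrite h4 h5 mulr1 !mulr0; split=> //; rewrite mul1r mulrN mulrC divfK.
exists 0, 0; split=> //.
- by rewrite !crep0.
- by rewrite !crep0// !mulr0 oppr0.
- by move=> e; rewrite e eqxx in ij.
have -> : H1fun (0 : H1 R) = 0 by [].
have -> : wderiv (0 : H1 R) = 0 by [].
by rewrite scaler0 subr0 normr0 mulr0.
Qed.

(** If [kappa T alpha j = 0], then waves can leave the node [fin_pt j] though none
    arrives, whatever the velocity [l] of the node. Boundary layers at this node
    make such states satisfy [A x = l x] up to an error that does not grow
    with [l]. *)
Lemma approximate_eigenvectors b (W : set state) j : admissible T b W ->
  multiple_node T (fin_pt j) -> alpha (fin_pt j) = (knode T (fin_pt j))%:R ->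
  exists K, forall l, K <= l -> exists x, [/\ dom T c alpha b W x, 0 < `|x| &
    `|l *: x - wave_op c x| <= K * `|x|].
Proof.
move=> adm mj aj; have [cm cm0 hcm] := finite_upper_bound c.
have kj : kappa T alpha j = 0.
  by rewrite /kappa aj subrr; case: eqP => // o0; move/multiple_out: mj; rewrite o0.
exists (6 * cm) => l hl.
have hl' k : 6 * c k <= l by apply: le_trans hl; rewrite ler_pM2l.
have l0 : 0 < l by apply: lt_le_trans hl; rewrite mulr_gt0.
have /choice[w /choice[w1 hw]] := fun i => edge_layer j i hl'.
pose x : state := [ffun i => (w i, l *: H1fun (w i))].
have lfun i : l *: H1fun (w i) = H1fun (l *: w i) by [].
have xv i : velocity x i = l *: w i by rewrite /velocity ffunE/= lfun toH1K.
have xs i : slope x i = w1 i.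
  by rewrite /slope /dx ffunE/=; have [-> _ _ _ _] := hw i; rewrite toH1K.
have wZ i (t : R) : 0 <= t <= 1 -> crep (l *: w i) t = l * crep (w i) t.
  by move=> t01; rewrite -[l *: w i]addr0 crep_lin// crep0// addr0.
have r1 i : crep (rightw c x i) 1 = 0.
  have [_ [_ h1] [_ h2] _ _] := hw i.
  by rewrite crep_rightw// xs xv wZ// mulNr h1 h2 addNr.
have q0 i : crep (leftw c x i) 0 = 0.
  have [_ [h1 _] [h2 _] _ _] := hw i.
  by rewrite crep_leftw// xs xv wZ// h1 h2 addNr.
have outE i j' : i \in out j' -> (i \in out j) = (j' == j).
  by rewrite !out_edgesE => /andP[-> /eqP ->].
have Hx : spaceH T x.
  move=> j' mj' i io; rewrite !ffunE/=; have [_ [-> _] _ _ _] := hw i.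
  by have [_ [_ ->] _ _ _] := hw j'; rewrite (outE _ _ io).
have w10 : edge1 \in out j = false by rewrite out_edgesE eqxx.
exists x; split.
- split.
  + case: adm => [->//|[-> _]]; split=> //; rewrite ffunE/=.
    by have [_ [-> _] _ _ _] := hw edge1; rewrite w10.
  + move=> i; rewrite ffunE/=; split; first by exists (w1 i); have [-> _ _ _ _] := hw i.
    by exists (l *: w i).
  + move=> j'; have [_ [_ h1] _ _ _] := hw j'; split=> [|i io].
      rewrite r1 add0r big1 => [|i _]; last exact: q0.
      by rewrite xv wZ// h1; case: eqP => [->|]; rewrite ?kj ?mul0r// !mulr0.
    by rewrite !xv !wZ// h1; have [_ [-> _] _ _ _] := hw i; rewrite (outE _ _ io).
  + rewrite q0 mulr0 crep_rightw// xs xv wZ// mulNr.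
    by have [_ [-> _] [-> _] _ _] := hw edge1; rewrite w10 !mulr0 !oppr0 addr0.
- have [_ _ _ /(_ erefl) wj _] := hw j.
  apply: lt_le_trans wj _; apply: le_trans (state_fst_le x j); rewrite ffunE/=.
  exact: H1fun_le.
rewrite -(@ler_pXn2r _ 2) ?nnegrE// ?mulr_ge0// ?(ltW cm0)//.
rewrite exprMn !state_norm_sqr mulr_sumr; apply: ler_sum => i _.
have -> : (l *: x - wave_op c x) i =
    (0, - c i ^+ 2 *: (wderiv (w1 i) - (l / c i) ^+ 2 *: H1fun (w i))).
  rewrite stateE [(- wave_op c x) i](_ : _ = (- (wave_op c x i).1, - (wave_op c x i).2)); last first.
    by rewrite ffunE.
  rewrite !ffunE/= lfun toH1K subrr /dxx -[dx (w i)](_ : w1 i = _); last first.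
    by have [h _ _ _ _] := hw i; rewrite /dx h toH1K.
  congr (_, _); rewrite scalerBr !scalerA !mulNr !scaleNr opprK addrC.
  by congr (_ + _ *: _); rewrite -exprMn mulrCA divff ?gt_eqF// mulr1 expr2.
rewrite /= normr0 expr0n add0r !ffunE/=.
apply: (@le_trans _ _ ((6 * cm) ^+ 2 * `|l *: H1fun (w i)| ^+ 2)); last first.
  by rewrite ler_wpM2l ?sqr_ge0// lerDr sqr_ge0.
rewrite -exprMn ler_pXn2r ?nnegrE ?mulr_ge0 ?(ltW cm0)// !normrZ normrN.
rewrite (ger0_norm (sqr_ge0 (c i))).
rewrite (gtr0_norm l0); have [_ _ _ _ h] := hw i.
apply: le_trans (ler_wpM2l (sqr_ge0 _) h) _.
have ci : c i != 0 by rewrite gt_eqF.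
have -> : c i ^+ 2 * (6 * (l / c i) * `|H1fun (w i)|) = 6 * c i * (l * `|H1fun (w i)|).
  by move: (`|_|) => n; field.
by rewrite ler_wpM2r ?mulr_ge0 ?(ltW l0)// ler_pM2l.
Qed.

(** An error that does not grow with [l] is against the resolvent estimate, by
    which [l x - A x] is at least of the order of [l]. *)
Lemma generation_necessary b (W : set state) : admissible T b W ->
  generates_C0_semigroup W (dom T c alpha b W) (wave_op c) ->
  forall n, multiple_node T n -> alpha n <> (knode T n)%:R.
Proof.
move=> adm [S [SC hS]] n mn an.
have [j nj] := multiple_fin_pt mn; rewrite nj in mn an.
have [K hK] := approximate_eigenvectors adm mn an.
have Wl := admissible_linear adm; have Wc := admissible_complete adm.
have [M [w [M0 w0 growth]]] := C0_semigroup_growth Wl Wc SC.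
pose l := Num.max K (w + M * `|K| + 1).
have lK : K <= l by rewrite le_max lexx.
have lw : w + M * `|K| + 1 <= l by rewrite le_max lexx orbT.
have MK : 0 <= M * `|K| by rewrite mulr_ge0// ltW.
have [x [dx x0 hx]] := hK l lK.
have [Wx WAx gen] := (hS x (wave_op c x)).1 (conj dx erefl).
have wl : w < l by lra.
have := generator_resolvent_bound Wl SC M0 w0 growth wl Wx gen.
have : M * `|l *: x - wave_op c x| <= M * (`|K| * `|x|).
  rewrite ler_pM2l//; apply: le_trans hx _.
  by rewrite ler_wpM2r// ler_norm.
move=> h1 h2; have := le_trans h2 h1; rewrite mulrA ler_pM2r//; lra.
Qed.

Lemma generation_iff b (W D : set state) : admissible T b W -> D = dom T c alpha b W ->
  generates_C0_semigroup W D (wave_op c) <->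
  (forall n, multiple_node T n -> alpha n <> (knode T n)%:R).
Proof.
move=> adm ->; split; first exact: generation_necessary.
exact: wave_generates.
Qed.

End Necessity.

Theorem theorem2 (R : realType) (m : nat) (T : tree m)
    (c : edge m -> R) (c_gt0 : forall i : edge m, 0 < c i)
    (alpha : node m -> R) :
  [/\ generates_C0_semigroup (spaceH T) (domain_T T c alpha) (wave_op c) <->
        (forall n : node m, multiple_node T n -> alpha n <> (knode T n)%:R),
      generates_C0_semigroup (spaceH T) (domain_N T c alpha) (wave_op c) <->
        (forall n : node m, multiple_node T n -> alpha n <> (knode T n)%:R)
    & generates_C0_semigroup (spaceH0 T) (domain_D T c alpha) (wave_op c) <->
        (forall n : node m, multiple_node T n -> alpha n <> (knode T n)%:R)].
Proof.
split.
- by apply: (@generation_iff _ _ _ _ _ _ 0); [exact: c_gt0|left|exact: domain_TE].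
- by apply: (@generation_iff _ _ _ _ _ _ 1); [exact: c_gt0|left|exact: domain_NE].
- by apply: (@generation_iff _ _ _ _ _ _ (-1)); [exact: c_gt0|right|exact: domain_DE].
Qed.
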